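(* Let $\mu,\nu\in\mathcal{P}_2(\mathbb{R}^d)$ with $[\mu]=[\nu]$ and set $$\mathcal{V}(\mu,\nu)=\inf\{\mathrm{var}(\rho):\rho\in\mathcal{P}_2(\mathbb{R}^d),\ \rho\succeq_c\mu,\ \rho\succeq_c\nu\}.$$ (i) With $f=\nu-\mu$, $$\mathcal{I}(f)=\mathcal{V}(\mu,\nu)-\frac{\mathrm{var}(\mu)+\mathrm{var}(\nu)}{2}=\mathcal{J}(\mu,\nu).$$ Moreover, $\pi\in\Sigma(\mu,\nu)$ is a minimizer of $\mathcal{J}(\mu,\nu)$ if and only if its third marginal is a minimizer of $\mathcal{V}(\mu,\nu)$. (ii) The infimum $\mathcal{V}(\mu,\nu)$ is attained, and for every minimizer $\rho$ there exists at least one minimizer $\pi$ of $\mathcal{J}(\mu,\nu)$ whose marginals are $\mu,\nu,\rho$ respectively.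
   Context: $\mathrm{var}(\rho)=\int|x-[\rho]|^2\rho(dx)$, $[\rho]=\int x\,\rho(dx)$. Convex order: $\rho\succeq_c\mu$ means $\int\varphi\,d\rho\ge\int\varphi\,d\mu$ for every convex $\varphi:\mathbb{R}^d\to\mathbb{R}$. $\mathcal{I}(f)=\sup\{\int u\,d\nu-\int u\,d\mu:u\in C^{1,1}(\mathbb{R}^d),\ \mathrm{lip}(\nabla u)\le1\}$. $\mathcal{J}(\mu,\nu)=\inf\{\iiint c\,d\pi:\pi\in\Sigma(\mu,\nu)\}$ with $c(x,y,z)=\tfrac12(|z-x|^2+|z-y|^2)$, where $\Sigma(\mu,\nu)$ is the set of $\pi\in\mathcal{P}_2((\mathbb{R}^d)^3)$ with first marginal $\mu$, second marginal $\nu$, and $\iiint\langle z-x,\Phi(x)\rangle\,d\pi=\iiint\langle z-y,\Psi(y)\rangle\,d\pi=0$ for all smooth compactly supported $\Phi,\Psi:\mathbb{R}^d\to\mathbb{R}^d$. *)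

(* Defs.v *)
From HB Require Import structures.
From mathcomp Require Import all_boot all_order all_algebra.
From mathcomp Require Import all_classical all_reals all_analysis.
Set Implicit Arguments. Unset Strict Implicit. Unset Printing Implicit Defensive.
Import Order.TTheory GRing.Theory Num.Theory.
Import numFieldNormedType.Exports.
Local Open Scope classical_set_scope.
Local Open Scope ring_scope.

Definition dotp {R : realType} {d : nat} (x y : 'rV[R]_d) : R :=
  \sum_(i < d) x ord0 i * y ord0 i.
Definition enorm {R : realType} {d : nat} (x : 'rV[R]_d) : R :=
  Num.sqrt (dotp x x).

Definition Rd (R : realType) (d : nat) :=
  g_sigma_algebraType (@open 'rV[R]_d).

Definition P2 {R : realType} {d : nat} (mu : probability (Rd R d) R) : Prop :=
  (\int[mu]_x ((enorm (x : 'rV[R]_d)) ^+ 2)%:E < +oo)%E.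

Definition bary {R : realType} {d : nat} (mu : probability (Rd R d) R) : 'rV[R]_d :=
  \row_i fine (\int[mu]_x ((x : 'rV[R]_d) ord0 i)%:E).

Definition var {R : realType} {d : nat} (mu : probability (Rd R d) R) : \bar R :=
  \int[mu]_x ((enorm ((x : 'rV[R]_d) - bary mu)) ^+ 2)%:E.

Definition cvx_ge {R : realType} {d : nat} (rho mu : probability (Rd R d) R) : Prop :=
  forall phi : 'rV[R]_d -> R, convex_function setT phi ->
    (\int[mu]_x (phi x)%:E <= \int[rho]_x (phi x)%:E)%E.

Definition C11_1 {R : realType} {d : nat} (u : 'rV[R]_d -> R^o) : Prop :=
  exists g : 'rV[R]_d -> 'rV[R]_d,
    (forall x, differentiable u x /\ forall h, 'd u x h = dotp (g x) h) /\
    (forall x y, enorm (g x - g y) <= enorm (x - y)).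

Definition calI {R : realType} {d : nat} (mu nu : probability (Rd R d) R) : \bar R :=
  ereal_sup [set (\int[nu]_x (u x)%:E - \int[mu]_x (u x)%:E)%E | u in @C11_1 R d].

Definition calV {R : realType} {d : nat} (mu nu : probability (Rd R d) R) : \bar R :=
  ereal_inf [set var rho | rho in
    [set rho : probability (Rd R d) R | P2 rho /\ cvx_ge rho mu /\ cvx_ge rho nu]].

Definition Rd3 (R : realType) (d : nat) := (Rd R d * Rd R d * Rd R d)%type.

Definition marg1 {R : realType} {d : nat} (pi : probability (Rd3 R d) R)
  (mu : probability (Rd R d) R) : Prop :=
  forall A : set (Rd R d), measurable A -> pi ((fun t => t.1.1) @^-1` A) = mu A.
Definition marg2 {R : realType} {d : nat} (pi : probability (Rd3 R d) R)
  (mu : probability (Rd R d) R) : Prop :=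
  forall A : set (Rd R d), measurable A -> pi ((fun t => t.1.2) @^-1` A) = mu A.
Definition marg3 {R : realType} {d : nat} (pi : probability (Rd3 R d) R)
  (mu : probability (Rd R d) R) : Prop :=
  forall A : set (Rd R d), measurable A -> pi ((fun t => t.2) @^-1` A) = mu A.

Definition P2_3 {R : realType} {d : nat} (pi : probability (Rd3 R d) R) : Prop :=
  (\int[pi]_t ((enorm (t.1.1 : 'rV[R]_d)) ^+ 2 + (enorm (t.1.2 : 'rV[R]_d)) ^+ 2
               + (enorm (t.2 : 'rV[R]_d)) ^+ 2)%:E < +oo)%E.

Fixpoint Ck {R : realType} {d : nat} (n : nat) (F : 'rV[R]_d -> 'rV[R]_d) : Prop :=
  match n with
  | 0 => continuous F
  | k.+1 => (forall x v, derivable F x v) /\ (forall v, Ck k (fun x => 'D_v F x))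
  end.

Definition testfun {R : realType} {d : nat} (F : 'rV[R]_d -> 'rV[R]_d) : Prop :=
  (forall n, Ck n F) /\ compact (closure [set x | F x != 0]).

Definition Sigma {R : realType} {d : nat} (mu nu : probability (Rd R d) R)
  (pi : probability (Rd3 R d) R) : Prop :=
  [/\ P2_3 pi, marg1 pi mu, marg2 pi nu,
   (forall Phi : 'rV[R]_d -> 'rV[R]_d, testfun Phi ->
      (\int[pi]_t (dotp ((t.2 : 'rV[R]_d) - t.1.1) (Phi t.1.1))%:E = 0)%E) &
   (forall Psi : 'rV[R]_d -> 'rV[R]_d, testfun Psi ->
      (\int[pi]_t (dotp ((t.2 : 'rV[R]_d) - t.1.2) (Psi t.1.2))%:E = 0)%E)].

Definition cost {R : realType} {d : nat} (t : Rd3 R d) : R :=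
  ((enorm ((t.2 : 'rV[R]_d) - t.1.1)) ^+ 2 + (enorm ((t.2 : 'rV[R]_d) - t.1.2)) ^+ 2) / 2.

Definition calJ {R : realType} {d : nat} (mu nu : probability (Rd R d) R) : \bar R :=
  ereal_inf [set (\int[pi]_t (cost t)%:E)%E | pi in Sigma mu nu].

Definition minJ {R : realType} {d : nat} (mu nu : probability (Rd R d) R)
  (pi : probability (Rd3 R d) R) : Prop :=
  Sigma mu nu pi /\ (\int[pi]_t (cost t)%:E = calJ mu nu)%E.

Definition minV {R : realType} {d : nat} (mu nu rho : probability (Rd R d) R) : Prop :=
  [/\ P2 rho, cvx_ge rho mu, cvx_ge rho nu & var rho = calV mu nu].

(* Main.v *)
(* If [u] has a 1-Lipschitz gradient then [|x|^2/2 + u] and [|x|^2/2 - u] are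
   convex, so every [rho] above [mu] and [nu] in convex order satisfies
   [int u d(nu - mu) + (m2 mu + m2 nu)/2 <= m2 rho]. If [pi] is in [Sigma] then
   the conditional expectation of [z] given [x], and given [y], is [x], resp.
   [y]; by the conditional Jensen inequality the third marginal dominates both
   [mu] and [nu], and the cost of [pi] is [m2 rho - (m2 mu + m2 nu)/2]. Hence
   I <= V - const <= J.

   The converse and the couplings come from one Hahn-Banach argument. On
   functions of quadratic growth of [(x, y, z)], let [p G] be the infimum of
   [int f dmu + int g dnu + b] over the bounds
   [G <= f x + g y + h z + <z - x, Phi x> + <z - y, Psi y>], where [(h, b)] runs
   over a cone. A linear [M <= p] is a finitely additive coupling; rounding the
   coordinates to finer and finer dyadic grids realises it by random variables
   on the unit interval, up to a loss in the second moments. That [p] is finite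
   is a weak duality.
   - For [b = int h drho] (Strassen's theorem) it holds because
     [sup_x (- f x - <z - x, Phi x>)] is a convex function of [z].
   - For [h = s |z|^2] (the optimal coupling) it holds because two families of
     affine functions with [a z + a' z <= |z|^2] are separated by
     [|z|^2/2 - u] and [|z|^2/2 + u] for a [u] with 1-Lipschitz gradient. *)
Require Import Defs.
From HB Require Import structures.
From mathcomp Require Import all_boot all_order all_algebra.
From mathcomp Require Import all_classical all_reals all_analysis.
From mathcomp Require Import measurable_realfun ring lra.
Set Implicit Arguments. Unset Strict Implicit. Unset Printing Implicit Defensive.
Import Order.TTheory GRing.Theory Num.Theory.
Import numFieldNormedType.Exports.
Local Open Scope classical_set_scope.
Local Open Scope ring_scope.
Import HBNNSimple.

(** * Integrals of real functions *)

(** A finitely additive functional may hide mass at infinity, and on functions of quadratic growth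
    that mass is seen exactly at order two. Every constraint stays below this order: marginals are
    tested against bounded functions, drifts against a coordinate times a bounded function, and both
    survive the passage to random variables because the truncation errors are small multiples of the
    quadratic weight. Only [M |z|^2] can drop. In a minimization the drop goes the right way, and
    the lower bound for the second moment of any measure above [mu] and [nu] in convex order then
    rules it out. Attainment thus comes without tightness or compactness of measures, together with
    the equality of the three values.

    Variances are replaced throughout by second moments: convex order forces a common barycenter, so
    the two differ by a constant. Cost, variance and dual value are then all compared with one
    number, the second moment of the third marginal. *)

Section real_integrals.
Context d (T : measurableType d) (R : realType).
Variable mu : {measure set T -> \bar R}.
Implicit Types f g h : T -> R.

Definition intg f := mu.-integrable setT (EFin \o f).

Lemma intg_measurable f : intg f -> measurable_fun setT f.
Proof. by move=> /measurable_int/measurable_EFinP. Qed.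

Lemma intg_le f g : measurable_fun setT f -> (forall x, `|f x| <= g x) ->
  intg g -> intg f.
Proof.
move=> mf fg ig; apply: le_integrable ig => //; first exact/measurable_EFinP.
by move=> x _; rewrite /= lee_fin (le_trans (fg x))// ler_norm.
Qed.

Lemma intgD f g : intg f -> intg g -> intg (fun x => f x + g x).
Proof. exact: integrableD. Qed.

Lemma intgZ k f : intg f -> intg (fun x => k * f x).
Proof. exact: integrableZl. Qed.

Lemma intgN f : intg f -> intg (fun x => - f x).
Proof. exact: integrableN. Qed.

Lemma intgB f g : intg f -> intg g -> intg (fun x => f x - g x).
Proof. exact: integrableB. Qed.

Lemma intg_sum I (s : seq I) (P : pred I) (f : I -> T -> R) :
  (forall i, P i -> intg (f i)) -> intg (fun x => \sum_(i <- s | P i) f i x).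
Proof.
move=> fi; rewrite /intg (_ : _ \o _ = fun x => (\sum_(i <- s | P i) (f i x)%:E)%E).
  exact: integrable_sum.
by apply/funext => x /=; rewrite sumEFin.
Qed.

Lemma Rint_EFin f : intg f -> (\int[mu]_x (f x)%:E = (\int[mu]_x f x)%:E)%E.
Proof. by move=> fi; rewrite fineK//; exact: integrable_fin_num. Qed.

Lemma RintD f g : intg f -> intg g ->
  \int[mu]_x (f x + g x) = \int[mu]_x f x + \int[mu]_x g x.
Proof. exact: RintegralD. Qed.

Lemma RintB f g : intg f -> intg g ->
  \int[mu]_x (f x - g x) = \int[mu]_x f x - \int[mu]_x g x.
Proof. exact: RintegralB. Qed.

Lemma RintZ k f : intg f -> \int[mu]_x (k * f x) = k * \int[mu]_x f x.
Proof. exact: RintegralZl. Qed.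

Lemma Rint0 : \int[mu]_x (0 : R) = 0.
Proof. by rewrite /Rintegral integral0. Qed.

Lemma RintN f : intg f -> \int[mu]_x (- f x) = - \int[mu]_x f x.
Proof.
by move=> fi; under eq_Rintegral do rewrite -mulN1r; rewrite RintZ// mulN1r.
Qed.

Lemma Rint_sum I (s : seq I) (P : pred I) (f : I -> T -> R) :
  (forall i, P i -> intg (f i)) ->
  \int[mu]_x (\sum_(i <- s | P i) f i x) = \sum_(i <- s | P i) \int[mu]_x f i x.
Proof.
move=> fi; elim: s => [|i s IH].
  by rewrite big_nil; under eq_Rintegral do rewrite big_nil; exact: Rint0.
rewrite big_cons; under eq_Rintegral do rewrite big_cons.
case: ifPn => // Pi; rewrite RintD ?IH//; first exact: fi.
exact: intg_sum.
Qed.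

Lemma Rint_le f g : intg f -> intg g -> (forall x, f x <= g x) ->
  \int[mu]_x f x <= \int[mu]_x g x.
Proof. by move=> fi gi fg; apply: le_Rintegral. Qed.

Lemma intg_norm f : intg f -> intg (fun x => `|f x|).
Proof. exact: integrable_norm. Qed.

Lemma intg_indic (A : set T) : measurable A -> (mu A < +oo)%E -> intg \1_A.
Proof.
move=> mA Aoo; apply/integrableP; split; first exact/measurable_EFinP.
under eq_integral do rewrite /= ger0_norm//.
by rewrite integral_indic// setIT.
Qed.

Lemma Rint_indic (A : set T) : measurable A -> \int[mu]_x \1_A x = fine (mu A).
Proof. by move=> mA; rewrite /Rintegral integral_indic// setIT. Qed.

Lemma Rint_dominated (f_ : nat -> T -> R) f g :
  (forall n, measurable_fun setT (f_ n)) -> measurable_fun setT f ->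
  {ae mu, forall x, f_ ^~ x @ \oo --> f x} -> intg g ->
  (forall n x, `|f_ n x| <= g x) ->
  intg f /\ ((\int[mu]_x f_ n x) @[n --> \oo] --> \int[mu]_x f x).
Proof.
move=> mf_ mf ff ig fg.
have [||||fi _ fc] := @dominated_convergence _ _ _ mu setT measurableT
  (fun n => EFin \o f_ n) (EFin \o f) (EFin \o g) _ _ _ ig.
- by move=> n; exact/measurable_EFinP.
- exact/measurable_EFinP.
- apply: filterS ff => x fx _.
  by apply: cvg_EFin => //; apply: nearW.
- by apply: aeW => x n _ /=; rewrite lee_fin.
split => //.

apply: fine_cvg; rewrite -Rint_EFin//.
Qed.

End real_integrals.

(** * The Hahn-Banach theorem *)

Section hahn_banach.
Variables (R : realType) (E : lmodType R) (V : set E) (p : E -> R).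
Hypothesis V0 : V 0.
Hypothesis VD : forall x y k, V x -> V y -> V (x + k *: y).
Hypothesis pD : forall x y, V x -> V y -> p (x + y) <= p x + p y.
Hypothesis pZ : forall k x, 0 < k -> V x -> p (k *: x) = k * p x.
Hypothesis p0 : p 0 = 0.

(** Partial functionals are encoded by their graphs, so that a chain is bounded by its plain union.
    Single-valuedness comes for free: two values [a], [b] at one point put [(0, a - b)] and
    [(0, b - a)] in the graph, and domination by [p] with [p 0 = 0] forces [a = b]. *)
Let dom_graph (g : set (E * R)) :=
  (forall x a y b k, g (x, a) -> g (y, b) -> g (x + k *: y, a + k * b)) /\
  (forall x a, g (x, a) -> V x /\ a <= p x).

Let maximal_graph : exists g, dom_graph g /\ forall h, g `<` h -> ~ dom_graph h.
Proof.
apply: Zorn_bigcup => F Fd Ft; split.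
- move=> x a y b k [X FX Xa] [Y FY Yb]; have [XY|YX] := Ft _ _ FX FY.
  + by exists Y => //; apply: (Fd _ FY).1 => //; exact: XY.
  + by exists X => //; apply: (Fd _ FX).1 => //; exact: YX.
- by move=> x a [X FX Xa]; exact: (Fd _ FX).2.
Qed.

Let graph0 g : dom_graph g -> (forall h, g `<` h -> ~ dom_graph h) -> g (0, 0).
Proof.
move=> [gl gd] gm; have [[[x a] gxa]|g0] := pselect (exists z, g z).
  have := gl _ _ _ _ (-1) gxa gxa.
  by rewrite scaleN1r subrr mulN1r subrr.
exfalso; apply: (gm [set (0, 0)]).
  rewrite properEneq; split; last by move=> z gz; case: g0; exists z.
  by apply/eqP => ge; apply: g0; exists (0, 0); rewrite ge.
split.
  move=> x a y b k [-> ->] [-> ->] /=.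
  by rewrite scaler0 mulr0 !addr0.
by move=> x a [-> ->]; rewrite p0.
Qed.

Let graph_total g : dom_graph g -> (forall h, g `<` h -> ~ dom_graph h) ->
  forall x0, V x0 -> exists a, g (x0, a).
Proof.
move=> gP gm x0 Vx0; have g0 := graph0 gP gm; case: gP => gl gd.
apply: contrapT => nx0.
have V1 x y : V x -> V y -> V (x + y).
  by move=> Vx Vy; have := VD 1 Vx Vy; rewrite scale1r.
have VN x : V x -> V (- x).
  by move=> Vx; have := VD (-1) V0 Vx; rewrite add0r scaleN1r.
have gV x a : g (x, a) -> V x by move=> /gd[].
(* The value at [x0] has to lie between all [a - p (x - x0)] and all [p (y + x0) - b]. Subadditivity
   of [p] separates the two sets, and [c] is the supremum of the first. *)
pose S := [set r | exists x a, g (x, a) /\ r = a - p (x - x0)].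
have ubS y b : g (y, b) -> ubound S (p (y + x0) - b).
  move=> gyb r [x [a [gxa ->]]].
  have := (gd _ _ (gl _ _ _ _ 1 gxa gyb)).2; rewrite scale1r mul1r.
  have -> : x + y = (x - x0) + (y + x0) by rewrite addrACA addNr addr0.
  move=> /le_trans/(_ (pD _ _)) h.
  have := h (V1 _ _ (gV _ _ gxa) (VN _ Vx0)) (V1 _ _ (gV _ _ gyb) Vx0).
  lra.
have S0 : S !=set0 by exists (0 - p (0 - x0)), 0, 0.
have hS : has_sup S by split => //; eexists; exact: ubS g0.
set c := sup S.
have cl x a : g (x, a) -> a - c <= p (x - x0).
  move=> gxa; have : a - p (x - x0) <= c.
    by apply: ub_le_sup; [case: hS | exists x, a].
  lra.
have cu x a : g (x, a) -> a + c <= p (x + x0).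
  move=> gxa; have : c <= p (x + x0) - a by apply: ge_sup => //; exact: ubS.
  lra.
pose h := [set z | exists x a t, g (x, a) /\ z = (x + t *: x0, a + t * c)].
apply: (gm h).
  rewrite properEneq; split; last first.
    by move=> [x a] gxa; exists x, a, 0; rewrite scale0r mul0r !addr0.
  apply/eqP => ge; apply: nx0; exists c; rewrite ge; exists 0, 0, 1.
  by rewrite scale1r mul1r !add0r.
split.
  move=> _ _ _ _ k [x [a [t [gxa [-> ->]]]]] [y [b [s [gyb [-> ->]]]]].
  exists (x + k *: y), (a + k * b), (t + k * s); split; first exact: gl.
  by rewrite scalerDr scalerDl scalerA addrACA; congr (_, _); ring.
move=> _ _ [x [a [t [gxa [-> ->]]]]]; split.
  by apply: VD => //; exact: gV gxa.
(* By homogeneity the bound at [x + t *: x0] reduces to [t = 1] and [t = -1], applied to the graph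
   point over [|t|^-1 *: x]. *)
have gs k : g (k *: x, k * a).
  by have := gl _ _ _ _ k g0 gxa; rewrite !add0r.
have [t0|t0|->] := ltgtP t 0; last by rewrite scale0r mul0r !addr0; exact: (gd _ _ gxa).2.
- have := cl _ _ (gs (- t^-1)); rewrite -(ler_pM2l (_ : 0 < - t)) ?oppr_gt0//
    -pZ ?oppr_gt0//; last first.
    by apply: V1 (gV _ _ (gs _)) (VN _ Vx0).
  rewrite scalerBr !scalerA mulrNN divff ?lt_eqF// scale1r -scaleNr opprK.
  by rewrite mulrBr mulrA mulrNN divff ?lt_eqF// mul1r -mulNr opprK.
- have := cu _ _ (gs (t^-1)); rewrite -(ler_pM2l t0) -pZ //; last first.
    by apply: V1 (gV _ _ (gs _)) Vx0.
  by rewrite scalerDr scalerA divff ?gt_eqF// scale1r mulrDr mulrA divff ?gt_eqF// mul1r.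
Qed.

Lemma hahn_banach : exists M : E -> R,
  (forall x y k, V x -> V y -> M (x + k *: y) = M x + k * M y) /\
  (forall x, V x -> M x <= p x).
Proof.
have [g [gP gm]] := maximal_graph.
have gt := graph_total gP gm.
have g0 := graph0 gP gm; case: gP => gl gd.
have gf x a b : g (x, a) -> g (x, b) -> a = b.
  move=> ga gb; have h u v : g (x, u) -> g (x, v) -> u <= v.
    move=> gu gv; have := (gd _ _ (gl _ _ _ _ (-1) gu gv)).2.
    by rewrite scaleN1r subrr p0 mulN1r subr_le0.
  by apply/eqP; rewrite eq_le !h.
have /choice[M MP] x : exists a, V x -> g (x, a).
  have [Vx|nV] := pselect (V x); last by exists 0.
  by have [a ga] := gt _ Vx; exists a.
exists M; split; last by move=> x Vx; exact: (gd _ _ (MP _ Vx)).2.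
move=> x y k Vx Vy; apply: gf (MP _ (VD k Vx Vy)) _.
by apply: gl; exact: MP.
Qed.
End hahn_banach.

(** * Convex functions and scalar products *)

Definition cvx (R : realType) (E : lmodType R) (phi : E -> R) :=
  forall x y t, 0 <= t <= 1 ->
    phi (t *: x + (1 - t) *: y) <= t * phi x + (1 - t) * phi y.

(** * Subgradients from the Hahn-Banach theorem *)

Section subgradient.
Variables (R : realType) (E : lmodType R) (phi : E -> R).
Hypothesis cphi : cvx phi.
Variable x : E.

(** [p v] is the one-sided directional derivative of [phi] at [x]. An infimum over all [t > 0] in
    place of a limit avoids the monotonicity of the quotients. It is sublinear, and a linear
    functional below it is a subgradient. *)
Let q v t := (phi (x + t *: v) - phi x) / t.
Let Q v := [set q v t | t in [set t | 0 < t]].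
Let p v := inf (Q v).

(** [x] is the mean of [x + t v] and [x - v] with weights [1/(1 + t)] and [t/(1 + t)]. *)
Let q_lb v t : 0 < t -> - (phi (x - v) - phi x) <= q v t.
Proof.
move=> t0; rewrite /q ler_pdivlMr//.
have t10 : 0 < 1 + t by rewrite addr_gt0.
have := cphi (x + t *: v) (x - v) (t := (1 + t)^-1).
have -> : 1 - (1 + t)^-1 = t / (1 + t) by field; rewrite gt_eqF.
rewrite invr_ge0 (ltW t10) invf_le1// lerDl (ltW t0) => /(_ isT).
have -> : (1 + t)^-1 *: (x + t *: v) + (t / (1 + t)) *: (x - v) = x.
  rewrite !scalerDr scalerN scalerA addrACA -scalerDl -scaleNr -scalerDl.
  have -> : (1 + t)^-1 + t / (1 + t) = 1 by field; rewrite gt_eqF.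
  by rewrite mulrC subrr scale1r scale0r addr0.
rewrite -(ler_pM2l t10) mulrDr !mulrA mulfV ?gt_eqF// mul1r.
have -> : (1 + t) * t / (1 + t) = t by field; rewrite gt_eqF.
lra.
Qed.

Let Q0 v : Q v !=set0. Proof. by exists (q v 1), 1 => /=. Qed.

Let Qlb v : has_lbound (Q v).
Proof. by exists (- (phi (x - v) - phi x)) => _ [t t0 <-]; exact: q_lb. Qed.

Let p_le v t : 0 < t -> p v <= q v t.
Proof. by move=> t0; apply: ge_inf => //; exists t. Qed.

Let p_ge v r : (forall t, 0 < t -> r <= q v t) -> r <= p v.
Proof. by move=> rq; apply: lb_le_inf => // _ [t t0 <-]; exact: rq. Qed.

(** With the step [r = s t / (s + t)] the point [x + r (v + w)] is a convex combination of [x + s v]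
    and [x + t w], and dividing by [r] turns the weights into [1/s] and [1/t]. *)
Let qD v w s t : 0 < s -> 0 < t -> p (v + w) <= q v s + q w t.
Proof.
move=> s0 t0; have st0 : 0 < s + t by rewrite addr_gt0.
have r0 : 0 < s * t / (s + t) by rewrite divr_gt0// mulr_gt0.
apply: (le_trans (p_le _ r0)); rewrite /q ler_pdivrMr//.
have := cphi (x + s *: v) (x + t *: w) (t := t / (s + t)).
have e1 : 1 - t / (s + t) = s / (s + t) by field; rewrite gt_eqF.
rewrite divr_ge0 ?(ltW t0) ?(ltW st0)// ler_pdivrMr// mul1r lerDr (ltW s0).
move=> /(_ isT); rewrite e1.
have -> : (t / (s + t)) *: (x + s *: v) + (s / (s + t)) *: (x + t *: w) =
          x + (s * t / (s + t)) *: (v + w).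
  rewrite !scalerDr !scalerA addrACA -scalerDl -mulrDl [t + s]addrC.
  rewrite divff ?gt_eqF// scale1r; congr (_ + (_ *: _ + _ *: _)); first by ring.
  by ring.
move=> h; rewrite [leRHS](_ : _ = t / (s + t) * (phi (x + s *: v) - phi x) +
  s / (s + t) * (phi (x + t *: w) - phi x)); last by field; rewrite !gt_eqF.
have -> : phi x = (t / (s + t)) * phi x + (s / (s + t)) * phi x.
  by field; rewrite gt_eqF.
move: h; rewrite !mulrBr; set A := _ * phi (_ + _); set B := _ * phi (_ + _).
set C := (t / _ * phi x).
have -> : t / (s + t) * (C + s / (s + t) * phi x) = C.
  by rewrite /C; field; rewrite gt_eqF.
have -> : s / (s + t) * (C + s / (s + t) * phi x) = s / (s + t) * phi x.
  by rewrite /C; field; rewrite gt_eqF.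
lra.
Qed.

Lemma subgradient_linear : exists M : E -> R,
  (forall v w k, M (v + k *: w) = M v + k * M w) /\
  (forall y, phi x + M (y - x) <= phi y).
Proof.
have [M [Ml Mp]] : exists M : E -> R,
    (forall v w k, setT v -> setT w -> M (v + k *: w) = M v + k * M w) /\
    (forall v, setT v -> M v <= p v).
  apply: hahn_banach => //.
  - move=> v w _ _; rewrite -lerBlDr; apply: p_ge => s s0.
    rewrite lerBlDr [leRHS]addrC -lerBlDr; apply: p_ge => t t0.
    by rewrite lerBlDr [leRHS]addrC; exact: qD.
  - have pk k v : 0 < k -> p (k *: v) <= k * p v.
      move=> k0; have : k^-1 * p (k *: v) <= p v; last by rewrite ler_pdivrMl.
      apply: p_ge => t t0.
      rewrite ler_pdivrMl//; have tk : 0 < t / k by rewrite divr_gt0.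
      apply: le_trans (p_le _ tk) _; rewrite /q scalerA divfK ?gt_eqF//.
      by rewrite invf_div mulrCA (mulrC k).
    move=> k v k0 _; apply/eqP; rewrite eq_le pk//=.
    rewrite -ler_pdivlMl//; apply: le_trans (pk _ _ _); last by rewrite invr_gt0.
    by rewrite scalerA mulVf ?scale1r// gt_eqF.
  - apply/eqP; rewrite eq_le; apply/andP; split.
      by apply: le_trans (p_le _ ltr01) _; rewrite /q scaler0 addr0 subrr mul0r.
    by apply: p_ge => t t0; rewrite /q scaler0 addr0 subrr mul0r.
exists M; split; first by move=> v w k; exact: Ml.
move=> y; have := le_trans (Mp (y - x) I) (p_le (y - x) ltr01).
by rewrite /q scale1r [x + _]addrC subrK divr1 lerBrDl.
Qed.

End subgradient.

(** * The Euclidean scalar product *)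

Section dotp.
Variables (R : realType) (d : nat).
Implicit Types x y z : 'rV[R]_d.

Lemma dotpC x y : dotp x y = dotp y x.
Proof. by apply: eq_bigr => i _; rewrite mulrC. Qed.

Lemma dotpDl x y z : dotp (x + y) z = dotp x z + dotp y z.
Proof. by rewrite -big_split/=; apply: eq_bigr => i _; rewrite mxE mulrDl. Qed.

Lemma dotpZl k x y : dotp (k *: x) y = k * dotp x y.
Proof. by rewrite mulr_sumr; apply: eq_bigr => i _; rewrite mxE mulrA. Qed.

Lemma dotpNl x y : dotp (- x) y = - dotp x y.
Proof. by rewrite -scaleN1r dotpZl mulN1r. Qed.

Lemma dotpBl x y z : dotp (x - y) z = dotp x z - dotp y z.
Proof. by rewrite dotpDl dotpNl. Qed.

Lemma dotp0l x : dotp 0 x = 0.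
Proof. by rewrite -(scale0r x) dotpZl mul0r. Qed.

Lemma dotpDr x y z : dotp z (x + y) = dotp z x + dotp z y.
Proof. by rewrite dotpC dotpDl !(dotpC z). Qed.

Lemma dotpZr k x y : dotp y (k *: x) = k * dotp y x.
Proof. by rewrite dotpC dotpZl (dotpC y). Qed.

Lemma dotpNr x y : dotp x (- y) = - dotp x y.
Proof. by rewrite dotpC dotpNl dotpC. Qed.

Lemma dotpBr x y z : dotp z (x - y) = dotp z x - dotp z y.
Proof. by rewrite dotpDr dotpNr. Qed.

Lemma dotp0r x : dotp x 0 = 0.
Proof. by rewrite dotpC dotp0l. Qed.

Lemma dotp_ge0 x : 0 <= dotp x x.
Proof. by apply: sumr_ge0 => i _; rewrite -expr2 sqr_ge0. Qed.

Lemma enorm_sqr x : enorm x ^+ 2 = dotp x x.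
Proof. by rewrite sqr_sqrtr// dotp_ge0. Qed.

Lemma enorm_le x y : (enorm x <= enorm y) = (dotp x x <= dotp y y).
Proof. by rewrite ler_sqrt// dotp_ge0. Qed.

Lemma dotp_delta x i : dotp x (delta_mx ord0 i) = x ord0 i.
Proof.
rewrite /dotp (bigD1 i)//= mxE !eqxx mulr1 big1 ?addr0// => j ji.
by rewrite mxE eqxx (negbTE ji) mulr0.
Qed.

Lemma dotp_le_sqr x y : 2 * dotp x y <= dotp x x + dotp y y.
Proof.
by have := dotp_ge0 (x - y); rewrite dotpBl !dotpBr (dotpC y x); lra.
Qed.

Lemma linear_dotp (M : 'rV[R]_d -> R) :
  (forall v w k, M (v + k *: w) = M v + k * M w) ->
  exists p, forall v, M v = dotp p v.
Proof.
move=> Ml; exists (\row_i M (delta_mx ord0 i)) => v.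
have M0 : M 0 = 0.
  by have := Ml 0 0 (-1); rewrite scaler0 addr0 mulN1r subrr.
have MZ k w : M (k *: w) = k * M w by rewrite -[k *: w]add0r Ml M0 add0r.
have MD u w : M (u + w) = M u + M w by rewrite -{1}[w]scale1r Ml mul1r.
rewrite [in LHS](row_sum_delta v) (big_morph M MD M0); apply: eq_bigr => i _.
by rewrite MZ mxE mulrC.
Qed.

Lemma subgradient (phi : 'rV[R]_d -> R) x : cvx phi ->
  exists p, forall y, phi x + dotp p (y - x) <= phi y.
Proof.
move=> cphi; have [M [/linear_dotp[p pE] Mp]] := subgradient_linear cphi x.
by exists p => y; rewrite -pE.
Qed.

Lemma sqr_coord_le x i : x ord0 i ^+ 2 <= dotp x x.
Proof.
rewrite /dotp (bigD1 i)//= -expr2 lerDl; apply: sumr_ge0 => j _.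
by rewrite -expr2 sqr_ge0.
Qed.

End dotp.

(** * Functions with non-expansive gradient *)

Lemma differentiable_err (R : realType) (V W : normedModType R) (u : V -> W)
    (L : {linear V -> W}) x : continuous L ->
  (forall e : R, 0 < e ->
    \forall h \near (0 : V), `|u (h + x) - u x - L h| <= e * `|h|) ->
  differentiable u x /\ 'd u x = L :> (V -> W).
Proof.
move=> Lc err; have ue : u \o shift x = cst (u x) + L +o_ 0 id.
  apply/eqaddoP => e e0; have := err e e0.
  by apply: filterS => h; rewrite !fctE /= opprD addrA.
have dE : 'd u x = L :> (V -> W) by exact: diff_unique ue.
by split => //; apply/diff_locallyP; rewrite dE.
Qed.

Section rV_analysis.
Variables (R : realType) (d : nat).
Implicit Types x y z v : 'rV[R]_d.

Lemma coord_norm_le x i : `|x ord0 i| <= `|x|.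
Proof.
rewrite [leRHS]/Num.norm /= mx_normrE; apply/bigmax_geP; right => /=.
by exists (ord0, i).
Qed.

Lemma dotp_norm_le x : dotp x x <= d%:R * `|x| ^+ 2.
Proof.
rewrite mulr_natl -[X in _ *+ X]card_ord -sumr_const; apply: ler_sum => i _.
by rewrite -expr2 -real_normK ?num_real// lerXn2r// ?nnegrE// coord_norm_le.
Qed.

Lemma dotp_linear (p : 'rV[R]_d) : GRing.linear_for *%R (dotp p).
Proof. by move=> k x y; rewrite dotpDr dotpZr. Qed.

HB.instance Definition _ (p : 'rV[R]_d) :=
  GRing.isLinear.Build R 'rV[R]_d R^o _ (dotp p : 'rV[R]_d -> R^o) (dotp_linear p).

Lemma dotp_continuous (p : 'rV[R]_d) : continuous (dotp p : 'rV[R]_d -> R^o).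
Proof.
apply: continuous_big => [|i _ x]; first exact: add_continuous.
apply: (@continuousM _ 'rV[R]_d (cst (p ord0 i)) (fun y => y ord0 i)).
  exact: cst_continuous.
exact: coord_continuous.
Qed.

Lemma differentiable_quad_err (u : 'rV[R]_d -> R^o) x p :
  (forall h, `|u (h + x) - u x - dotp p h| <= dotp h h) ->
  differentiable u x /\ forall h, 'd u x h = dotp p h.
Proof.
move=> up.
have [||du ->] := @differentiable_err R 'rV[R]_d R^o u (dotp p : {linear 'rV[R]_d -> R^o}) x.
- exact: dotp_continuous.
(* The norm of row vectors is the sup norm, for which [dotp h h <= d * |h|^2]; the summand 1 keeps
   the quotient positive for [d = 0]. *)
- move=> e e0; have e1 : 0 < e / (d%:R + 1) by rewrite divr_gt0// ltr_wpDl.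
  near=> h.
  apply: (le_trans (up h)); apply: (le_trans (dotp_norm_le h)).
  rewrite expr2 mulrA ler_wpM2r//.
  have : `|h| <= e / (d%:R + 1).
    by near: h; exact: (@nbhs0_le _ ('rV[R]_d : normedModType R)).
  rewrite ler_pdivlMr ?ltr_wpDl// => /(le_trans _); apply.
  by rewrite mulrC ler_wpM2l// lerDl.
by split.
Unshelve. all: by end_near. Qed.

Lemma is_derive_line (u : 'rV[R]_d -> R^o) x v (s : R) :
  differentiable u (x + s *: v) ->
  is_derive s 1 (fun t : R => u (x + t *: v) : R) ('d u (x + s *: v) v).
Proof.
move=> du; have dv : derivable u (x + s *: v) v by exact: diff_derivable.
have e : (fun h : R => h^-1 *: (((fun t : R => u (x + t *: v)) \o shift s) (h *: (1 : R)) -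
    u (x + s *: v))) =
   (fun h : R => h^-1 *: ((u \o shift (x + s *: v)) (h *: v) - u (x + s *: v))).
  apply/funext => h /=; congr (_ *: (u _ - _)).
  by rewrite [h *: 1]mulr1 scalerDl addrCA.
apply: DeriveDef; first by rewrite /derivable e.
by rewrite /derive e -deriveE.
Qed.

(** When [g] is the gradient of [u], this is monotonicity of the gradient of [|x|^2/2 + u]. *)
Lemma nonexpansive_monotone (g : 'rV[R]_d -> 'rV[R]_d) x y :
  (forall x y, enorm (g x - g y) <= enorm (x - y)) ->
  0 <= dotp (x - y) (x - y) + dotp (g x - g y) (x - y).
Proof.
move=> /(_ x y); rewrite enorm_le => gxy.
by have := dotp_le_sqr (- (g x - g y)) (x - y); rewrite !(dotpNl, dotpNr); lra.
Qed.

Lemma C11_1_lower (u : 'rV[R]_d -> R^o) (g : 'rV[R]_d -> 'rV[R]_d) :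
  (forall x, differentiable u x /\ forall h, 'd u x h = dotp (g x) h) ->
  (forall x y, enorm (g x - g y) <= enorm (x - y)) ->
  forall x y, u x + dotp (g x) (y - x) - dotp (y - x) (y - x) / 2 <= u y.
Proof.
move=> ud gL x y; set v := y - x.
(* [F] is [|x|^2/2 + u] along the segment, up to an affine term. Its derivative at any [c] in []0,
   1[] is at least its derivative at 0, so the mean value theorem gives
   [F 1 - F 0 >= dotp (g x) v]. *)
pose F (s : R) : R := u (x + s *: v) + s ^+ 2 / 2 * dotp v v.
have Fd s : is_derive s (1 : R) F (dotp (g (x + s *: v)) v + s * dotp v v).
  have [du dE] := ud (x + s *: v).
  rewrite -dE; apply: is_deriveD; first exact: is_derive_line.
  have dsqr : is_derive s (1 : R) (fun t : R => t * t) (s + s).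
    have -> : s + s = s *: (1 : R) + s *: (1 : R) by rewrite /GRing.scale/= mulr1.
    exact: (@is_deriveM R R id id).
  have -> : (fun s : R => s ^+ 2 / 2 * dotp v v) =
            (dotp v v / 2) \*: (fun t : R => t * t).
    by apply/funext => t; rewrite /= /GRing.scale/=; field.
  have -> : s * dotp v v = (dotp v v / 2) *: (s + s).
    by rewrite /GRing.scale/=; field.
  exact: is_deriveZ.
have [c] : exists2 c, c \in `]0, 1[%R &
    F 1 - F 0 = (dotp (g (x + c *: v)) v + c * dotp v v) * (1 - 0).
  apply: MVT => //; apply: continuous_subspaceT => s.
  exact/differentiable_continuous/derivable1_diffP/ex_derive.
rewrite in_itv/= => /andP[c0 c1].
rewrite /F scale1r scale0r addr0 expr1n expr0n/= mul0r mul0r addr0.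
rewrite subr0 mulr1 (_ : x + v = y) => [e|]; last by rewrite addrC subrK.
have := nonexpansive_monotone (x + c *: v) x gL.
rewrite addrAC subrr add0r dotpZl !dotpZr.
have -> : dotp (g (x + c *: v) - g x) v = dotp (g (x + c *: v)) v - dotp (g x) v.
  by rewrite dotpBl.
rewrite -mulrDr pmulr_rge0//; lra.
Qed.

Lemma C11_1N (u : 'rV[R]_d -> R^o) (g : 'rV[R]_d -> 'rV[R]_d) :
  (forall x, differentiable u x /\ forall h, 'd u x h = dotp (g x) h) ->
  (forall x, differentiable (- u : 'rV[R]_d -> R^o) x /\
     forall h, 'd (- u : 'rV[R]_d -> R^o) x h = dotp (- g x) h).
Proof.
move=> ud x; have [du dE] := ud x; split; first exact: differentiableN.
by move=> h; rewrite diffN// dotpNl -dE.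
Qed.

Lemma C11_1_upper (u : 'rV[R]_d -> R^o) (g : 'rV[R]_d -> 'rV[R]_d) :
  (forall x, differentiable u x /\ forall h, 'd u x h = dotp (g x) h) ->
  (forall x y, enorm (g x - g y) <= enorm (x - y)) ->
  forall x y, u y <= u x + dotp (g x) (y - x) + dotp (y - x) (y - x) / 2.
Proof.
move=> ud gL x y; have := C11_1_lower (C11_1N ud) _ x y.
have gL' : forall x y, enorm (- g x - - g y) <= enorm (x - y).
  by move=> a b; rewrite enorm_le -opprD dotpNl dotpNr opprK -enorm_le.
move=> /(_ gL'); rewrite !fctE dotpNl; lra.
Qed.

Lemma supported_cvx (phi : 'rV[R]_d -> R) (p : 'rV[R]_d -> 'rV[R]_d) :
  (forall x y, phi x + dotp (p x) (y - x) <= phi y) -> cvx phi.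
Proof.
move=> h x y t /andP[t0 t1]; set w := _ + _.
have := ler_wpM2l t0 (h w x).
have := ler_wpM2l (_ : 0 <= 1 - t) (h w y); rewrite subr_ge0 => /(_ t1).
have : t * dotp (p w) (x - w) + (1 - t) * dotp (p w) (y - w) = 0.
  rewrite -!dotpZr -dotpDr !scalerBr addrACA -opprD -scalerDl.
  by rewrite [t + _]addrC subrK scale1r subrr dotp0r.
by rewrite !mulrDr; lra.
Qed.

(* The cocoercivity estimate [|p x - p y|^2 / 2 <= <p x - p y, x - y>] is what
   makes [x |-> p x - x] non-expansive. *)
Lemma C11_1_intro (phi : 'rV[R]_d -> R) (p : 'rV[R]_d -> 'rV[R]_d) :
  (forall x y, phi x + dotp (p x) (y - x) <= phi y) ->
  (forall x w, phi (x + w) <= phi x + dotp (p x) w + dotp w w) ->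
  C11_1 (fun x => phi x - dotp x x / 2 : R^o).
Proof.
move=> lo up; exists (fun x => p x - x); split => x.
  apply: differentiable_quad_err => h.
  have := up x h; have := lo x (h + x); rewrite addrK (addrC x h).
  rewrite dotpBl !(dotpDl, dotpDr) (dotpC h x) ler_norml; lra.
move=> y; rewrite enorm_le.
have -> : p x - x - (p y - y) = (p x - p y) - (x - y).
  by rewrite !opprB addrACA [RHS]addrACA; congr (_ + _); rewrite addrC.
(* Both bounds are compared at [b + w]: this yields the gain [- <p b - p a, w> - |w|^2], which is
   largest, with value [|p b - p a|^2 / 4], at [w = - (p b - p a) / 2]. Adding the estimate for
   [(a, b)] and [(b, a)] gives cocoercivity. *)
have co a b : phi a + dotp (p a) (b - a) + dotp (p b - p a) (p b - p a) / 4 <= phi b.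
  have := up b (- (2^-1 *: (p b - p a))).
  have := lo a (b - 2^-1 *: (p b - p a)).
  rewrite !(dotpDl, dotpDr, dotpNl, dotpNr, dotpZl, dotpZr).
  rewrite (dotpC (p b) (p a)); lra.
have := co x y; have := co y x.
rewrite !(dotpDl, dotpDr, dotpNl, dotpNr, dotpZl, dotpZr).
rewrite (dotpC (p y) (p x)) (dotpC y x) (dotpC x (p x)) (dotpC y (p x))
  (dotpC x (p y)) (dotpC y (p y)); lra.
Qed.

End rV_analysis.

(** * Separation of two families of affine functions *)

Section affine.
Variables (R : realType) (d : nat).
Implicit Types (x y z v w : 'rV[R]_d) (l : R * 'rV[R]_d) (F : set (R * 'rV[R]_d)).

Definition aff l z := l.1 + dotp l.2 z.

Definition supaff F z := sup [set aff l z | l in F].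

Definition bounded_family F := F !=set0 /\ forall z, exists r, forall l, F l -> aff l z <= r.

Lemma supaff_ge F l z : bounded_family F -> F l -> aff l z <= supaff F z.
Proof.
move=> [_ /(_ z)[r rF]] Fl; apply: ub_le_sup; last by exists l.
by exists r => _ [m Fm <-]; exact: rF.
Qed.

Lemma supaff_le F r z : F !=set0 -> (forall l, F l -> aff l z <= r) -> supaff F z <= r.
Proof.
move=> [l Fl] Fr; apply: ge_sup; first by exists (aff l z), l.
by move=> _ [m Fm <-]; exact: Fr.
Qed.

Lemma aff_comb l x y t : aff l (t *: x + (1 - t) *: y) = t * aff l x + (1 - t) * aff l y.
Proof. by rewrite /aff dotpDr !dotpZr; ring. Qed.

Lemma cvx_supaff F : bounded_family F -> cvx (supaff F).
Proof.
move=> FP x y t /andP[t0 t1]; apply: supaff_le; first by case: FP.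
move=> l Fl; rewrite aff_comb.
by apply: lerD; apply: ler_wpM2l; rewrite ?subr_ge0//; exact: supaff_ge.
Qed.

Variables F G : set (R * 'rV[R]_d).
Hypothesis F0 : F !=set0.
Hypothesis G0 : G !=set0.
Hypothesis FG : forall l m z, F l -> G m -> aff l z + aff m z <= dotp z z.

Let L := [set m | forall l z, F l -> aff l z + aff m z <= dotp z z].

Let LP : bounded_family L.
Proof.
split; first by case: G0 => m Gm; exists m => l z Fl; exact: FG.
by move=> z; case: F0 => l Fl; exists (dotp z z - aff l z) => m /(_ l z Fl); lra.
Qed.

Let phi := supaff L.

(** The points [z + w] and [z - ((1 - t)/t) w] with weights [1 - t] and [t] have mean [z], and the
    mean of their squared norms is [|z|^2 + (1 - t)/t |w|^2]. Averaging the constraints of [l] and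
    [m] at these points leaves each affine function of [F] unchanged, so the average [k] of the
    translates, lowered by [(1 - t)/t |w|^2], is again in [L]. *)
Let pair_le x w t l m : 0 < t -> t < 1 -> L l -> L m ->
  (1 - t) * aff l (x + w) + t * aff m (x - ((1 - t) / t) *: w) <=
  phi x + (1 - t) / t * dotp w w.
Proof.
move=> t0 t1 Ll Lm; rewrite -lerBlDr.
pose k := ((1 - t) * aff l w + t * aff m (- ((1 - t) / t *: w)) -
  (1 - t) / t * dotp w w,
  (1 - t) *: l.2 + t *: m.2).
have kE z : aff k z = (1 - t) * aff l (z + w) + t * aff m (z - ((1 - t) / t) *: w) -
  (1 - t) / t * dotp w w.
  rewrite /aff /k /= !(dotpDl, dotpDr, dotpZl, dotpNr, dotpZr) /aff.
  by rewrite !(dotpNr, dotpZr); ring.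
have Lk : L k.
  move=> i z Fi; rewrite kE.
  have e : aff i z = (1 - t) * aff i (z + w) + t * aff i (z - ((1 - t) / t) *: w).
    by rewrite /aff !dotpDr dotpNr dotpZr; field; rewrite gt_eqF.
  have := ler_wpM2l (ltW t0) (Lm i (z - ((1 - t) / t) *: w) Fi).
  have := ler_wpM2l (_ : 0 <= 1 - t) (Ll i (z + w) Fi); rewrite subr_ge0 => /(_ (ltW t1)).
  rewrite e !mulrDr.
  have : (1 - t) * dotp (z + w) (z + w) +
    t * dotp (z - ((1 - t) / t) *: w) (z - ((1 - t) / t) *: w) =
    dotp z z + (1 - t) / t * dotp w w.
    rewrite !(dotpDl, dotpDr, dotpNl, dotpNr, dotpZl, dotpZr) (dotpC w z).
    by field; rewrite gt_eqF.
  lra.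
by have := supaff_ge x LP Lk; rewrite kE -/phi; lra.
Qed.

(** Suprema over [l] and [m] in [pair_le] replace both by [phi]. The subgradient bounds the second
    term from below, and division by [1 - t] leaves the error [|w|^2 / t], which tends to [|w|^2] as
    [t] tends to 1. *)
Let quad_above x w p : (forall y, phi x + dotp p (y - x) <= phi y) ->
  phi (x + w) <= phi x + dotp p w + dotp w w.
Proof.
move=> px.
have key t : 0 < t -> t < 1 -> phi (x + w) <= phi x + dotp p w + dotp w w / t.
  move=> t0 t1; have t10 : 0 < 1 - t by rewrite subr_gt0.
  have h m : L m -> (1 - t) * phi (x + w) + t * aff m (x - ((1 - t) / t) *: w) <=
      phi x + (1 - t) / t * dotp w w.
    move=> Lm; rewrite -lerBrDr -ler_pdivlMl//.
    apply: supaff_le; [by case: LP | move=> l Ll].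
    by rewrite ler_pdivlMl// lerBrDr; exact: pair_le.
  have {}h : (1 - t) * phi (x + w) + t * phi (x - ((1 - t) / t) *: w) <=
      phi x + (1 - t) / t * dotp w w.
    rewrite -lerBrDl -ler_pdivlMl//; apply: supaff_le; [by case: LP | move=> m Lm].
    by rewrite ler_pdivlMl// lerBrDl; exact: h.
  have := ler_wpM2l (ltW t0) (px (x - ((1 - t) / t) *: w)).
  rewrite [x - _]addrC addrK dotpNr dotpZr [- _ + x]addrC.
  have -> : t * (phi x - (1 - t) / t * dotp p w) = t * phi x - (1 - t) * dotp p w.
    by field; rewrite gt_eqF.
  move=> h'; rewrite -(ler_pM2l t10).
  have -> : (1 - t) * (phi x + dotp p w + dotp w w / t) =
    phi x - t * phi x + (1 - t) * dotp p w + (1 - t) / t * dotp w w.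
    by field; rewrite gt_eqF.
  lra.
(* The limit [t -> 1] by contradiction: if the claim fails by [e], then [t = (q + e/2) / (q + e)] is
   below 1 and [q / t < q + e]. *)
rewrite leNgt; apply/negP => lt; set q := dotp w w in lt key.
have q0 : 0 <= q by exact: dotp_ge0.
set e := phi (x + w) - (phi x + dotp p w + q).
have e0 : 0 < e by rewrite subr_gt0.
have qe : 0 < q + e by rewrite ltr_wpDl.
have qe2 : 0 < q + e / 2 by rewrite ltr_wpDl// divr_gt0.
have := key ((q + e / 2) / (q + e)); rewrite divr_gt0// ltr_pdivrMr// mul1r.
have -> : q + e / 2 < q + e by lra.
move=> /(_ isT isT).
have : q / ((q + e / 2) / (q + e)) < q + e.
  by rewrite invf_div mulrA ltr_pdivrMr//; nra.
by rewrite /e; lra.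
Qed.

(* [phi] is the largest convex function below all [|z|^2 - aff l z] with [l] in
   [F]; it inherits their upper quadratic bounds, so [phi - |z|^2/2] has a
   1-Lipschitz gradient. *)
Lemma C11_1_sandwich : exists u : 'rV[R]_d -> R^o, C11_1 u /\
  forall z, (forall m, G m -> aff m z <= u z + dotp z z / 2) /\
            (forall l, F l -> aff l z <= dotp z z / 2 - u z).
Proof.
have /choice[p pP] x : exists p, forall y, phi x + dotp p (y - x) <= phi y.
  by apply: subgradient; exact: cvx_supaff.
exists (fun z => phi z - dotp z z / 2); split.
  by apply: (C11_1_intro pP) => x w; exact: quad_above.
move=> z; split.
  move=> m Gm; rewrite subrK; apply: supaff_ge => //.
  by move=> l y Fl; exact: FG.
move=> l Fl; have : phi z <= dotp z z - aff l z.
  apply: supaff_le; first by case: LP.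
  by move=> m /(_ l z Fl); lra.
lra.
Qed.

End affine.

(** * Random variables realising a positive functional *)

Section bits.
Variables (R : realType) (T : Type) (M : (T -> R) -> R) (V : set (T -> R)).
Hypothesis V_lin : forall F G k, V F -> V G -> V (fun t => F t + k * G t).
Hypothesis V_bounded : forall F, (exists C : R, forall t, `|F t| <= C) -> V F.
Hypothesis M_lin : forall F G k, V F -> V G ->
  M (fun t => F t + k * G t) = M F + k * M G.
Hypothesis M_ge0 : forall F, V F -> (forall t, 0 <= F t) -> 0 <= M F.
Hypothesis M1 : M (fun=> 1) = 1.
Variable B : nat -> T -> bool.

(* Lists of bits are in reverse order: the latest bit comes first. The unit
   interval is split successively in proportion to the values of [M]. *)
Fixpoint prefix k t : seq bool := if k is k'.+1 then B k' t :: prefix k' t else [::].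

Let m (s : seq bool) : R := M (fun t => (prefix (size s) t == s)%:R).

Fixpoint left_end (s : seq bool) : R :=
  if s is b :: s' then left_end s' + (if b then m (false :: s') else 0) else 0.

Fixpoint digits k (x : R) : seq bool :=
  if k is k'.+1 then let s := digits k' x in (left_end s + m (false :: s) <= x) :: s
  else [::].

Let Vb (F : T -> bool) : V (fun t => (F t)%:R).
Proof. by apply: V_bounded; exists 1 => t; case: (F t); rewrite ?normr1 ?normr0. Qed.

Let MD F G : V F -> V G -> M (fun t => F t + G t) = M F + M G.
Proof.
by move=> VF VG; have := M_lin 1 VF VG; rewrite mul1r; under eq_fun do rewrite mul1r.
Qed.

Let m_ge0 s : 0 <= m s.
Proof. by apply: M_ge0 => // t; case: (_ == _). Qed.

Let m_nil : m [::] = 1. Proof. by rewrite /m /= -[RHS]M1. Qed.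

Let m_split s : m s = m (false :: s) + m (true :: s).
Proof.
rewrite /m -MD//; congr M; apply/funext => t /=; rewrite !eqseq_cons.
by case: (B _ t); rewrite /= ?addr0 ?add0r.
Qed.

Let size_prefix k t : size (prefix k t) = k.
Proof. by elim: k => //= k ->. Qed.

Let size_digits k x : size (digits k x) = k.
Proof. by elim: k => //= k ->. Qed.

Let I s : set R := `[left_end s, left_end s + m s[%classic.

Let IP s x : I s x <-> left_end s <= x /\ x < left_end s + m s.
Proof. by rewrite /I /= in_itv/=; split => [/andP|[-> ->]]. Qed.

Let I_digits k x : 0 <= x < 1 -> I (digits k x) x.
Proof.
move=> /andP[x0 x1]; elim: k => [|k /IP[lx xr]]; apply/IP.
  by rewrite /= m_nil add0r.
have ms := m_split (digits k x).
by rewrite /=; case: (leP (left_end (digits k x) + m (false :: digits k x)) x) => h /=; split; lra.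
Qed.

Let digits_I s x : I s x -> digits (size s) x = s.
Proof.
elim: s => //= b s IH /IP[/=]; have := m_ge0 (false :: s).
have := m_ge0 (true :: s); have := m_split s => ms m1 m0.
case: b => lx xr.
  by rewrite IH ?lx//; apply/IP; split; lra.
rewrite IH; last by apply/IP; split; lra.
by rewrite leNgt; move: xr; rewrite addr0 => ->.
Qed.

Let left_end_ge0 s : 0 <= left_end s.
Proof.
by elim: s => //= b s IH; apply: addr_ge0 => //; case: b.
Qed.

Let right_end_le1 s : left_end s + m s <= 1.
Proof.
elim: s => [|b s]/=; first by rewrite m_nil add0r.
rewrite (m_split s); have := m_ge0 (true :: s); have := m_ge0 (false :: s).
by case: b; lra.
Qed.

Let P : probability _ R := @uniform_prob R 0 1 ltr01.

Let measurable_digits s : measurable [set x : R | digits (size s) x = s].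
Proof.
elim: s => [|b s IH]; first by rewrite (_ : [set _ | _] = setT)//; apply/seteqP.
have -> : [set x | digits (size (b :: s)) x = b :: s] =
   [set x | digits (size s) x = s] `&`
   (if b then `[left_end s + m (false :: s), +oo[%classic
    else ~` `[left_end s + m (false :: s), +oo[%classic).
  apply/seteqP; split => x /=.
    move=> [bx dx]; split => //; rewrite dx in bx; rewrite -bx.
    case: (leP (left_end s + m (false :: s)) x) => h /=; rewrite in_itv/= andbT//.
    by apply/negP; rewrite -ltNge.
  move=> [dx]; rewrite dx; case: b; rewrite /= in_itv/= andbT; first by move=> ->.
  by move=> /negP/negbTE ->.
apply: measurableI => //; case: b; first exact: measurable_itv.
by apply: measurableC; exact: measurable_itv.
Qed.

Let P_digits s : P [set x | digits (size s) x = s] = (m s)%:E.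
Proof.
set A := [set x | _].
have mA : measurable A by exact: measurable_digits.
have mI : measurable (I s) by exact: measurable_itv.
have PE (D : set R) : measurable D -> P D = lebesgue_measure (D `&` `[0%R, 1%R]%classic).
  move=> mD; rewrite /P /= /uniform_prob integral_uniform_pdf.
  rewrite (eq_integral (cst 1%E)).
    by rewrite integral_cst ?mul1e//; exact: measurableI.
  by move=> x; rewrite inE => -[_ /=]; rewrite in_itv/= /uniform_pdf => ->; rewrite subr0 invr1.
have PI : P (I s) = (m s)%:E.
  rewrite PE// setIidl; last first.
    move=> x /IP[lx xr]; rewrite /= in_itv/= (le_trans (left_end_ge0 s) lx).
    by rewrite ltW// (lt_le_trans xr).
  rewrite lebesgue_measure_itv/= lte_fin ltrDl; case: ltP => [_|m0].
    by rewrite -EFinD addrAC subrr add0r.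
  by congr EFin; apply/eqP; rewrite eq_le m_ge0 m0.
(* The two sets need not be equal: [digits] is also defined outside [[0, 1[]. Within [[0, 1]] they
   differ at most by the point 1, which is a null set. *)
rewrite -PI; apply/eqP; rewrite eq_le; apply/andP; split; last first.
  by apply: le_measure; rewrite ?inE// => x /digits_I.
rewrite !PE//; apply: (@le_trans _ _ (lebesgue_measure (I s `&` `[0%R, 1%R]%classic `|` [set 1%R]))).
  apply: le_measure; rewrite ?inE//.
  - exact: measurableI.
  - by apply: measurableU => //; exact: measurableI.
  move=> x [Ax /=]; rewrite in_itv/= => /andP[x0]; rewrite le_eqVlt => /predU1P[->|x1].
    by right.
  by left; split; [rewrite -Ax; apply: I_digits; rewrite x0|rewrite x0 x1 orbT].
apply: (le_trans (measureU2 _ _ _)) => //; first exact: measurableI.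
by rewrite [X in (_ + X)%E]lebesgue_measure_set1 adde0.
Qed.

Definition bit i x := head false (digits i.+1 x).

(** A function of [K] bits is a finite combination of indicators of words of length [K], whose
    probabilities are right by construction. Finite additivity of [M] is therefore enough, for any
    sequence of events [B]. *)
Lemma bits_law K (G : (nat -> bool) -> R) :
  (forall b b', (forall i, (i < K)%N -> b i = b' i) -> G b = G b') ->
  intg P (fun x => G (bit ^~ x)) /\
  \int[P]_x (G (bit ^~ x)) = M (fun t => G (B ^~ t)).
Proof.
move=> GK.
pose g (s : seq bool) := G (fun i => nth false (rev s) i).
have gd x : G (bit ^~ x) = g (digits K x).
  apply: GK => i; elim: K => // k IH ik; rewrite /= rev_cons nth_rcons size_rev size_digits.
  by move: ik; rewrite ltnS leq_eqVlt => /predU1P[->|ik]; [rewrite ltnn eqxx | rewrite ik IH].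
have gp t : G (B ^~ t) = g (prefix K t).
  apply: GK => i; elim: K {gd} => // k IH ik; rewrite /= rev_cons nth_rcons size_rev size_prefix.
  by move: ik; rewrite ltnS leq_eqVlt => /predU1P[->|ik]; [rewrite ltnn eqxx | rewrite ik IH].
have sumE (s : seq bool) : size s = K ->
    g s = \sum_(u : K.-tuple bool) g u * (s == u :> seq bool)%:R.
  move=> sK; have sKE : size s == K by apply/eqP.
  rewrite (bigD1 (Tuple sKE))//= eqxx mulr1 big1 ?addr0// => u us.
  rewrite (_ : (s == u :> seq bool) = false) ?mulr0//.
  by apply: contraNF us => /eqP su; apply/eqP/val_inj.
pose D (u : K.-tuple bool) := [set x : R | digits (size u) x = u].
have DE x (u : K.-tuple bool) : (digits K x == u :> seq bool)%:R = \1_(D u) x :> R.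
  rewrite indicE (_ : (x \in D u) = (digits K x == u :> seq bool))//.
  apply/idP/idP; first by rewrite inE /D /= size_tuple => /eqP.
  by move=> /eqP e; rewrite inE /D /= size_tuple.
have mD u : measurable (D u) by exact: measurable_digits.
have iD u : intg P \1_(D u).
  apply: intg_indic; first exact: mD.
  exact: le_lt_trans (probability_le1 P (mD u)) (ltry 1).
have -> : (fun x => G (bit ^~ x)) = (fun x => \sum_(u : K.-tuple bool) g u * \1_(D u) x).
  by apply/funext => x; rewrite gd sumE//; apply: eq_bigr => u _; rewrite DE.
split; first by apply: intg_sum => u _; exact: intgZ.
rewrite Rint_sum; last by move=> u _; exact: intgZ.
have -> : (fun t => G (B ^~ t)) =
    (fun t => \sum_(u : K.-tuple bool) g u * (prefix K t == u :> seq bool)%:R).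
  by apply/funext => t; rewrite gp sumE.
have V0 : V (fun=> 0) by apply: V_bounded; exists 0 => ?; rewrite normr0.
have M0 : M (fun=> 0) = 0.
  have := M_lin (-1) V0 V0; under eq_fun do rewrite mulr0 addr0.
  lra.

have Msum (r : seq (K.-tuple bool)) (F : K.-tuple bool -> T -> bool) :
    V (fun t => \sum_(u <- r) g u * (F u t)%:R) /\
    M (fun t => \sum_(u <- r) g u * (F u t)%:R) = \sum_(u <- r) g u * M (fun t => (F u t)%:R).
  elim: r => [|u r [Vr IH]].
    under eq_fun do rewrite big_nil.
    by rewrite big_nil.
  have e : (fun t => \sum_(v <- u :: r) g v * (F v t)%:R) =
    (fun t => \sum_(v <- r) g v * (F v t)%:R + g u * (F u t)%:R).
    by apply/funext => t; rewrite big_cons addrC.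
  by rewrite e; split; [exact: V_lin | rewrite M_lin// IH big_cons addrC].
rewrite (Msum _ (fun u t => prefix K t == u :> seq bool)).2.
apply: eq_bigr => u _; rewrite RintZ; last exact: iD.
rewrite Rint_indic; last exact: mD.
congr (_ * _).
have -> : M (fun t => (prefix K t == u :> seq bool)%:R) = m u by rewrite /m size_tuple.
have h : (P : {measure set _ -> \bar R}) (D u) = (m u)%:E := P_digits u.
by rewrite h.
Qed.

End bits.

(** * Almost sure limits under summable increments *)

Section fast_limit.
Context d (T : measurableType d) (R : realType) (P : {measure set T -> \bar R}).
Variables (I : finType) (Y : nat -> I -> T -> R) (C : R).
Hypothesis mY : forall k i, measurable_fun setT (Y k i).

Let e k x := \sum_i `|Y k.+1 i x - Y k i x|.

Hypothesis ie : forall k, intg P (e k).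
Hypothesis e_small : forall k, \int[P]_x e k x <= C / 2 ^+ k.

Let e_ge0 k x : 0 <= e k x. Proof. by apply: sumr_ge0. Qed.

Let S x : \bar R := (\sum_(0 <= k <oo) (e k x)%:E)%E.

Let S_ge0 x : (0 <= S x)%E.
Proof. by apply: nneseries_ge0 => k _ _; rewrite lee_fin. Qed.

Let mS : measurable_fun setT S.
Proof.
apply: (ge0_emeasurable_sum (P := xpredT)).
  by move=> k x _ _; rewrite lee_fin.
by move=> k _; exact: measurable_int (ie k).
Qed.

Let int_S : (\int[P]_x S x < +oo)%E.
Proof.
rewrite /S integral_nneseries//.
- apply: (@le_lt_trans _ _ (\sum_(0 <= k <oo) (C / 2 ^+ k)%:E)%E).
    apply: lee_nneseries => [k _ _|k _].
      by apply: integral_ge0 => x _; rewrite lee_fin.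
    rewrite Rint_EFin ?lee_fin; first exact: e_small. exact: ie.
  rewrite (_ : (\sum_(0 <= k <oo) (C / 2 ^+ k)%:E)%E =
    (\sum_(0 <= k <oo) ((C * 2) / (2 ^ (k + 1))%:R)%:E)%E); last first.
    apply: eq_eseriesr => k _; congr EFin.
    by rewrite addn1 expnSr natrM natrX invfM mulrACA [_ / 2]mulrC mulVf ?mulr1.
  by rewrite (cvg_lim _ (@cvg_geometric_eseries_half R (C * 2) 0)) ?ltry.
- by move=> k; exact: measurable_int (ie k).
- by move=> k x _; rewrite lee_fin.
Qed.

Let E := [set x | (S x < +oo)%E].

Let mE : measurable E.
Proof. by rewrite -[E]setTI; exact: emeasurable_fun_infty_o. Qed.

Let E_ae : {ae P, forall x, E x}.
Proof.
have iS : P.-integrable setT S.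
  apply/integrableP; split => //.
  by under eq_integral do rewrite gee0_abs//.
apply: filterS (integrable_ae measurableT iS) => x /(_ Logic.I) /=.
by rewrite ge0_fin_numE.
Qed.

Let dist_le x k : E x -> \sum_i `|Y k i x - Y 0 i x| <= fine (S x).
Proof.
move=> Ex; rewrite -lee_fin fineK ?ge0_fin_numE//.
apply: (@le_trans _ _ (\sum_(0 <= j < k) (e j x)%:E)%E); last first.
  by apply: nneseries_lim_ge => j _ _; rewrite lee_fin.
rewrite sumEFin lee_fin; elim: k => [|k IH].
  by rewrite big_geq// big1// => i _; rewrite subrr normr0.
rewrite big_nat_recr//=; apply: le_trans (lerD IH (lexx _)).
rewrite -big_split/=; apply: ler_sum => i _.
by rewrite addrC; apply: le_trans (ler_normD _ _); rewrite addrA subrK.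
Qed.

Let cvgY x i : E x -> cvgn (fun k => Y k i x).
Proof.
move=> Ex; have -> : (fun k => Y k i x) =
    (fun k => Y 0 i x + series (telescope (fun k => Y k i x)) k).
  by apply/funext => k; rewrite (eq_sum_telescope (fun k => Y k i x)).
apply: is_cvgD; first exact: is_cvg_cst.
apply: (@normed_cvg _ R^o).
apply: nondecreasing_is_cvgn.
  by apply: nondecreasing_series => n _ _ /=; exact: normr_ge0.
exists (fine (S x)) => _ [k _ <-]; rewrite -lee_fin fineK ?ge0_fin_numE//.
apply: (@le_trans _ _ (\sum_(0 <= j < k) (e j x)%:E)%E); last first.
  by apply: nneseries_lim_ge => j _ _; rewrite lee_fin.
rewrite sumEFin lee_fin /series/=; apply: ler_sum => j _.
by rewrite /e (bigD1 i)//= lerDl sumr_ge0.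
Qed.

(** The sum [S] of all increments is integrable, hence finite almost everywhere. On the set [E]
    where it is finite the sequences converge, and [S] dominates their distance to the start.
    Multiplying by [\1_E] makes the limit exist at every point, which gives measurability and the
    value 0 off [E]. *)
Lemma fast_limit : exists (X : I -> T -> R) (E : set T) (D : T -> R),
  [/\ forall i, measurable_fun setT (X i),
      measurable E /\ {ae P, forall x, E x},
      forall x i, E x -> (fun k => Y k i x) @ \oo --> X i x,
      (forall x i, ~ E x -> X i x = 0) &
      intg P D /\ forall x k, 0 <= D x /\
        (E x -> \sum_i `|Y k i x - Y 0 i x| <= D x)].
Proof.
exists (fun i x => lim ((fun k => \1_E x * Y k i x) @ \oo)), E, (fun x => fine (S x)).
have cE x i : E x -> (fun k => \1_E x * Y k i x) = (fun k => Y k i x).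
  by move=> Ex; apply/funext => k; rewrite indicE mem_set// mul1r.
have cnE x i : ~ E x -> (fun k => \1_E x * Y k i x) = (fun k => 0).
  by move=> Ex; apply/funext => k; rewrite indicE memNset// mul0r.
split.
- move=> i; apply: (measurable_fun_cvg (h := fun k x => \1_E x * Y k i x)).
    by move=> k; apply: measurable_funM => //; exact: measurable_indic.
  move=> x _; have [Ex|Ex] := pselect (E x).
    by rewrite cE//; exact: cvgY.
  by rewrite cnE//; exact: is_cvg_cst.
- by split.
- by move=> x i Ex; rewrite cE//; exact: cvgY.
- by move=> x i Ex; rewrite cnE// lim_cst.
- split.
    apply/integrableP; split.
      by apply/measurable_EFinP; exact: measurableT_comp.
    apply: le_lt_trans int_S; apply: ge0_le_integral => //.
    - by apply/measurable_EFinP; apply: measurableT_comp => //; exact: measurableT_comp.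
    - move=> x _ /=; rewrite ger0_norm ?fine_ge0//.
      by case: (S x) (S_ge0 x) => [r| |]//= _; rewrite leey.
  by move=> x k; split; [exact: fine_ge0 | exact: dist_le].
Qed.

End fast_limit.

(** * Dyadic rounding *)

Section rounding.
Variable R : realType.
Implicit Types s a : R.

(** For [a >= 0] this is the integer part of [a] capped at [N]. It is written as a sum of threshold
    indicators because each of them is to become one random bit. *)
Definition hits N a := \sum_(l < N) (l.+1%:R <= a :> R)%R%:R : R.

Lemma hits_all N a : N%:R <= a -> hits N a = N%:R.
Proof.
move=> Na; rewrite /hits (eq_bigr (fun=> 1)) => [|l _].
  by rewrite sumr_const card_ord.
by rewrite (le_trans _ Na)// ler_nat.
Qed.

Lemma hits_le N a : 0 <= a -> 0 <= hits N a <= a.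
Proof.
move=> a0; rewrite sumr_ge0//=; elim: N => [|N IH]; first by rewrite /hits big_ord0.
have [Na|Na] := leP N.+1%:R a; first by rewrite hits_all.
by rewrite /hits big_ord_recr/= (lt_geF Na) addr0.
Qed.

Lemma hits_ge N a : a <= N.+1%:R -> a - 1 <= hits N a.
Proof.
elim: N => [|N IH aN]; first by rewrite /hits big_ord0 subr_le0.
have [Na|Na] := leP N.+1%:R a.
  by rewrite hits_all// lerBlDr natr1.
by rewrite /hits big_ord_recr/= (lt_geF Na) addr0 IH// ltW.
Qed.

Lemma hits_neg N a : a <= 0 -> hits N a = 0.
Proof.
by move=> a0; apply: big1 => l _; rewrite leNgt (le_lt_trans a0).
Qed.

(* Rounding towards 0 on the grid of mesh [2^-k], truncated at [2^k]. *)
Definition rnd k s := 2^-1 ^+ k *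
  (hits (4 ^ k) (2 ^+ k * s) - hits (4 ^ k) (2 ^+ k * - s)).

Lemma rndN k s : rnd k (- s) = - rnd k s.
Proof. by rewrite /rnd opprK -mulrN opprB. Qed.

(** Below the truncation level the error is at most the mesh [2^-k]; above it [s >= 2^k], so the
    error is at most [s <= 2^-k s^2]. The quadratic bound makes the error a small multiple of the
    growth weight, uniformly in [s]. *)
Let rnd_pos k s : 0 <= s -> 0 <= rnd k s <= s /\ s - rnd k s <= 2^-1 ^+ k * (1 + s ^+ 2).
Proof.
move=> s0; have p0 : 0 < 2 ^+ k :> R by rewrite exprn_gt0.
have h0 : 0 < 2^-1 ^+ k :> R by rewrite exprn_gt0.
have hp : 2^-1 ^+ k * 2 ^+ k = 1 :> R by rewrite -exprMn mulVf// expr1n.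
have ps : 0 <= 2 ^+ k * s by rewrite mulr_ge0// ltW.
rewrite /rnd [hits _ (_ * - s)]hits_neg ?mulrN ?oppr_le0// subr0.
have /andP[l0 ls] := hits_le (4 ^ k) ps.
have rs : 2^-1 ^+ k * hits (4 ^ k) (2 ^+ k * s) <= s.
  by have := ler_wpM2l (ltW h0) ls; rewrite mulrA hp mul1r.
have r0 : 0 <= 2^-1 ^+ k * hits (4 ^ k) (2 ^+ k * s) by rewrite mulr_ge0// ltW.
rewrite r0 rs; split => //.
have [aN|Na] := leP (2 ^+ k * s) (4 ^ k).+1%:R.
  have := ler_wpM2l (ltW h0) (hits_ge aN); rewrite mulrBr mulrA hp mul1r mulr1.
  have : 0 <= 2^-1 ^+ k * s ^+ 2 by rewrite mulr_ge0 ?sqr_ge0// ltW.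
  by rewrite mulrDr mulr1; lra.
have p2 : (2 ^+ k : R) * 2 ^+ k = (4 ^ k)%:R by rewrite -exprMn -natrM -natrX.
have ks : 2 ^+ k <= s.
  rewrite -(ler_pM2l p0) p2; apply: le_trans (ltW Na).
  by rewrite ler_nat.
have : s <= 2^-1 ^+ k * s ^+ 2.
  have := ler_wpM2l (ltW h0) (ler_wpM2r s0 ks); rewrite mulrA hp mul1r.
  by rewrite -expr2.
have : 0 <= (2^-1 ^+ k : R) by rewrite ltW.
by rewrite mulrDr mulr1; lra.
Qed.

Lemma rnd_norm_le k s : `|rnd k s| <= `|s|.
Proof.
wlog s0 : s / 0 <= s => [h|].
  have [/h//|s0] := leP 0 s.
  by have := h (- s); rewrite oppr_ge0 (ltW s0) rndN !normrN => /(_ isT).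
by have [/andP[r0 rs] _] := rnd_pos k s0; rewrite !ger0_norm.
Qed.

Lemma rnd_err k s : `|rnd k s - s| <= 2^-1 ^+ k * (1 + s ^+ 2).
Proof.
wlog s0 : s / 0 <= s => [h|].
  have [/h//|s0] := leP 0 s.
  have := h (- s); rewrite oppr_ge0 (ltW s0) rndN sqrrN => /(_ isT).
  by rewrite -opprD normrN.
have [/andP[r0 rs] rerr] := rnd_pos k s0.
by rewrite distrC ger0_norm ?subr_ge0.
Qed.

End rounding.

(** * Representation of a positive functional by random variables *)

Section riesz.
Variables (R : realType) (T : Type) (M : (T -> R) -> R) (V : set (T -> R)).
Variables (I : finType) (c : I -> T -> R).
Hypothesis V_lin : forall F G k, V F -> V G -> V (fun t => F t + k * G t).
Hypothesis V_le : forall F G, V G -> (forall t, `|F t| <= G t) -> V F.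
Hypothesis V1 : V (fun=> 1).
Hypothesis V_sqr : forall i, V (fun t => c i t ^+ 2).
Hypothesis M_lin : forall F G k, V F -> V G ->
  M (fun t => F t + k * G t) = M F + k * M G.
Hypothesis M_ge0 : forall F, V F -> (forall t, 0 <= F t) -> 0 <= M F.
Hypothesis M1 : M (fun=> 1) = 1.

Let V0 : V (fun=> 0).
Proof. by apply: V_le V1 _ => t; rewrite normr0. Qed.

Let VZ k F : V F -> V (fun t => k * F t).
Proof. by move=> VF; have := V_lin k V0 VF; under eq_fun do rewrite add0r. Qed.

Let VD F G : V F -> V G -> V (fun t => F t + G t).
Proof. by move=> VF VG; have := V_lin 1 VF VG; under eq_fun do rewrite mul1r. Qed.

Let VB F G : V F -> V G -> V (fun t => F t - G t).
Proof. by move=> VF VG; have := V_lin (-1) VF VG; under eq_fun do rewrite mulN1r. Qed.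

Let VS (J : finType) (F : J -> T -> R) : (forall j, V (F j)) -> V (fun t => \sum_j F j t).
Proof.
move=> VF; elim: (index_enum J) => [|j s IH].
  by under eq_fun do rewrite big_nil.
by under eq_fun do rewrite big_cons; exact: VD.
Qed.

Let V_bounded F : (exists C : R, forall t, `|F t| <= C) -> V F.
Proof.
move=> [C FC]; apply: (V_le (VZ C V1)) => t.
by rewrite mulr1.
Qed.

Let MB F G : V F -> V G -> M (fun t => F t - G t) = M F - M G.
Proof.
by move=> VF VG; have := M_lin (-1) VF VG; rewrite mulN1r; under eq_fun do rewrite mulN1r.
Qed.

Let MZ k F : V F -> M (fun t => k * F t) = k * M F.
Proof.
move=> VF; have M0 : M (fun=> 0) = 0.
  by have := MB V0 V0; under eq_fun do rewrite subrr; rewrite subrr.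
by have := M_lin k V0 VF; under eq_fun do rewrite add0r; rewrite M0 add0r.
Qed.

Let M_le F G : V F -> V G -> (forall t, F t <= G t) -> M F <= M G.
Proof.
move=> VF VG FG; rewrite -subr_ge0 -MB//; apply: M_ge0; first exact: VB.
by move=> t; rewrite subr_ge0.
Qed.

Let w t := \sum_i (1 + c i t ^+ 2).

Let Vw : V w.
Proof. by apply: VS => i; apply: VD => //; exact: V_sqr. Qed.

(** All threshold comparisons, for every level, coordinate, threshold and sign, are listed in one
    sequence of bits. A single random sequence then carries the roundings of all levels at once, and
    their almost sure limit makes sense. *)
Let feature n t : bool :=
  match (unpickle n : option (nat * I * nat * bool)) with
  | Some (k, i, l, s) => if s then l.+1%:R <= 2 ^+ k * c i t
                         else l.+1%:R <= 2 ^+ k * - c i t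
  | None => false
  end.

Let grid k (i : I) (b : nat -> bool) : R := 2^-1 ^+ k *
  (\sum_(l < 4 ^ k) (b (pickle (k, i, nat_of_ord l, true)))%:R -
   \sum_(l < 4 ^ k) (b (pickle (k, i, nat_of_ord l, false)))%:R).

Let grid_feature k i t : grid k i (feature ^~ t) = rnd k (c i t).
Proof.
by rewrite /grid /rnd /hits; congr (_ * (_ - _)); apply: eq_bigr => l _;
  rewrite /feature pickleK.
Qed.

Let grid_finite k : exists K, forall b b' : nat -> bool,
  (forall n, (n < K)%N -> b n = b' n) -> forall i, grid k i b = grid k i b'.
Proof.
pose p (q : I * 'I_(4 ^ k) * bool) := pickle (k, q.1.1, nat_of_ord q.1.2, q.2).
exists (\max_q p q)%N.+1 => b b' bb i; rewrite /grid.
have e (l : 'I_(4 ^ k)%N) (s : bool) :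
    b (pickle (k, i, nat_of_ord l, s)) = b' (pickle (k, i, nat_of_ord l, s)).
  by apply: bb; rewrite ltnS; exact: (@leq_bigmax _ p (i, l, s)).
by congr (_ * (_ - _)); apply: eq_bigr => l _; rewrite e.
Qed.

Let P : probability _ R := @uniform_prob R 0 1 ltr01.

Let Y k i x := grid k i (bit M feature ^~ x).

(** Two consecutive levels are needed for the increments. [G] may be arbitrary, since the rounded
    coordinates depend on finitely many bits. *)
Let law k (G : (I -> R) -> (I -> R) -> R) :
  intg P (fun x => G (Y k ^~ x) (Y k.+1 ^~ x)) /\
  \int[P]_x (G (Y k ^~ x) (Y k.+1 ^~ x)) =
  M (fun t => G (fun i => rnd k (c i t)) (fun i => rnd k.+1 (c i t))).
Proof.
have [K HK] := grid_finite k; have [K' HK'] := grid_finite k.+1.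
have [|iG ->] := bits_law V_lin V_bounded M_lin M_ge0 M1
  (K := maxn K K') (G := fun b => G (grid k ^~ b) (grid k.+1 ^~ b)) feature.
  move=> b b' bb; congr G; apply/funext => i.
    by apply: HK => n nK; apply: bb; rewrite leq_max nK.
  by apply: HK' => n nK; apply: bb; rewrite leq_max nK orbT.
split; first exact: iG.
by congr M; apply/funext => t; congr G; apply/funext => i; rewrite grid_feature.
Qed.

Let mY k i : measurable_fun setT (Y k i).
Proof. exact: intg_measurable (law k (fun a _ => a i)).1. Qed.

Let sum_rnd_err k t : \sum_i `|rnd k (c i t) - c i t| <= 2^-1 ^+ k * w t.
Proof. by rewrite mulr_sumr; apply: ler_sum => i _; exact: rnd_err. Qed.

Let ie k : intg P (fun x => \sum_i `|Y k.+1 i x - Y k i x|).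
Proof. exact: (law k (fun a b => \sum_i `|b i - a i|)).1. Qed.

Let halfpow k : (2^-1 ^+ k : R) = (2 ^+ k)^-1. Proof. by rewrite exprVn. Qed.

Let e_small k : \int[P]_x (\sum_i `|Y k.+1 i x - Y k i x|) <= (2 * M w) / 2 ^+ k.
Proof.
have [_ ->] := law k (fun a b => \sum_i `|b i - a i|).

have le t : \sum_i `|rnd k.+1 (c i t) - rnd k (c i t)| <= 2 / 2 ^+ k * w t.
  apply: (@le_trans _ _ (\sum_i `|rnd k.+1 (c i t) - c i t| + \sum_i `|rnd k (c i t) - c i t|)).
    rewrite -big_split/=; apply: ler_sum => i _.
    by rewrite [X in _ <= _ + X]distrC; apply: le_trans (ler_normD _ _); rewrite addrA subrK.
  apply: (le_trans (lerD (sum_rnd_err _ _) (sum_rnd_err _ _))).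
  rewrite -mulrDl ler_wpM2r//; last first.
    by rewrite exprS halfpow; have : 0 <= (2 ^+ k : R)^-1 by [rewrite invr_ge0 exprn_ge0]; lra.
  by apply: sumr_ge0 => i _; rewrite addr_ge0// sqr_ge0.
rewrite mulrAC -MZ//; apply: M_le => //; last exact: VZ.
apply: (V_le (VZ (2 / 2 ^+ k) Vw)) => t.
by rewrite ger0_norm// sumr_ge0.
Qed.

Let lipschitz (F : (I -> R) -> R) := exists L : R, 0 <= L /\
  forall a b, `|F a - F b| <= L * \sum_i `|a i - b i|.

Let V_lipschitz F k : lipschitz F -> V (fun t => F (fun i => rnd k (c i t))).
Proof.
move=> [L [L0 FL]].
apply: (V_le (G := fun t => `|F (fun=> 0)| + L * w t)).
  apply: VD; last exact: VZ.
  by apply: V_bounded; exists (`|F (fun=> 0)|) => t; rewrite normr_id.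
move=> t; have := FL (fun i => rnd k (c i t)) (fun=> 0).
have : \sum_i `|rnd k (c i t) - 0| <= w t.
  apply: ler_sum => i _; rewrite subr0; apply: (le_trans (rnd_norm_le _ _)).
  by rewrite ler_norml; have := sqr_ge0 (c i t - 1); have := sqr_ge0 (c i t + 1);
     rewrite !expr2; nra.
move=> /(ler_wpM2l L0) h1 h2.
have := ler_normD (F (fun=> 0)) (F (fun i => rnd k (c i t)) - F (fun=> 0)).
by rewrite [F (fun=> 0) + _]addrC subrK; lra.
Qed.

Let V_lipschitz_c F : lipschitz F -> V (fun t => F (c ^~ t)).
Proof.
move=> [L [L0 FL]].
apply: (V_le (G := fun t => `|F (fun=> 0)| + L * w t)).
  apply: VD; last exact: VZ.
  by apply: V_bounded; exists (`|F (fun=> 0)|) => t; rewrite normr_id.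
move=> t; have := FL (c ^~ t) (fun=> 0).
have : \sum_i `|c i t - 0| <= w t.
  apply: ler_sum => i _; rewrite subr0.
  by rewrite ler_norml; have := sqr_ge0 (c i t - 1); have := sqr_ge0 (c i t + 1);
     rewrite !expr2; nra.
move=> /(ler_wpM2l L0) h1 h2.
have := ler_normD (F (fun=> 0)) (F (c ^~ t) - F (fun=> 0)).
by rewrite [F (fun=> 0) + _]addrC subrK; lra.
Qed.

Let M_rnd_cvg F : lipschitz F ->
  M (fun t => F (fun i => rnd k (c i t))) @[k --> \oo] --> M (fun t => F (c ^~ t)).
Proof.
move=> FL; have [L [L0 FL']] := FL.
apply/cvgrPdist_le => e e0.
have h k : `|M (fun t => F (c ^~ t)) - M (fun t => F (fun i => rnd k (c i t)))| <=
    L * M w * 2^-1 ^+ k.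
  have VF := V_lipschitz_c FL; have VFk := V_lipschitz k FL.
  have key G H : V G -> V H -> (forall t, G t - H t <= L * 2^-1 ^+ k * w t) ->
      M G - M H <= L * M w * 2^-1 ^+ k.
    move=> VG VH GH; rewrite -MB// mulrAC -MZ//; apply: M_le => //; first exact: VB.
    exact: VZ.
  have b t : `|F (c ^~ t) - F (fun i => rnd k (c i t))| <= L * 2^-1 ^+ k * w t.
    apply: (le_trans (FL' _ _)); rewrite -mulrA ler_wpM2l//.
    by under eq_bigr do rewrite distrC; exact: sum_rnd_err.
  rewrite ler_norml lerNl opprB; apply/andP; split; apply: key => // t.
    by apply: le_trans (b t); rewrite distrC ler_norm.
  by apply: le_trans (b t); rewrite ler_norm.
have : L * M w * 2^-1 ^+ k @[k --> \oo] --> L * M w * 0.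
  apply: cvgMr; apply: (@cvg_expr R (2^-1 : R)).
  by rewrite ger0_norm// invf_lt1// ltr1n.
rewrite mulr0 => /cvgrPdist_le/(_ e e0); apply: filterS => k; rewrite sub0r normrN.
move=> hk; apply: (le_trans (h k)); apply: le_trans hk; exact: ler_norm.
Qed.

(** Squares are of the same order as the weight [w], so the truncation error of [c i t ^+ 2] is not
    small against [w] and mass of [M] at infinity can get lost. Fatou's lemma gives the inequality;
    Lipschitz functions are below that order and keep equality. *)
Lemma riesz : exists X : I -> measurableTypeR R -> R,
  [/\ forall i, measurable_fun setT (X i),
      (forall F, lipschitz F -> intg P (fun x => F (X ^~ x)) /\
         \int[P]_x (F (X ^~ x)) = M (fun t => F (c ^~ t))) &
      forall i, (\int[P]_x ((X i x) ^+ 2)%:E <= (M (fun t => c i t ^+ 2))%:E)%E].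
Proof.
have [X [E [D [mX [mE Eae] YX X0 [iD DE]]]]] := @fast_limit _ _ _ P _ _ _ mY ie e_small.
exists X.
have PE (F : measurableTypeR R -> R) : measurable_fun setT F ->
    (\int[P]_x (\1_E x * F x)%:E = \int[P]_x (F x)%:E)%E.
  move=> mF; apply: ae_eq_integral => //.
  - by apply/measurable_EFinP; apply: measurable_funM => //; exact: measurable_indic.
  - exact/measurable_EFinP.
  by apply: filterS Eae => x Ex _; rewrite indicE mem_set// mul1r.
split => //.
- move=> F FL; have [L [L0 FL']] := FL.
  have lawF k := law k (fun a _ => F a).
  (* [f k] is [F (Y k)] on [E] and [F 0] off [E], where [X] vanishes: it converges to [F (X)] at
     every point. *)
  pose f k x := \1_E x * (F (Y k ^~ x) - F (fun=> 0)) + F (fun=> 0).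
  have mFY k : measurable_fun setT (fun x => F (Y k ^~ x)).
    exact: intg_measurable (lawF k).1.
  have mf k : measurable_fun setT (f k).
    apply: measurable_funD => //; apply: measurable_funM; first exact: measurable_indic.
    by apply: measurable_funB; [exact: mFY | exact: measurable_cst].
  have fX x : f ^~ x @ \oo --> F (X ^~ x).
    have [Ex|nEx] := pselect (E x); last first.
      rewrite (_ : X ^~ x = fun=> 0); last by apply/funext => i; exact: X0.
      rewrite (_ : f ^~ x = fun=> F (fun=> 0)); first exact: cvg_cst.
      by apply/funext => k; rewrite /f indicE memNset// mul0r add0r.
    rewrite (_ : f ^~ x = fun k => F (Y k ^~ x)); last first.
      by apply/funext => k; rewrite /f indicE mem_set// mul1r subrK.
    have s0 : \sum_i `|Y k i x - X i x| @[k --> \oo] --> \sum_(i : I) (0 : R).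
      apply: cvg_big => [|i _]; first exact: add_continuous.
      have c0 : Y k i x - X i x @[k --> \oo] --> X i x - X i x.
        by apply: cvgB; [exact: YX | exact: cvg_cst].
      have h := cvg_norm c0; rewrite subrr normr0 in h; exact: h.
    have c0 : L * \sum_i `|Y k i x - X i x| @[k --> \oo] --> L * \sum_(i : I) (0 : R).
      exact: cvgMr.
    rewrite big1// mulr0 in c0.
    apply/cvgrPdist_le => e e0; move/cvgrPdist_le : c0 => /(_ e e0).
    apply: filterS => k; rewrite sub0r normrN => h.
    rewrite distrC; apply: (le_trans (FL' _ _)); exact: le_trans (ler_norm _) h.
  pose g x := `|F (Y 0 ^~ x) - F (fun=> 0)| + L * D x + `|F (fun=> 0)|.
  have icst r : intg P (fun=> r) by exact: finite_measure_integrable_cst.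
  have ig : intg P g.
    apply: intgD => //; apply: intgD; last exact: intgZ.
    by apply: intg_norm; apply: intgB => //; exact: (lawF 0).1.
  have fg k x : `|f k x| <= g x.
    apply: (le_trans (ler_normD _ _)); rewrite lerD2r.
    have [Ex|nEx] := pselect (E x); last first.
      rewrite indicE memNset// mul0r normr0 addr_ge0// mulr_ge0//.
      exact: (DE x 0).1.
    rewrite indicE mem_set// mul1r.
    have := ler_normD (F (Y 0 ^~ x) - F (fun=> 0)) (F (Y k ^~ x) - F (Y 0 ^~ x)).
    rewrite [_ + (F (Y k ^~ x) - _)]addrC addrA subrK => /le_trans; apply.
    rewrite lerD2l; apply: (le_trans (FL' _ _)); rewrite ler_wpM2l//.
    exact: (DE x k).2.
  have mFX : measurable_fun setT (fun x => F (X ^~ x)).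
    by apply: (measurable_fun_cvg mf) => x _; exact: fX.
  have [iFX cFX] := Rint_dominated mf mFX (aeW _ fX) ig fg.
  split => //; apply/eqP; rewrite eq_sym; apply/eqP.
  apply: cvg_unique (M_rnd_cvg FL) _; first exact: Rhausdorff.
  rewrite (_ : (fun k => M _) = (fun k => \int[P]_x f k x)) //.
  apply/funext => k; rewrite -(lawF k).2 /Rintegral; congr fine.
  apply: ae_eq_integral => //.
    by apply/measurable_EFinP; exact: mFY.
    by apply/measurable_EFinP; exact: mf.
  by apply: filterS Eae => x Ex _; rewrite /f indicE mem_set// mul1r subrK.
- move=> i.
  pose f k x := (\1_E x * (Y k i x ^+ 2))%:E.
  have mf k : measurable_fun setT (f k).
    apply/measurable_EFinP; apply: measurable_funM; first exact: measurable_indic.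
    by apply: measurable_funX; exact: mY.
  have f0 k x : setT x -> (0 <= f k x)%E by move=> _; rewrite lee_fin mulr_ge0// sqr_ge0.
  have fX x : f ^~ x @ \oo --> (X i x ^+ 2)%:E.
    apply: cvg_EFin; first exact: nearW.
    have [Ex|nEx] := pselect (E x); last first.
      rewrite X0// expr0n/= (_ : _ \o _ = fun=> 0); first exact: cvg_cst.
      by apply/funext => k; rewrite /= indicE memNset// mul0r.
    rewrite (_ : _ \o _ = fun k => Y k i x ^+ 2); last first.
      by apply/funext => k; rewrite /= indicE mem_set// mul1r.
    by rewrite expr2; under eq_fun do rewrite expr2; apply: cvgM; exact: YX.
  have le k : (\int[P]_x f k x <= (M (fun t => c i t ^+ 2))%:E)%E.
    rewrite /f PE; last by apply: measurable_funX; exact: mY.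
    have [iY eY] := law k (fun a _ => a i ^+ 2).
    rewrite Rint_EFin// eY lee_fin.
    have sq t : rnd k (c i t) ^+ 2 <= c i t ^+ 2.
      rewrite -[leLHS]real_normK ?num_real// -[leRHS]real_normK ?num_real//.
      by rewrite lerXn2r ?nnegrE// rnd_norm_le.
    apply: M_le => //; apply: (V_le (V_sqr i)) => t.
    by rewrite ger0_norm ?sqr_ge0.
  have := fatou P measurableT mf f0.
  rewrite (eq_integral (fun x => (X i x ^+ 2)%:E)); last first.
    move=> x _; rewrite is_cvg_limn_einfE; last by apply/cvg_ex; eexists; exact: fX.
    exact: cvg_lim (fX x).
  move=> /le_trans; apply; rewrite limn_einf_lim.
  apply: lime_le; first exact: is_cvg_einfs.
  apply: nearW => n; apply: le_trans (le n); apply: ereal_inf_lbound.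
  by exists n => /=.
Qed.

End riesz.

(** * Measures and conditional means on Euclidean space *)

Section borel_Rd.
Variables (R : realType) (d : nat).
Implicit Types (x a b : 'rV[R]_d).

Definition box a b : set 'rV[R]_d := [set x | forall i, a ord0 i < x ord0 i < b ord0 i].

Definition boxes : set (set 'rV[R]_d) := [set A | exists a b, A = box a b].

Lemma continuous_measurable (f : 'rV[R]_d -> R) : continuous f ->
  measurable_fun setT (f : Rd R d -> R).
Proof.
move=> cf; apply: (measurability _ (RGenOInfty.measurableE R)).
move=> _ [_ [x ->] <-]; rewrite setTI; apply: sub_sigma_algebra.
by apply: open_comp => // y _; exact: cf.
Qed.

Lemma measurable_coord i : measurable_fun setT (fun x : Rd R d => (x : 'rV[R]_d) ord0 i).
Proof. by apply: continuous_measurable; exact: coord_continuous. Qed.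

Lemma preimage_box_measurable e (T : measurableType e) (h : T -> 'rV[R]_d) :
  (forall i, measurable_fun setT (fun t => h t ord0 i)) ->
  forall a b, measurable (h @^-1` box a b).
Proof.
move=> mh a b.
rewrite (_ : _ @^-1` _ = \bigcap_(i in [set: 'I_d])
  ((fun t => h t ord0 i) @^-1` `]a ord0 i, b ord0 i[)); last first.
  apply/seteqP; split => t /=.
    by move=> ht i _ /=; rewrite in_itv; exact: ht.
  by move=> ht i; have := ht i Logic.I; rewrite /= in_itv.
apply: fin_bigcap_measurable; first exact: finite_finset.
by move=> i _; rewrite -[_ @^-1` _]setTI; exact: mh.
Qed.

Lemma measurable_box a b : measurable (box a b : set (Rd R d)).
Proof. exact: (@preimage_box_measurable _ (Rd R d) id measurable_coord a b). Qed.

Lemma boxesI : setI_closed boxes.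
Proof.
move=> _ _ [a [b ->]] [a' [b' ->]].
exists (\row_i Num.max (a ord0 i) (a' ord0 i)), (\row_i Num.min (b ord0 i) (b' ord0 i)).
apply/seteqP; split => x /=.
  by move=> [h h'] i; rewrite !mxE gt_max lt_min; have /andP[-> ->] := h i; have /andP[-> ->] := h' i.
by move=> h; split=> i; have := h i; rewrite !mxE gt_max lt_min
  => /andP[/andP[? ?] /andP[? ?]]; apply/andP.
Qed.

Lemma Rd_measurableE : (measurable : set (set (Rd R d))) = <<s boxes>>.
Proof.
apply/seteqP; split; last first.
  apply: smallest_sub; first exact: sigma_algebra_measurable.
  by move=> _ [a [b ->]]; exact: measurable_box.
apply: smallest_sub; first exact: smallest_sigma_algebra.
(* An open set is the union of the boxes with rational corners that it contains, and there are
   countably many such corners. *)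
move=> U oU; pose rbox (p : 'rV[rat]_d * 'rV[rat]_d) := box (map_mx ratr p.1) (map_mx ratr p.2).
rewrite (_ : U = \bigcup_p (if `[< rbox p `<=` U >] then rbox p else set0)).
  apply: (@countable_bigcupT_measurable _ (g_sigma_algebraType boxes)).
    exact: countableP.
  move=> p; case: ifPn => _; last exact: measurable0.
  by apply: sub_sigma_algebra; eexists; eexists.
apply/seteqP; split=> [x Ux|x [p _]]; last first.
  by case: ifPn => // /asboolP; apply.
have /nbhs_ballP[e e0 eU] : nbhs x U by exact: open_nbhs_nbhs.
have /choice[a aP] i : exists q : rat, x ord0 i - e < ratr q < x ord0 i.
  have [|q] := @rat_in_itvoo R (x ord0 i - e) (x ord0 i); first by rewrite ltrBlDr ltrDl.
  by rewrite in_itv/=; exists q.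
have /choice[b bP] i : exists q : rat, x ord0 i < ratr q < x ord0 i + e.
  have [|q] := @rat_in_itvoo R (x ord0 i) (x ord0 i + e); first by rewrite ltrDl.
  by rewrite in_itv/=; exists q.
have rU : rbox (\row_i a i, \row_i b i) `<=` U.
  move=> y /= hy; apply: eU; split => // i j; rewrite ord1 /ball/= ltr_distlC.
  have := hy j; have /andP[? ?] := aP j; have /andP[? ?] := bP j; rewrite !mxE => /andP[? ?].
  by apply/andP; split; lra.
exists (\row_i a i, \row_i b i) => //; rewrite asboolT//.
by move=> i /=; rewrite !mxE; have /andP[_ ->] := aP i; have /andP[-> _] := bP i.
Qed.

Lemma measurable_rV e (T : measurableType e) (h : T -> 'rV[R]_d) :
  (forall i, measurable_fun setT (fun t => h t ord0 i)) ->
  measurable_fun setT (h : T -> Rd R d).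
Proof.
move=> mh; apply: (measurability _ Rd_measurableE) => _ [_ [a [b ->]] <-].
by rewrite setTI; exact: preimage_box_measurable.
Qed.

(** The open boxes form a generating class stable under intersection, so equality on boxes is
    enough, and it passes to the limit along the tests by dominated convergence. *)
Lemma measure_eq_by_tests (m1 m2 : {measure set (Rd R d) -> \bar R}) :
  (m1 setT < +oo)%E -> (m2 setT < +oo)%E ->
  (forall a b, exists phi : nat -> Rd R d -> R,
    [/\ forall n, measurable_fun setT (phi n),
        forall n x, 0 <= phi n x <= 1,
        forall x, phi ^~ x @ \oo --> (\1_(box a b) x : R) &
        forall n, \int[m1]_x phi n x = \int[m2]_x phi n x]) ->
  forall A, measurable A -> m1 A = m2 A.
Proof.
move=> f1 f2 tests.
pose g (k : nat) := box (const_mx (- k%:R)) (const_mx k%:R).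
apply: (@measure_unique _ R (Rd R d) boxes g _ _ _ _ m1 m2).
- exact: Rd_measurableE.
- exact: boxesI.
- by move=> k; exists (const_mx (- k%:R)), (const_mx k%:R).
- apply/seteqP; split => // x _; have := archi_boundP (normr_ge0 x).
  set k := Num.bound `|x| => xk; exists k => // i; rewrite !mxE.
  by rewrite -ltr_norml; apply: le_lt_trans xk; exact: coord_norm_le.
- move=> _ [a [b ->]]; have [phi [mphi phi01 cphi ephi]] := tests a b.
  have mB : measurable (box a b : set (Rd R d)) by exact: measurable_box.
  have fin (m : {measure set (Rd R d) -> \bar R}) : (m setT < +oo)%E ->
      m (box a b) \is a fin_num /\
      \int[m]_x phi n x @[n --> \oo] --> fine (m (box a b)).
    move=> mf; split.
      rewrite ge0_fin_numE//; apply: le_lt_trans mf; apply: le_measure; rewrite ?inE//.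
    have [||||_] := @Rint_dominated _ _ _ m phi \1_(box a b) (fun=> 1) mphi.
    - exact: measurable_indic.
    - exact: aeW.
    - apply/integrableP; split; first exact/measurable_EFinP.
      by rewrite /= normr1 integral_cst// mul1e.
    - by move=> n x; have /andP[? ?] := phi01 n x; rewrite ger0_norm.
    by rewrite Rint_indic.
  have [n1 c1] := fin m1 f1; have [n2 c2] := fin m2 f2.
  rewrite -(fineK n1) -(fineK n2); congr EFin.
  rewrite (funext ephi : (fun n => \int[m1]_x phi n x) = _) in c1.
  exact: cvg_unique c1 c2.
- move=> k; apply: le_lt_trans f1; apply: le_measure; rewrite ?inE//.
  exact: measurable_box.
Qed.

End borel_Rd.

(** * Vanishing conditional means *)

Section orthogonality.
Context e (S : measurableType e) (R : realType) (P : {measure set S -> \bar R}).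
Variables (d : nat).
Implicit Types (W : S -> R) (h : S -> Rd R d).

(* [E[W | h] = 0] *)
Definition orth W h := forall A : set (Rd R d), measurable A ->
  \int[P]_s (W s * \1_A (h s)) = 0.

Let measurable_indic_comp h (A : set (Rd R d)) : measurable_fun setT h ->
  measurable A -> measurable_fun setT (fun s => \1_A (h s) : R).
Proof.
by move=> mh mA; apply: (measurableT_comp (f := \1_A : Rd R d -> R)) => //; exact: measurable_indic.
Qed.

Let intg_mul_bounded W (f : S -> R) : intg P W -> measurable_fun setT f ->
  (forall s, `|f s| <= 1) -> intg P (fun s => W s * f s).
Proof.
move=> iW mf f1; apply: (intg_le _ _ (intg_norm iW)).
  by apply: measurable_funM => //; exact: intg_measurable iW.
by move=> s; rewrite normrM ler_piMr.
Qed.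

Let indic_le1 (A : set (Rd R d)) x : `|\1_A x : R| <= 1.
Proof. by rewrite indicE; case: (_ \in _); rewrite ?normr1 ?normr0. Qed.

Let dominated W (f_ : nat -> S -> R) (f : S -> R) : intg P W ->
  (forall n, measurable_fun setT (f_ n)) -> measurable_fun setT f ->
  (forall s, f_ ^~ s @ \oo --> f s) ->
  (forall n s, `|f_ n s| <= 1) ->
  \int[P]_s (W s * f_ n s) @[n --> \oo] --> \int[P]_s (W s * f s).
Proof.
move=> iW mf_ mf ff f1.
have mW := intg_measurable iW.
have [||||_] := @Rint_dominated _ _ _ P (fun n s => W s * f_ n s) (fun s => W s * f s)
  (fun s => `|W s|) _ _ _ (intg_norm iW) => //.
- by move=> n; exact: measurable_funM.
- exact: measurable_funM.
- by apply: aeW => s; apply: cvgMr; exact: ff.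
- by move=> n s; rewrite normrM ler_piMr.
Qed.

(** The tests are left open because two kinds are needed: smooth bumps for the definition of
    [Sigma], Lipschitz tents for random variables built from a functional. *)
Lemma orth_by_tests W h : intg P W -> measurable_fun setT h ->
  (forall a b, exists phi : nat -> Rd R d -> R,
    [/\ forall n, measurable_fun setT (phi n),
        forall n x, 0 <= phi n x <= 1,
        forall x, phi ^~ x @ \oo --> (\1_(box a b) x : R) &
        forall n, \int[P]_s (W s * phi n (h s)) = 0]) ->
  orth W h.
Proof.
move=> iW mh tests A mA.
have null_box a b : \int[P]_s (W s * \1_(box a b) (h s)) = 0.
  have [phi [mphi phi01 cphi ephi]] := tests a b.
  have := @dominated W (fun n s => phi n (h s)) (fun s => \1_(box a b) (h s)) iW.
  rewrite (funext ephi : (fun n => \int[P]_s (W s * phi n (h s))) = _).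
  move=> c; apply/esym; apply: cvg_unique (cvg_cst _) (c _ _ _ _) => //.
  - by move=> n; exact: measurableT_comp.
  - by apply: measurable_indic_comp => //; exact: measurable_box.
  - by move=> n s; have /andP[? ?] := phi01 n (h s); rewrite ger0_norm.
(* The whole space is a limit of boxes; the complement step of the Dynkin argument needs it. *)
have null_T : \int[P]_s (W s * \1_[set: Rd R d] (h s)) = 0.
  pose B (k : nat) : set (Rd R d) := box (const_mx (- k%:R)) (const_mx k%:R).
  have := @dominated W (fun k s => \1_(B k) (h s)) (fun s => \1_setT (h s)) iW.
  rewrite (_ : (fun k => \int[P]_s (W s * \1_(B k) (h s))) = fun=> 0); last first.
    by apply/funext => k; exact: null_box.
  move=> c; apply/esym; apply: cvg_unique (cvg_cst _) (c _ _ _ _) => //.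
  - by move=> k; apply: measurable_indic_comp => //; exact: measurable_box.
  - exact: measurable_indic_comp.
  - move=> s; apply: cvg_near_cst; have := archi_boundP (normr_ge0 (h s : 'rV[R]_d)).
    set K := Num.bound _ => hK; exists K => // k /= Kk; rewrite !indicE !mem_set// => i.
    rewrite !mxE -ltr_norml; apply: le_lt_trans (coord_norm_le _ _) _.
    by apply: (lt_le_trans hK); rewrite ler_nat.
have : <<s @boxes R d >> A by rewrite -Rd_measurableE.
move: A {mA}; apply: (@dynkin_induction _ (Rd R d) (@boxes R d)
  [set A : set (Rd R d) | \int[P]_s (W s * \1_A (h s)) = 0]) => //.
- exact: Rd_measurableE.
- exact: boxesI.
- by move=> _ [a [b ->]]; exact: null_box.
- move=> D mD /= D0.
  rewrite (_ : (fun s => _) = fun s => W s * \1_setT (h s) - W s * \1_D (h s)); last first.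
    apply/funext => s; rewrite -mulrBr !indicE in_setT in_setC.
    by case: (_ \in D) => /=; rewrite ?subrr ?subr0.
  rewrite RintB ?null_T ?D0 ?subrr//.
    by apply: intg_mul_bounded => //; exact: measurable_indic_comp.
  by apply: intg_mul_bounded => //; exact: measurable_indic_comp.
- move=> F mF tF /= F0.
  have setE (D : set (Rd R d)) : measurable D ->
      (\int[P]_(s in h @^-1` D) (W s)%:E)%E = (\int[P]_s (W s * \1_D (h s)))%:E.
    move=> mD; rewrite -Rint_EFin; last first.
      by apply: intg_mul_bounded => //; exact: measurable_indic_comp.
    rewrite integral_mkcond; apply: eq_integral => s _.
    rewrite patchE indicE; have [hs|hs] := boolP (s \in h @^-1` D).
      by rewrite (_ : h s \in D) ?mulr1// inE; rewrite inE in hs.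
    by rewrite (_ : (h s \in D) = false) ?mulr0//; apply/negbTE; rewrite notin_setE;
      rewrite notin_setE in hs.
  have mhF (D : set (Rd R d)) : measurable D -> measurable (h @^-1` D).
    by move=> mD; rewrite -[_ @^-1` _]setTI; exact: mh.
  apply: EFin_inj.
  rewrite -setE; last exact: bigcupT_measurable.
  rewrite preimage_bigcup integral_bigcup.
  - by apply: eseries0 => k _ _; rewrite setE// F0.
  - apply/trivIsetP => i j _ _ ij; rewrite -preimage_setI.
    by move/trivIsetP : tF => -> //; rewrite preimage_set0.
  - by move=> k; exact: mhF.
  - apply: integrableS iW => //; first by apply: bigcupT_measurable => k; exact: mhF.
Qed.

(** [f] may be unbounded. Simple functions increasing to a nonnegative [g] stay dominated by
    [|W g(h)|], and the positive and negative parts of [f] inherit integrability against [W] from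
    [f]. *)
Lemma orth_fun W h (f : Rd R d -> R) : orth W h -> intg P W ->
  measurable_fun setT h -> measurable_fun setT f ->
  intg P (fun s => W s * f (h s)) -> \int[P]_s (W s * f (h s)) = 0.
Proof.
move=> oW iW mh.
have pos (g : Rd R d -> R) : measurable_fun setT g -> (forall x, 0 <= g x) ->
    intg P (fun s => W s * g (h s)) -> \int[P]_s (W s * g (h s)) = 0.
  move=> mg g0 ig.
  have mEg : measurable_fun setT (EFin \o g) by exact/measurable_EFinP.
  pose a := nnsfun_approx measurableT mEg.
  have cg x : a n x @[n --> \oo] --> g x.
    have ha : EFin \o a ^~ x @ \oo --> (g x)%:E.
      have := @cvg_nnsfun_approx _ _ R _ measurableT _ mEg.
      by apply => //= y _; rewrite lee_fin.
    exact: (fine_cvg ha).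
  have ag n x : a n x <= g x.
    rewrite -(cvg_lim _ (cg x))//; apply: nondecreasing_cvgn_le.
      by move=> p q pq; exact/lefP/nd_nnsfun_approx.
    by apply/cvg_ex; exists (g x); exact: cg.
  have zero n : \int[P]_s (W s * a n (h s)) = 0.
    under eq_Rintegral do rewrite fimfunEord mulr_sumr.
    
    have Wr r s : W s * (r * \1_(a n @^-1` [set r]) (h s)) =
        r * (W s * \1_(a n @^-1` [set r]) (h s)) by rewrite mulrCA.
    have i1 r : intg P (fun s => W s * \1_(a n @^-1` [set r]) (h s)).
      by apply: intg_mul_bounded => //; exact: measurable_indic_comp.
    rewrite Rint_sum; last first.
      by move=> i _; rewrite (funext (Wr _)); apply: intgZ; exact: i1.
    apply: big1 => i _; under eq_Rintegral do rewrite Wr.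
    by rewrite RintZ ?oW ?mulr0//; exact: i1.
  have [||||_] := @Rint_dominated _ _ _ P (fun n s => W s * a n (h s))
    (fun s => W s * g (h s)) (fun s => `|W s * g (h s)|) _ _ _ (intg_norm ig) => //.
  - move=> n; apply: measurable_funM; first exact: intg_measurable iW.
    by apply: measurableT_comp => //; exact: measurable_funP.
  - exact: intg_measurable ig.
  - by apply: aeW => s; apply: cvgMr; exact: cg.
  - move=> n s; rewrite !normrM ler_wpM2l// ger0_norm//.
    by rewrite ger0_norm.
  rewrite (funext zero : (fun n => \int[P]_s (W s * a n (h s))) = _) => c.
  by apply/esym; apply: cvg_unique (cvg_cst _) c.
move=> mf fi.

have sub (g : Rd R d -> R) : measurable_fun setT g -> (forall x, `|g x| <= `|f x|) ->
    intg P (fun s => W s * g (h s)).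
  move=> mg gf; apply: (intg_le _ _ (intg_norm fi)).
    apply: measurable_funM; first exact: intg_measurable iW.
    exact: measurableT_comp.
  by move=> s; rewrite !normrM ler_wpM2l.
have fpos x : 0 <= f^\+ x <= `|f x| by rewrite /= le_max lexx orbT ge_max ler_norm normr_ge0.
have fneg x : 0 <= f^\- x <= `|f x|.
  by rewrite /= le_max lexx orbT ge_max -normrN ler_norm normr_ge0.
have mp := measurable_funrpos mf; have mn := measurable_funrneg mf.
have ip : intg P (fun s => W s * f^\+ (h s)).
  by apply: sub => // x; have /andP[? ?] := fpos x; rewrite ger0_norm.
have im : intg P (fun s => W s * f^\- (h s)).
  by apply: sub => // x; have /andP[? ?] := fneg x; rewrite ger0_norm.
rewrite (_ : (fun s => _) = fun s => W s * f^\+ (h s) - W s * f^\- (h s)); last first.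
  by apply/funext => s; rewrite -mulrBr -[in LHS](funrposBneg f).


by rewrite RintB// !pos// subrr.
Qed.

End orthogonality.

(** * Smooth test functions *)

Section flat.
Variable R : realType.
Implicit Types t s : R.

Lemma is_derive1_chain (f g : R -> R) t (df dg : R) :
  is_derive t 1 f df -> is_derive (f t) 1 g dg ->
  is_derive t 1 (fun x => g (f x)) (dg * df).
Proof.
move=> [Df fE] [Dg gE].
have dft : differentiable f t by move/derivable1_diffP : Df.
have dgt : differentiable g (f t) by move/derivable1_diffP : Dg.
have dgf := differentiable_comp dft dgt.
apply: DeriveDef; first by move/derivable1_diffP : dgf.
have := derive1_comp Df Dg; rewrite !derive1E => e.
by rewrite -gE -fE -e.
Qed.

(* The derivative of [flat k] is [- k flat k.+1 + flat k.+2]: the family is closed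
   under differentiation, hence smooth. *)
Definition flat k t : R := if 0 < t then t^-1 ^+ k * expR (- t^-1) else 0.

Lemma flat_ge0 k t : 0 <= flat k t.
Proof.
rewrite /flat; case: ifPn => // t0.
by rewrite mulr_ge0 ?expR_ge0// exprn_ge0// invr_ge0 ltW.
Qed.

Lemma flat0_le1 t : flat 0 t <= 1.
Proof.
by rewrite /flat; case: ifPn => // t0; rewrite expr0 mul1r expR_le1 oppr_le0 invr_ge0 ltW.
Qed.

Let exp_decay n s : 0 <= s -> s ^+ n.+1 * expR (- s) <= n.+1`!%:R.
Proof.
move=> s0; rewrite expRN ler_pdivrMr ?expR_gt0//.

rewrite -ler_pdivrMl// mulrC; apply: le_trans (expR_ge1Dxn n s0).
by rewrite lerDr.
Qed.

(** With [s = 1/t] this is [s^(k+2) e^(-s) <= (k+2)!]. The factor [t^2] makes the difference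
    quotients of [flat k] at 0 tend to 0. *)
Lemma flat_small k t : flat k t <= k.+2`!%:R * t ^+ 2.
Proof.
rewrite /flat; case: ifPn => t0; last by rewrite mulr_ge0 ?sqr_ge0.
rewrite -ler_pdivrMr ?exprn_gt0// -exprVn mulrAC -exprD addn2.
by apply: exp_decay; rewrite invr_ge0 ltW.
Qed.

Let flat_pos k t : 0 < t ->
  is_derive t 1 (fun x => x^-1 ^+ k * expR (- x^-1)) (- k%:R * flat k.+1 t + flat k.+2 t).
Proof.
move=> t0; have tn0 : t != 0 by rewrite gt_eqF.
have dV : is_derive t 1 (fun x : R => x^-1) (- t ^- 2).
  have := @is_deriveV R id t 1 1 tn0 (is_derive_id _ _).
  by rewrite /GRing.scale/= mulr1.
have dq s : is_derive s 1 (fun x : R => x ^+ k * expR (- x))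
    (k%:R * s ^+ k.-1 * expR (- s) - s ^+ k * expR (- s)).
  have dX : is_derive s 1 (fun x : R => x ^+ k) (k%:R * s ^+ k.-1).
    have := @is_deriveX _ _ (@id R) k s 1 1 (is_derive_id _ _).
    by rewrite /GRing.scale/= mulr1; congr (is_derive _ _ _ _); apply/funext => x; rewrite fctE.
  have dE : is_derive s 1 (fun x : R => expR (- x)) (- expR (- s)).
    by rewrite -mulrN1; apply: (@is_derive1_chain -%R expR); exact: is_deriveNid.
  apply: (is_derive_eq (is_deriveM dX dE)).
  by rewrite /GRing.scale/=; ring.
apply: (is_derive_eq (is_derive1_chain dV (dq t^-1))).
rewrite /flat t0 -exprVn; case: k {dq} => [|k] /=; first by ring.
by rewrite !exprS; ring.
Qed.

Lemma is_derive_flat k t : is_derive t 1 (flat k) (- k%:R * flat k.+1 t + flat k.+2 t).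
Proof.
have [t0|t0|t0] := ltgtP t 0.
- have -> : - k%:R * flat k.+1 t + flat k.+2 t = 0.
    by rewrite /flat ltNge (ltW t0)/= mulr0 addr0.
  apply: near_eq_is_derive (is_derive_cst (0 : R) t 1).
  by apply: filterS (lt_nbhsl t0) => x x0; rewrite /flat ltNge (ltW x0).
- apply: near_eq_is_derive (flat_pos k t0).
  by apply: filterS (lt_nbhsr t0) => x x0; rewrite /flat x0.
- have -> : - k%:R * flat k.+1 t + flat k.+2 t = 0.
    by rewrite /flat t0 ltxx/= mulr0 addr0.
  have lim0 : (fun h => h^-1 *: ((flat k \o shift t) (h *: 1) - flat k t)) @ 0^' --> (0 : R).
    apply/cvgrPdist_le => e e0; near=> h.
    have f0 : flat k 0 = 0 by rewrite /flat ltxx.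
    rewrite t0 f0 subr0 sub0r normrN /= addr0 [h *: 1]mulr1 [_ *: _]/(_ * _).
    have hn0 : h != 0 by near: h; exact: nbhs_dnbhs_neq.
    rewrite normrM normfV ler_pdivrMl ?normr_gt0// ger0_norm ?flat_ge0//.
    apply: (le_trans (flat_small _ _)).
    rewrite -real_normK ?num_real// expr2 mulrA mulrC ler_wpM2l//.
    rewrite mulrC -ler_pdivlMr ?ltr0n ?fact_gt0//.
    near: h; apply: dnbhs0_le.
    by rewrite divr_gt0// ltr0n fact_gt0.
  by apply: DeriveDef; [apply/cvg_ex; exists 0 | exact: cvg_lim lim0].
Unshelve. all: by end_near. Qed.

End flat.

(** * Smooth bumps approximating indicators of boxes *)

Section bumps.
Variables (R : realType) (d : nat).
Implicit Types (x v e a b : 'rV[R]_d) (phi : 'rV[R]_d -> R).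

(** The algebra generated by constants and by [flat k] of affine functions of one coordinate is
    closed under directional derivatives, so smoothness follows by induction on the order without
    any formula for higher derivatives. *)
Inductive bumpy : ('rV[R]_d -> R) -> Prop :=
| bumpy_cst c : bumpy (fun=> c)
| bumpy_flat k i (a b : R) : bumpy (fun x => flat k (a * x ord0 i + b))
| bumpy_add f g : bumpy f -> bumpy g -> bumpy (fun x => f x + g x)
| bumpy_mul f g : bumpy f -> bumpy g -> bumpy (fun x => f x * g x).

Lemma is_derive_along phi x v (l : R) :
  is_derive (0 : R) 1 (fun h : R => phi (h *: v + x)) l -> is_derive x v phi l.
Proof.
move=> [D E].
have e : (fun h : R => h^-1 *: ((phi \o shift x) (h *: v) - phi x)) =
   (fun h : R => h^-1 *: (((fun h : R => phi (h *: v + x)) \o shift 0) (h *: (1 : R)) -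
     phi ((0 : R) *: v + x))).
  by apply/funext => h /=; rewrite addr0 [h *: 1]mulr1 scale0r add0r.
by apply: DeriveDef; [rewrite /derivable e | rewrite /derive e].
Qed.

Lemma bumpy_is_derive phi : bumpy phi -> forall v, exists psi, bumpy psi /\
  forall x, is_derive x v phi (psi x).
Proof.
move=> bphi v; elim: bphi => [c|k i a b|f g bf [df [bdf Df]] bg [dg [bdg Dg]]
  |f g bf [df [bdf Df]] bg [dg [bdg Dg]]].
- by exists (fun=> 0); split; [exact: bumpy_cst|move=> x; exact: is_derive_cst].
- exists (fun x => (- k%:R * flat k.+1 (a * x ord0 i + b) + flat k.+2 (a * x ord0 i + b))
    * (a * v ord0 i)); split.
    apply: bumpy_mul; last exact: bumpy_cst.
    apply: bumpy_add; last exact: bumpy_flat.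
    by apply: bumpy_mul; [exact: bumpy_cst|exact: bumpy_flat].
  move=> x; apply: (is_derive_along (phi := fun x => flat k (a * x ord0 i + b))).
  pose A (h : R) := a * (h * v ord0 i + x ord0 i) + b.
  have -> : (fun h : R => flat k (a * (h *: v + x) ord0 i + b)) = (fun h => flat k (A h)).
    by apply/funext => h; rewrite !mxE.
  have dA : is_derive (0 : R) 1 A (a * v ord0 i).
    have -> : A = (fun h => (a * v ord0 i) * h + (a * x ord0 i + b)).
      by apply/funext => h; rewrite /A; ring.
    apply: (is_derive_eq (is_deriveD (is_deriveZ (a * v ord0 i) (is_derive_id (0 : R) 1))
      (is_derive_cst (a * x ord0 i + b) (0 : R) 1))).
    by rewrite /GRing.scale/= mulr1 addr0.
  have := is_derive1_chain dA (is_derive_flat k (A 0)).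
  by rewrite {2 3}/A mul0r add0r.
- exists (fun x => df x + dg x); split; first exact: bumpy_add.
  by move=> x; exact: is_deriveD.
- exists (fun x => f x * dg x + g x * df x); split.
    by apply: bumpy_add; exact: bumpy_mul.
  by move=> x; exact: is_deriveM.
Qed.

Lemma flat_continuous k : continuous (@flat R k).
Proof.
move=> t; apply/differentiable_continuous/derivable1_diffP.
by have [] := is_derive_flat k t.
Qed.

Lemma bumpy_continuous phi : bumpy phi -> continuous phi.
Proof.
elim=> [c|k i a b|f g _ cf _ cg|f g _ cf _ cg] x.
- exact: cst_continuous.
- apply: (@continuous_comp _ _ _ (fun x : 'rV[R]_d => a * x ord0 i + b)); last exact: flat_continuous.
  apply: continuousD; last exact: cst_continuous.
  apply: (@continuousM _ 'rV[R]_d (cst a) (fun y => y ord0 i)).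
    exact: cst_continuous.
  exact: coord_continuous.
- by apply: continuousD; [exact: cf|exact: cg].
- by apply: continuousM; [exact: cf|exact: cg].
Qed.

Lemma bumpy_Ck e n phi : bumpy phi -> Ck n (fun x => phi x *: e).
Proof.
elim: n phi => [|n IH] phi bphi.
  move=> x; have cphi : {for x, continuous phi} by exact: bumpy_continuous.
  exact: (cvgZr_tmp cphi).
have D v : exists psi, bumpy psi /\ forall x, is_derive x v (fun x => phi x *: e) (psi x *: e).
  have [psi [bpsi Dpsi]] := bumpy_is_derive bphi v; exists psi; split => // x.
  have [dp <-] := Dpsi x.
  have c : (h^-1 *: (((fun x => phi x *: e) \o shift x) (h *: v) - phi x *: e)) @[h --> 0^']
      --> 'D_v phi x *: e.
    rewrite (_ : (fun h => _) = (fun h => (h^-1 *: ((phi \o shift x) (h *: v) - phi x)) *: e)).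
      by apply: cvgZr_tmp; exact: dp.
    by apply/funext => h /=; rewrite -scalerBl scalerA.
  by apply: DeriveDef; [apply/cvg_ex; exists ('D_v phi x *: e)|exact: cvg_lim c].
split=> [x v|v].
  by have [psi [_ /(_ x)[]]] := D v.
have [psi [bpsi Dpsi]] := D v.
rewrite (_ : (fun x => _) = (fun x => psi x *: e)); first exact: IH.
by apply/funext => x; have [_ <-] := Dpsi x.
Qed.

Lemma bump_testfun phi e a b : bumpy phi ->
  (forall x, phi x != 0 -> box a b x) -> testfun (fun x => phi x *: e).
Proof.
move=> bphi supp; split; first by move=> n; exact: bumpy_Ck.
pose K := [set x : 'rV[R]_d | forall i, `[a ord0 i, b ord0 i]%classic (x ord0 i)].
have cK : compact K.
  apply: (@rV_compact R d (fun i => `[a ord0 i, b ord0 i]%classic)) => i.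
  exact: segment_compact.
apply: subclosed_compact cK _; first exact: closed_closure.
have clK : closed K.
  rewrite (_ : K = \bigcap_(i in [set: 'I_d])
    ((fun x : 'rV[R]_d => x ord0 i) @^-1` `[a ord0 i, b ord0 i]%classic)); last first.
    by apply/seteqP; split => x h i; [move=> _; exact: h|exact: h].
  apply: closed_bigI => i _; apply: preimage_closed; last exact: interval_closed.
  by move=> x _; exact: coord_continuous.
rewrite [X in _ `<=` X]((closure_id K).1 clK); apply: closure_subset => x /=.
rewrite scaler_eq0 negb_or => /andP[/supp h _] i /=.
by have /andP[? ?] := h i; rewrite in_itv/= !ltW.
Qed.

(** Each factor is [exp (- 1/(n s))], where [s] is the signed distance to a face, and 0 when
    [s <= 0]: it tends to 1 inside the open box. *)
Definition bump (a b : 'rV[R]_d) n (x : 'rV[R]_d) : R := \prod_(i < d)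
  (flat 0 (n%:R * (x ord0 i - a ord0 i)) * flat 0 (n%:R * (b ord0 i - x ord0 i))).

Lemma bumpy_bump a b n : bumpy (bump a b n).
Proof.
rewrite /bump; elim: (index_enum _) => [|i s IH].
  by under eq_fun do rewrite big_nil; exact: bumpy_cst.
under eq_fun do rewrite big_cons; apply: bumpy_mul => //; apply: bumpy_mul.
  rewrite (_ : (fun x => _) = (fun x => flat 0 (n%:R * x ord0 i + - (n%:R * a ord0 i)))).
    exact: bumpy_flat.
  by apply/funext => x; rewrite mulrBr.
rewrite (_ : (fun x => _) = (fun x => flat 0 (- n%:R * x ord0 i + n%:R * b ord0 i))).
  exact: bumpy_flat.
by apply/funext => x; congr flat; ring.
Qed.

Lemma bump_supp a b n x : bump a b n x != 0 -> box a b x.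
Proof.
move=> nz i; apply/andP; split; rewrite ltNge; apply: contra nz => h;
  rewrite /bump prodf_seq_eq0; apply/hasP; exists i; rewrite ?mem_index_enum//=;
  rewrite mulf_eq0.
  by rewrite {1}/flat ltNge mulr_ge0_le0 ?subr_le0// eqxx.
by rewrite orbC {1}/flat ltNge mulr_ge0_le0 ?subr_le0// eqxx.
Qed.

Lemma bump01 a b n x : 0 <= bump a b n x <= 1.
Proof.
apply/andP; split; first by apply: prodr_ge0 => i _; rewrite mulr_ge0 ?flat_ge0.
apply: prodr_ile1 => i; rewrite mulr_ge0 ?flat_ge0//= mulr_ile1 ?flat_ge0//; exact: flat0_le1.
Qed.

Lemma bump_cvg a b x : bump a b ^~ x @ \oo --> (\1_(box a b) x : R).
Proof.
rewrite indicE; case: (boolP (x \in box a b)) => [|/negP]; rewrite inE => bx; last first.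
  rewrite (_ : bump a b ^~ x = fun=> 0); first exact: cvg_cst.
  by apply/funext => n; apply/eqP; apply/negPn/negP => /bump_supp.
have one (t : R) : 0 < t -> flat 0 (n%:R * t) @[n --> \oo] --> (1 : R).
  move=> t0.
  have c : expR (- (n.+1%:R^-1 * t^-1)) @[n --> \oo] --> (expR (- (0 * t^-1)) : R).
    apply: (@cvg_comp _ _ _ _ expR); last exact: continuous_expR.
    by apply: cvgN; apply: cvgMl; exact: cvg_harmonic.
  rewrite -cvg_shiftS /=; rewrite mul0r oppr0 expR0 in c.
  rewrite (_ : (fun n => _) = fun n => expR (- (n.+1%:R^-1 * t^-1)))//.
  by apply/funext => n; rewrite /flat mulr_gt0// expr0 mul1r invfM mulrC.
rewrite (_ : (true%:R : R) = \prod_(i < d) (1 : R)); last by rewrite big1.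
apply: cvg_big => [|i _]; first exact: mul_continuous.
have /andP[ax xb] := bx i; rewrite -subr_gt0 in ax; rewrite -subr_gt0 in xb.
have h := cvgM (one _ ax) (one _ xb); rewrite mulr1 in h. exact: h.
Qed.

End bumps.

(** * Conditional Jensen inequality *)

Section convex_functions.
Variables (R : realType) (d : nat).
Implicit Types (x y v p : 'rV[R]_d) (phi : 'rV[R]_d -> R).

Let slope_bound p v : `|dotp p v| <= (\sum_i `|p ord0 i|) * `|v|.
Proof.
rewrite mulr_suml; apply: (le_trans (ler_norm_sum _ _ _)); apply: ler_sum => i _.
by rewrite normrM ler_wpM2l// coord_norm_le.
Qed.

(** [x + v] is the barycenter of the [d] points [y i = x + d v_i e_i], and each of them lies on the
    segment between [x - 2 d e_i] and [x + 2 d e_i], since [|v_i| <= 2]. The resulting bound does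
    not depend on [v]. *)
Lemma cvx_locally_bounded phi x : cvx phi ->
  exists C, forall v, `|v| <= 2 -> phi (x + v) <= C.
Proof.
move=> cphi; pose e i : 'rV[R]_d := (d%:R * 2) *: delta_mx ord0 i.
exists (`|phi x| + \sum_i (`|phi (x + e i)| + `|phi (x - e i)|)) => v v2.
have S0 : 0 <= \sum_i (`|phi (x + e i)| + `|phi (x - e i)|).
  by apply: sumr_ge0 => i _; rewrite addr_ge0.
have [d0|d0] := posnP d.
  have -> : v = 0 by apply/rowP => i; have := ltn_ord i; rewrite {2}d0.
  by rewrite addr0; have := ler_norm (phi x); lra.


(* Summing the subgradient inequality at [x + v] over the [y i] replaces Jensen's inequality for [d]
   points: the linear terms cancel. *)
have [p hp] := subgradient (x + v) cphi.
pose y i := x + (d%:R * v ord0 i) *: delta_mx ord0 i.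
have ysum : \sum_i (y i - (x + v)) = 0.
  apply/rowP => j; rewrite summxE mxE.
  rewrite (eq_bigr (fun i => (d%:R * v ord0 i) * (i == j)%:R - v ord0 j)); last first.
    by move=> i _; rewrite !mxE eqxx/= [j == i]eq_sym; ring.
  rewrite big_split/= (bigD1 j)//= eqxx mulr1 big1 ?addr0; last first.
    by move=> i /negbTE ->; rewrite mulr0.
  by rewrite sumr_const card_ord -[- _ *+ _]mulr_natl; ring.
have le1 : d%:R * phi (x + v) <= \sum_i phi (y i).
  have e0 : \sum_i dotp p (y i - (x + v)) = 0.
    rewrite -(big_morph (dotp p) (fun u w => dotpDr u w p) (dotp0r p)) ysum.
    exact: dotp0r.
  have : \sum_i (phi (x + v) + dotp p (y i - (x + v))) <= \sum_i phi (y i).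
    by apply: ler_sum => i _; exact: hp.
  by rewrite big_split/= e0 addr0 sumr_const card_ord mulr_natl.
have le2 i : phi (y i) <= `|phi (x + e i)| + `|phi (x - e i)|.
  set s := v ord0 i; have s2 : `|s| <= 2 by apply: le_trans (coord_norm_le _ _) v2.
  have -> : y i = ((s + 2) / 4) *: (x + e i) + (1 - (s + 2) / 4) *: (x - e i).
    by apply/rowP => j; rewrite !mxE -/s; field.
  move: s2; rewrite ler_norml => /andP[s1 s2].
  have t0 : 0 <= (s + 2) / 4 <= 1 by lra.
  apply: (le_trans (cphi _ _ _ t0)); apply: lerD.
    by have := ler_norm (phi (x + e i)); have := normr_ge0 (phi (x + e i)); nra.
  by have := ler_norm (phi (x - e i)); have := normr_ge0 (phi (x - e i)); nra.
have : d%:R * phi (x + v) <= \sum_i (`|phi (x + e i)| + `|phi (x - e i)|).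
  by apply: (le_trans le1); apply: ler_sum => i _; exact: le2.

have d1 : 1 <= d%:R :> R by rewrite ler1n.
have [p0|p0] := leP (phi (x + v)) 0.
  by have := normr_ge0 (phi x); lra.
by have := normr_ge0 (phi x); nra.
Qed.

Let rat_near x (e : R) : 0 < e -> exists q : 'rV[rat]_d, `|x - map_mx ratr q| <= e.
Proof.
move=> e0.
have /choice[a aP] i : exists q : rat, x ord0 i - e < ratr q < x ord0 i.
  have [|q] := @rat_in_itvoo R (x ord0 i - e) (x ord0 i); first by rewrite ltrBlDr ltrDl.
  by rewrite in_itv/=; exists q.
exists (\row_i a i); rewrite [leLHS]/Num.norm /= mx_normrE; apply/bigmax_leP.
split; first exact: ltW.
by move=> [i j] _ /=; rewrite !mxE ord1 ler_norml; have /andP[] := aP j; lra.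
Qed.

(* Affine functions supporting [phi] at the rational points are enough:
   slopes near [x] stay bounded since [phi] is bounded above near [x]. *)
Lemma cvx_countable_sup phi : cvx phi -> exists l : nat -> R * 'rV[R]_d,
  (forall n x, aff (l n) x <= phi x) /\
  (forall x e, 0 < e -> exists n, phi x - e <= aff (l n) x).
Proof.
move=> cphi; have /choice[p hp] x : exists p, forall y, phi x + dotp p (y - x) <= phi y.
  exact: subgradient.
pose pt n : 'rV[R]_d := map_mx ratr (odflt 0 (@unpickle 'rV[rat]_d n)).
exists (fun n => (phi (pt n) - dotp (p (pt n)) (pt n), p (pt n))).
have lE n x : aff (phi (pt n) - dotp (p (pt n)) (pt n), p (pt n)) x =
    phi (pt n) + dotp (p (pt n)) (x - pt n).
  by rewrite /aff/= dotpBr; ring.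
split=> [n x|x e e0]; first by rewrite lE.
have [C hC] := cvx_locally_bounded x cphi.
pose D := \sum_i `|p x ord0 i|.
have D0 : 0 <= D by apply: sumr_ge0.
have xC : phi x <= C by have := hC 0; rewrite normr0 addr0; apply.
(* The affine function touching at [z] loses at [x] at most [k (C - phi x) + 2 D k]: one [D k]
   because [phi z >= phi x - D k], the rest through the slope at [z]. The choice of [k] makes
   [k E <= e] and [k <= 1]. *)
pose E := C - phi x + D + D + 1.
have E0 : 0 < E by rewrite /E; lra.
pose k := e / (E + e).
have k0 : 0 < k by rewrite divr_gt0// addr_gt0.
have Ee : 0 < E + e by rewrite addr_gt0.
have k1 : k <= 1 by rewrite /k ler_pdivrMr// mul1r lerDr ltW.
have kE : k * E <= e.
  have kEe : k * (E + e) = e by rewrite /k divfK// gt_eqF.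
  by have := mulr_gt0 k0 e0; rewrite mulrDr in kEe; lra.
have [q xq] := rat_near x k0.
exists (pickle q); rewrite lE /pt pickleK /=; set z := map_mx ratr q in xq *.
have xz : phi x - D * k <= phi z.
  have := hp x z; have := slope_bound (p x) (z - x); rewrite -/D.
  rewrite ler_norml => /andP[+ _].
  have : D * `|z - x| <= D * k by rewrite ler_wpM2l// distrC.
  lra.
(* The slope at [z] is controlled by going further by [(z - x)/k]. The point reached is within
   distance 2 of [x], where [phi <= C]; this is the origin of the radius 2 in
   [cvx_locally_bounded]. *)
have : k^-1 * dotp (p z) (z - x) <= C - phi z.
  have := hp z (z + k^-1 *: (z - x)); rewrite [z + _ - z]addrC addrA addNr add0r dotpZr.
  have := hC ((z - x) + k^-1 *: (z - x)); rewrite addrA [x + _]addrC subrK.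
  have h : `|z - x| <= k by rewrite distrC.
  have : `|z - x + k^-1 *: (z - x)| <= 2.
    apply: (le_trans (ler_normD _ _)); rewrite normrZ (gtr0_norm (_ : 0 < k^-1)) ?invr_gt0//.
    have : k^-1 * `|z - x| <= 1 by rewrite ler_pdivrMl// mulr1.
    lra.
  move=> /[swap] /[apply]; lra.
rewrite ler_pdivrMl// -opprB dotpNr.
have : k * (C - phi z) <= k * (C - phi x + D * k) by rewrite ler_pM2l//; lra.
have : D * k <= D by rewrite ler_piMr.
move=> Dk; have : k * (D * k) <= k * D by rewrite ler_pM2l.
move: kE; rewrite /E !mulrDr; lra.
Qed.

(* Selecting, in a maximum of finitely many affine functions, the slope of an
   active one gives a bounded measurable subgradient. *)
Lemma cvx_approx phi : cvx phi -> exists f : nat -> 'rV[R]_d -> R,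
  [/\ forall n x, f n x <= f n.+1 x <= phi x,
      forall n, measurable_fun setT (f n : Rd R d -> R),
      forall x, f ^~ x @ \oo --> phi x,
      exists l, forall x, f 0 x = aff l x &
      forall n, exists g : 'rV[R]_d -> 'rV[R]_d,
        [/\ forall x y, f n x + dotp (g x) (y - x) <= f n y,
            forall i, measurable_fun setT (fun x : Rd R d => (g x) ord0 i) &
            exists C, forall x, `|g x| <= C]].
Proof.
move=> /cvx_countable_sup[l [lphi lsup]].
pose f := fix f n x := if n is n'.+1 then Num.max (f n' x) (aff (l n) x) else aff (l 0) x.
have fphi n x : f n x <= phi x.
  by elim: n => [|n IH] /=; [exact: lphi|rewrite ge_max IH lphi].
have fS n x : f n x <= f n.+1 x by rewrite /= le_max lexx.
have fmono x : {homo f ^~ x : n m / (n <= m)%N >-> n <= m}.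
  by apply: homo_leq => //; exact: le_trans.
have lf n x : aff (l n) x <= f n x by case: n => //= n; rewrite le_max lexx orbT.
have aff_cont m : continuous (aff m : 'rV[R]_d -> R).
  move=> x; apply: (@continuousD _ _ 'rV[R]_d (cst m.1) (dotp m.2 : 'rV[R]_d -> R^o)).
    exact: cst_continuous.
  exact: dotp_continuous.
have mf n : measurable_fun setT (f n : Rd R d -> R).
  elim: n => [|n IH]; first exact: (continuous_measurable (aff_cont _)).
  by apply: measurable_maxr => //; exact: (continuous_measurable (aff_cont _)).
exists f; split.
- by move=> n x; rewrite fS fphi.
- exact: mf.
- move=> x; apply/cvgrPdist_le => e e0; have [n hn] := lsup x e e0.
  exists n => // m /= nm; have := fphi m x; have := fmono x n m nm; have := lf n x.
  by rewrite ler_norml; lra.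
- by exists (l 0).
elim=> [|n [g [hg mg [C hC]]]].
  exists (fun=> (l 0).2); split => [x y|i|]; last by exists `|(l 0).2|.
    by rewrite /= /aff dotpBr; lra.
  exact: measurable_cst.
exists (fun x => if f n x < aff (l n.+1) x then (l n.+1).2 else g x); split.
- move=> x y /=; case: ltP => h.
    by rewrite le_max; apply/orP; right; rewrite /aff dotpBr; lra.
  by rewrite le_max hg.
- move=> i; rewrite (_ : (fun x => _) = fun x : Rd R d =>
      if f n x < aff (l n.+1) x then (l n.+1).2 ord0 i else g x ord0 i); last first.
    by apply/funext => x; case: ifP.
  apply: measurable_fun_ifT; [|exact: measurable_cst|exact: mg].
  by apply: measurable_fun_ltr => //; exact: (continuous_measurable (aff_cont _)).
- exists (`|(l n.+1).2| + C) => x.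
  have C0 : 0 <= C by apply: le_trans (hC x).
  by case: ifP => _; [rewrite lerDl|rewrite ler_wpDl].
Qed.

Lemma cvx_measurable phi : cvx phi -> measurable_fun setT (phi : Rd R d -> R).
Proof.
move=> /cvx_approx[f [_ mf cf _ _]].
exact: (@measurable_fun_cvg _ (Rd R d) R setT f phi mf (fun x _ => cf x)).
Qed.

End convex_functions.

(** * Jensen's inequality when the conditional mean of [z] given [h] is [h] *)

Section jensen.
Context e (S : measurableType e) (R : realType) (P : probability S R) (d : nat).
Variables h z : S -> Rd R d.
Hypothesis mh : measurable_fun setT h.
Hypothesis mz : measurable_fun setT z.
Hypothesis ih : forall i, intg P (fun s => (h s : 'rV[R]_d) ord0 i).
Hypothesis iz : forall i, intg P (fun s => (z s : 'rV[R]_d) ord0 i).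
Hypothesis hz : forall i, orth P
  (fun s => (z s : 'rV[R]_d) ord0 i - (h s : 'rV[R]_d) ord0 i) h.

Let intg_cst (r : R) : intg P (fun=> r).
Proof. exact: finite_measure_integrable_cst. Qed.

Let intg_aff (l : R * 'rV[R]_d) (k : S -> Rd R d) :
  (forall i, intg P (fun s => (k s : 'rV[R]_d) ord0 i)) ->
  intg P (fun s => aff l (k s)).
Proof.
move=> ik; apply: intgD; first exact: intg_cst.
by apply: intg_sum => i _; apply: intgZ; exact: ik.
Qed.

Let intg_or_infty (f g : S -> R) : measurable_fun setT f -> intg P g ->
  (forall s, g s <= f s) -> intg P f \/ (\int[P]_s (f s)%:E = +oo)%E.
Proof.
move=> mf ig gf; have [if_|nif] := pselect (intg P f); [by left|right].
have mEf : measurable_fun setT (EFin \o f) by exact/measurable_EFinP.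
have neg : (\int[P]_s (EFin \o f)^\- s \is a fin_num)%E.
  rewrite ge0_fin_numE; last exact: integral_ge0.
  apply: (@le_lt_trans _ _ (\int[P]_s (`|g s|)%:E)%E); last first.
    by have /integrableP[_] := ig.
  apply: ge0_le_integral => //.
  - exact: measurable_funeneg.
  - by apply/measurable_EFinP; exact: intg_measurable (intg_norm ig).
  move=> s _; rewrite funenegE /= -EFin_max lee_fin ge_max normr_ge0 andbT.
  by have := gf s; have := ler_norm (- g s); rewrite normrN; lra.
have pos : (\int[P]_s (EFin \o f)^\+ s = +oo)%E.
  apply/eqP; rewrite -leye_eq leNgt; apply/negP => pos; apply: nif.
  apply/integrableP; split => //.
  rewrite (eq_integral (fun s => (EFin \o f)^\+ s + (EFin \o f)^\- s))%E; last first.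
    by move=> s _; rewrite -/((abse \o (EFin \o f)) s) fune_abse.
  rewrite ge0_integralD//.
  - by rewrite lte_add_pinfty//; move: neg; rewrite ge0_fin_numE//; exact: integral_ge0.
  - exact: measurable_funepos.
  - exact: measurable_funeneg.
by rewrite integralE pos -(fineK neg).
Qed.

(** For each [f n] the subgradient at [h] is a bounded measurable function of [h], so its product
    with [z - h] integrates to 0 and [f n (h)] has at most the mean of [phi (z)]. The claim is in
    extended reals because convex order tests all convex functions, integrable or not. *)
Lemma jensen (phi : 'rV[R]_d -> R) : cvx phi ->
  (\int[P]_s (phi (h s))%:E <= \int[P]_s (phi (z s))%:E)%E.
Proof.
move=> cphi; have mphi := cvx_measurable cphi.
have [f [fS mf cf [l fl] fg]] := cvx_approx cphi.
have fmono x : {homo f ^~ x : n m / (n <= m)%N >-> n <= m}.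
  by apply: homo_leq => //; [exact: le_trans|move=> n; have /andP[] := fS n x].
have fphi n x : f n x <= phi x.
  by apply: le_trans (fmono x n n.+1 (leqnSn n)) _; have /andP[] := fS n x.
have mphiz : measurable_fun setT (fun s => phi (z s)) by exact: (measurableT_comp mphi mz).
have mphih : measurable_fun setT (fun s => phi (h s)) by exact: (measurableT_comp mphi mh).
have i0z : intg P (fun s => f 0 (z s)).
  by rewrite (_ : (fun s => _) = (fun s => aff l (z s))); [exact: intg_aff|apply/funext].
have i0h : intg P (fun s => f 0 (h s)).
  by rewrite (_ : (fun s => _) = (fun s => aff l (h s))); [exact: intg_aff|apply/funext].
(* [phi (z)] lies above an integrable affine function, so its integral is finite or [+oo]; in the
   second case there is nothing to prove. *)
have [izphi|->] := intg_or_infty mphiz i0z (fun s => fphi 0 (z s)); last by rewrite leey.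
have ifz n : intg P (fun s => f n (z s)).
  apply: (intg_le (g := fun s => `|f 0 (z s)| + `|phi (z s)|)).
  - exact: (measurableT_comp (mf n) mz).
  - move=> s; have := fmono (z s) 0 n (leq0n n); have := fphi n (z s).
    have := ler_norm (phi (z s)); have := ler_norm (- f 0 (z s)); rewrite normrN.
    have := normr_ge0 (phi (z s)); have := normr_ge0 (f 0 (z s)).
    by rewrite ler_norml => *; apply/andP; split; lra.
  - by apply: intgD; exact: intg_norm.
have ifh n : intg P (fun s => f n (h s)) /\ \int[P]_s f n (h s) <= \int[P]_s phi (z s).
  have [g [hg mg [C hC]]] := fg n.
  pose W i s := (z s : 'rV[R]_d) ord0 i - (h s : 'rV[R]_d) ord0 i.
  have iW i : intg P (W i) by exact: intgB.
  have iWg i : intg P (fun s => W i s * g (h s) ord0 i).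
    apply: (intg_le (g := fun s => C * `|W i s|)).
    - apply: measurable_funM; first exact: intg_measurable (iW i).
      exact: (measurableT_comp (mg i) mh).
    - move=> s; rewrite normrM mulrC ler_wpM2r//; apply: le_trans (hC (h s)).
      exact: coord_norm_le.
    - by apply: intgZ; exact: intg_norm.
  pose G s := \sum_i W i s * g (h s) ord0 i.
  have iG : intg P G by apply: intg_sum => i _; exact: iWg.
  have G0 : \int[P]_s G s = 0.
    rewrite Rint_sum; last by move=> i _; exact: iWg.
    by apply: big1 => i _; exact:
      (@orth_fun _ _ _ _ _ _ _ (fun x => g x ord0 i) (hz i) (iW i) mh (mg i) (iWg i)).
  have GE s : dotp (g (h s)) ((z s : 'rV[R]_d) - h s) = G s.
    by rewrite /dotp /G; apply: eq_bigr => i _; rewrite mxE mxE mulrC.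
  have key s : f n (h s) <= f n (z s) - G s.
    by have := hg (h s) (z s); rewrite GE; lra.
  have ih' : intg P (fun s => f n (h s)).
    apply: (intg_le (g := fun s => `|f 0 (h s)| + `|f n (z s) - G s|)).
    - exact: (measurableT_comp (mf n) mh).
    - move=> s; have := fmono (h s) 0 n (leq0n n); have := key s.
      have := ler_norm (f n (z s) - G s); have := ler_norm (- f 0 (h s)); rewrite normrN.
      have := normr_ge0 (f n (z s) - G s); have := normr_ge0 (f 0 (h s)).
      by rewrite ler_norml => *; apply/andP; split; lra.
    - by apply: intgD; apply: intg_norm => //; exact: intgB.
  split => //; apply: (@le_trans _ _ (\int[P]_s (f n (z s) - G s))).
    by apply: Rint_le => //; exact: intgB.
  by rewrite RintB// G0 subr0; apply: Rint_le.

(* Subtracting the affine minorant [f 0] makes the increasing sequence nonnegative, as monotone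
   convergence requires. *)
have lim_h s : (fun n => (f n (h s) - f 0 (h s))%:E) @ \oo --> (phi (h s) - f 0 (h s))%:E.
  apply: cvg_EFin; first exact: nearW.
  by apply: cvgB; [exact: cf|exact: cvg_cst].
have bound : (\int[P]_s (phi (h s) - f 0 (h s))%:E <=
    (\int[P]_s phi (z s) - \int[P]_s f 0 (h s))%:E)%E.
  rewrite (eq_integral (fun s => limn (fun n => (f n (h s) - f 0 (h s))%:E))); last first.
    by move=> s _; apply/esym/cvg_lim => //; exact: lim_h.
  rewrite monotone_convergence//.
  - apply: lime_le.
      apply: ereal_nondecreasing_is_cvgn => n m nm; apply: ge0_le_integral => //.
      + by move=> s _; rewrite lee_fin subr_ge0 fmono.
      + by apply/measurable_EFinP; exact: intg_measurable (intgB (ifh n).1 i0h).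
      + by apply/measurable_EFinP; exact: intg_measurable (intgB (ifh m).1 i0h).
      + by move=> s _; rewrite lee_fin lerD2r fmono.
    apply: nearW => n; rewrite Rint_EFin; last exact: intgB (ifh n).1 i0h.
    by rewrite lee_fin RintB ?lerD2r//; [exact: (ifh n).2|exact: (ifh n).1].
  - by move=> n; apply/measurable_EFinP; exact: intg_measurable (intgB (ifh n).1 i0h).
  - by move=> n s _; rewrite lee_fin subr_ge0 fmono.
  - by move=> s _ n m nm; rewrite lee_fin lerD2r fmono.
have id : intg P (fun s => phi (h s) - f 0 (h s)).
  apply/integrableP; split.
    by apply/measurable_EFinP; apply: measurable_funB => //; exact: intg_measurable i0h.
  rewrite (eq_integral (fun s => (phi (h s) - f 0 (h s))%:E)).
    by apply: le_lt_trans bound _; exact: ltry.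
  by move=> s _; rewrite /= ger0_norm ?subr_ge0.
have ihphi : intg P (fun s => phi (h s)).
  rewrite (_ : (fun s => _) = (fun s => (phi (h s) - f 0 (h s)) + f 0 (h s))).
    exact: intgD.
  by apply/funext => s; rewrite subrK.
move: bound; rewrite !Rint_EFin// !lee_fin RintB//; lra.
Qed.

End jensen.

(** * Smooth test functions and conditional means *)

Section tests.
Context e (S : measurableType e) (R : realType) (P : probability S R) (d : nat).
Variables h z : S -> Rd R d.
Hypothesis mh : measurable_fun setT h.
Hypothesis ih : forall i, intg P (fun s => (h s : 'rV[R]_d) ord0 i).
Hypothesis iz : forall i, intg P (fun s => (z s : 'rV[R]_d) ord0 i).

Let W i s := (z s : 'rV[R]_d) ord0 i - (h s : 'rV[R]_d) ord0 i.

Let iW i : intg P (W i). Proof. exact: intgB. Qed.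

Lemma orth_of_testfun :
  (forall Phi : 'rV[R]_d -> 'rV[R]_d, testfun Phi ->
    (\int[P]_s (dotp ((z s : 'rV[R]_d) - h s) (Phi (h s)))%:E = 0)%E) ->
  forall i, orth P (W i) h.
Proof.
move=> tests i; apply: orth_by_tests => // a b.
exists (bump a b); split.
- move=> n; apply: continuous_measurable; exact: bumpy_continuous (bumpy_bump _ _ _).
- exact: bump01.
- exact: bump_cvg.
move=> n; rewrite /Rintegral.
have t := tests _ (bump_testfun (delta_mx ord0 i) (bumpy_bump a b n) (@bump_supp _ _ a b n)).
apply: (etrans (congr1 fine _) (congr1 fine t)); apply: eq_integral => s _.
by rewrite dotpZr dotp_delta !mxE mulrC.
Qed.

Lemma testfun_bounded (Phi : 'rV[R]_d -> 'rV[R]_d) : testfun Phi ->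
  continuous Phi /\ exists C, forall x, `|Phi x| <= C.
Proof.
move=> [/(_ 0%N) /= cPhi cK]; split => //.
have : compact (Phi @` closure [set x | Phi x != 0]).
  by apply: continuous_compact => //; exact: continuous_subspaceT.
move=> /compact_bounded[M [_ hM]]; exists (`|M| + 1) => x.
have M1 : M < `|M| + 1 by rewrite ltr_pwDr// ler_norm.
have [->|nz] := eqVneq (Phi x) 0; first by rewrite normr0 addr_ge0.
by apply: (hM _ M1); exists x => //; exact: subset_closure.
Qed.

Lemma testfun_of_orth : (forall i, orth P (W i) h) ->
  forall Phi : 'rV[R]_d -> 'rV[R]_d, testfun Phi ->
    (\int[P]_s (dotp ((z s : 'rV[R]_d) - h s) (Phi (h s)))%:E = 0)%E.
Proof.
move=> oW Phi /testfun_bounded[cPhi [C hC]].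
have mPhi i : measurable_fun setT (fun x : Rd R d => Phi x ord0 i).
  apply: (continuous_measurable (f := fun x => Phi x ord0 i)) => x.
  apply: (@continuous_comp _ _ _ Phi (fun y : 'rV[R]_d => y ord0 i)); first exact: cPhi.
  exact: coord_continuous.
have iWP i : intg P (fun s => W i s * Phi (h s) ord0 i).
  apply: (intg_le (g := fun s => C * `|W i s|)).
  - apply: measurable_funM; first exact: intg_measurable (iW i).
    exact: (measurableT_comp (mPhi i) mh).
  - move=> s; rewrite normrM mulrC ler_wpM2r//; apply: le_trans (hC (h s)).
    exact: coord_norm_le.
  - by apply: intgZ; exact: intg_norm.
rewrite (eq_integral (fun s => (\sum_i W i s * Phi (h s) ord0 i)%:E)); last first.
  by move=> s _; rewrite /dotp; congr EFin; apply: eq_bigr => i _; rewrite !mxE.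
rewrite Rint_EFin; last by apply: intg_sum => i _; exact: iWP.
rewrite Rint_sum; last by move=> i _; exact: iWP.
rewrite big1// => i _.
exact: (@orth_fun _ _ _ _ _ _ _ (fun x => Phi x ord0 i) (oW i) (iW i) mh (mPhi i) (iWP i)).
Qed.

End tests.

(** * Couplings from positive functionals *)

Section tents.
Variables (R : realType) (d : nat).
Implicit Types (x y a b : 'rV[R]_d).

Definition clip (m M s : R) := Num.max m (Num.min M s).

Lemma clip_lip m M s t : m <= M -> `|clip m M s - clip m M t| <= `|s - t|.
Proof.
move=> mM; rewrite /clip; have := ler_norm (s - t); have := ler_norm (- (s - t)).
rewrite normrN ler_norml => h1 h2; case: (leP M s) => ?; case: (leP M t) => ?;
  rewrite ?(max_r mM); try (case: (leP m s) => ?); try (case: (leP m t) => ?);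
  apply/andP; split; lra.
Qed.

Lemma clip_bound m M s : m <= M -> m <= clip m M s <= M.
Proof. by move=> mM; rewrite /clip le_max lexx/= ge_max mM ge_min lexx. Qed.

Definition lip (phi : 'rV[R]_d -> R) := exists L : R, 0 <= L /\
  forall x y, `|phi x - phi y| <= L * \sum_i `|x ord0 i - y ord0 i|.

(** The signed distance to the nearest face of the box, capped at 1. It replaces the smooth bumps
    where global Lipschitz bounds are needed, since [riesz] represents only Lipschitz functions
    exactly. *)
Definition depth a b x : R :=
  \big[Num.min/1]_(i < d) Num.min (x ord0 i - a ord0 i) (b ord0 i - x ord0 i).

Definition tent a b n x : R := clip 0 1 (n%:R * depth a b x).

Let min_lip (s t u v : R) : `|Num.min s t - Num.min u v| <= `|s - u| + `|t - v|.
Proof.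
have := ler_norm (s - u); have := ler_norm (- (s - u)); rewrite normrN.
have := ler_norm (t - v); have := ler_norm (- (t - v)); rewrite normrN.
rewrite ler_norml => h1 h2 h3 h4; case: (leP s t) => ?; case: (leP u v) => ?; apply/andP; split; lra.
Qed.

Lemma depth_lip a b x y : `|depth a b x - depth a b y| <= 2 * \sum_i `|x ord0 i - y ord0 i|.
Proof.
rewrite /depth; elim: (index_enum _) => [|i s IH]; first by rewrite !big_nil subrr normr0 mulr0.
rewrite !big_cons mulrDr; apply: (le_trans (min_lip _ _ _ _)); apply: lerD => //.
apply: (le_trans (min_lip _ _ _ _)); rewrite mulr_natl mulr2n; apply: lerD.
  by rewrite opprB addrA subrK.
rewrite opprB [_ - _ + _]addrC addrA subrK distrC; lra.
Qed.

Lemma tent_lip a b n : lip (tent a b n).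
Proof.
exists (n%:R * 2); split => // x y; apply: (le_trans (clip_lip _ _ _)) => //.
by rewrite -mulrBr normrM normr_nat -mulrA ler_wpM2l// depth_lip.
Qed.

Lemma tent01 a b n x : 0 <= tent a b n x <= 1.
Proof. exact: clip_bound. Qed.

Lemma depth_gt0 a b x : (0 < depth a b x) <-> box a b x.
Proof.
rewrite /depth; split=> [h i|bx].
  move: h; rewrite (bigD1 i)//= lt_min => /andP[+ _].
  by rewrite lt_min !subr_gt0 => /andP[-> ->].
elim/big_ind: _ => // [s t s0 t0|i _]; first by rewrite lt_min s0.
by have /andP[? ?] := bx i; rewrite lt_min !subr_gt0; apply/andP.
Qed.

Lemma tent_cvg a b x : tent a b ^~ x @ \oo --> (\1_(box a b) x : R).
Proof.
rewrite indicE; case: (boolP (x \in box a b)) => [|/negP]; rewrite inE -depth_gt0 => bx.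
  apply: cvg_near_cst; pose N := Num.bound (depth a b x)^-1; exists N => // n /= Nn.
  have h : (depth a b x)^-1 < n%:R.
    apply: lt_le_trans (archi_boundP _) _; first by rewrite invr_ge0 ltW.
    by rewrite ler_nat.
  have h1 : 1 <= n%:R * depth a b x.
    by rewrite -ler_pdivrMr// div1r ltW.
  by rewrite /tent /clip min_l// max_r.
rewrite (_ : tent a b ^~ x = fun=> 0); first exact: cvg_cst.
apply/funext => n; rewrite /tent /clip; move/negP : bx; rewrite -leNgt => u0.
have h1 : n%:R * depth a b x <= 0 by rewrite mulr_ge0_le0.
by rewrite min_r ?max_l// (le_trans h1).
Qed.

Lemma tent_measurable a b n : measurable_fun setT (tent a b n : Rd R d -> R).
Proof.
have md : measurable_fun setT (depth a b : Rd R d -> R).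
  rewrite /depth; elim: (index_enum _) => [|i s IH].
    by under eq_fun do rewrite big_nil; exact: measurable_cst.
  under eq_fun do rewrite big_cons; apply: measurable_minr => //.
  by apply: measurable_minr; apply: measurable_funB => //; exact: measurable_coord.
apply: measurable_maxr; first exact: measurable_cst.
apply: measurable_minr; first exact: measurable_cst.
by apply: measurable_funM => //; exact: measurable_cst.
Qed.

End tents.

(** * Laws and conditional means read off from the functional *)

Section representation.
Variables (R : realType) (T : Type) (M : (T -> R) -> R) (V : set (T -> R)).
Variables (I : finType) (c : I -> T -> R) (d : nat).
Context e (S : measurableType e) (P : probability S R).
Variable X : I -> S -> R.
Hypothesis mX : forall i, measurable_fun setT (X i).
Hypothesis representation : forall F : (I -> R) -> R,
  (exists L : R, 0 <= L /\ forall a b, `|F a - F b| <= L * \sum_i `|a i - b i|) ->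
  intg P (fun s => F (X ^~ s)) /\ \int[P]_s (F (X ^~ s)) = M (fun t => F (c ^~ t)).

Variable p : 'I_d -> I.
Hypothesis p_inj : injective p.

Let sum_proj (a b : I -> R) : \sum_j `|a (p j) - b (p j)| <= \sum_i `|a i - b i|.
Proof.
rewrite (partition_big p xpredT)//=; apply: ler_sum => i _.
case: (pickP (fun j => p j == i)) => [j0 /eqP <-|none]; last by rewrite big_pred0.
by rewrite (big_pred1 j0)// => j; rewrite /= (inj_eq p_inj).
Qed.

Let norm_subB (s t u v : R) : `|s - t - (u - v)| <= `|s - u| + `|t - v|.
Proof. by rewrite (_ : s - t - (u - v) = (s - u) - (t - v)); [exact: ler_normB|ring]. Qed.

Let term_le (a b : I -> R) i : `|a i - b i| <= \sum_i `|a i - b i|.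
Proof. by rewrite (bigD1 i)//= lerDl sumr_ge0. Qed.

Let point s : Rd R d := \row_j X (p j) s.

Lemma measurable_point : measurable_fun setT point.
Proof.
by apply: measurable_rV => i; under eq_fun do rewrite mxE; exact: mX.
Qed.

Lemma intg_component i : intg P (X i).
Proof.
apply: (representation (F := fun a => a i) _).1; exists 1; split => // a b.
by rewrite mul1r.
Qed.

Lemma law_eq (mu : probability (Rd R d) R) :
  (forall phi, lip phi -> measurable_fun setT (phi : Rd R d -> R) ->
    (forall x, 0 <= phi x <= 1) ->
    M (fun t => phi (\row_j c (p j) t)) = \int[mu]_x phi x) ->
  forall A, measurable A -> P (point @^-1` A) = mu A.
Proof.
move=> Mmu A mA.
pose hp : {mfun S >-> Rd R d} := mfun_Sub (mem_set measurable_point).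
rewrite -[LHS]/(pushforward P hp A).
apply: (@measure_eq_by_tests R d (pushforward P hp) mu) => //.
- exact: le_lt_trans (probability_le1 P measurableT) (ltry 1).
- by rewrite (le_lt_trans (probability_le1 _ _))// ltry.
move=> a b; exists (tent a b); split.
- by move=> n; exact: tent_measurable.
- exact: tent01.
- exact: tent_cvg.
move=> n; rewrite -Mmu; [|exact: tent_lip|exact: tent_measurable|exact: tent01].
have [L [L0 hL]] := tent_lip a b n.
have [|_ <-] := representation (F := fun a' => tent a b n (\row_j a' (p j))).
  exists L; split => // a' b'; apply: (le_trans (hL _ _)); rewrite ler_wpM2l//.
  by under eq_bigr do rewrite !mxE; exact: sum_proj.
rewrite /Rintegral ge0_integral_pushforward//.
- by apply/measurable_EFinP; exact: tent_measurable.
- by move=> x _; rewrite lee_fin; have /andP[] := tent01 a b n x.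
Qed.

Hypothesis V_lin : forall F G k, V F -> V G -> V (fun t => F t + k * G t).
Hypothesis V_le : forall F G, V G -> (forall t, `|F t| <= G t) -> V F.
Hypothesis V1 : V (fun=> 1).
Hypothesis V_sqr : forall i, V (fun t => c i t ^+ 2).
Hypothesis M_lin : forall F G k, V F -> V G ->
  M (fun t => F t + k * G t) = M F + k * M G.
Hypothesis M_ge0 : forall F, V F -> (forall t, 0 <= F t) -> 0 <= M F.

(** The difference of two coordinates times [phi] is not Lipschitz, so the representation does not
    apply to it. Clipping the coordinates at [k + 1] makes the product Lipschitz at an error of at
    most [w / (k + 1)], because [|s| <= s^2 / (k + 1)] beyond the clipping level. Both sides then
    converge as [k] grows. *)
Lemma orth_component (i i' : I) :
  (forall phi, lip phi -> (forall x, 0 <= phi x <= 1) ->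
    M (fun t => (c i' t - c i t) * phi (\row_j c (p j) t)) = 0) ->
  orth P (fun s => X i' s - X i s) point.
Proof.
move=> M0.
have iX : intg P (fun s => X i' s - X i s) by apply: intgB; exact: intg_component.
apply: orth_by_tests => //; first exact: measurable_point.
move=> a b; exists (tent a b); split.
- by move=> n; exact: tent_measurable.
- exact: tent01.
- exact: tent_cvg.
move=> n; set phi := tent a b n.
have [L [L0 hL]] := tent_lip a b n.
have phi01 x : 0 <= phi x <= 1 by exact: tent01.
pose cl (k : nat) (s : R) := clip (- k%:R) k%:R s.
have kk (k : nat) : - k%:R <= k%:R :> R by rewrite ge0_cp.
have clk k s : `|cl k s| <= k%:R by rewrite ler_norml; exact: clip_bound.
have clerr k s : `|cl k.+1 s - s| <= k.+1%:R^-1 * s ^+ 2.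
  have k0 : 0 < k.+1%:R :> R by [].
  rewrite ler_pdivlMl// /cl /clip.
  have := sqr_ge0 s; rewrite expr2 => s0.
  case: (leP k.+1%:R s) => h1; rewrite ?(max_r (kk _)); first by rewrite ler0_norm; nra.
  by case: (leP (- k.+1%:R) s) => h2; rewrite ?subrr ?normr0 ?mulr0// ger0_norm; nra.
have clle k s : `|cl k s| <= `|s|.
  rewrite /cl /clip; have k0 : 0 <= k%:R :> R by [].
  case: (leP k%:R s) => h1; rewrite ?(max_r (kk _)); first by rewrite !ger0_norm; lra.
  by case: (leP (- k%:R) s) => h2 //; rewrite !ler0_norm; lra.
pose G k t := (cl k.+1 (c i' t) - cl k.+1 (c i t)) * phi (\row_j c (p j) t).
pose H t := (c i' t - c i t) * phi (\row_j c (p j) t).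
pose w t := c i' t ^+ 2 + c i t ^+ 2.
have VD F F' : V F -> V F' -> V (fun t => F t + F' t).
  by move=> VF VG; have := V_lin 1 VF VG; under eq_fun do rewrite mul1r.
have Vw : V w by exact: VD.
have V0 : V (fun=> 0) by apply: V_le V1 _ => t; rewrite normr0.
have VZ k F : V F -> V (fun t => k * F t).
  by move=> VF; have := V_lin k V0 VF; under eq_fun do rewrite add0r.
have GH k t : `|G k t - H t| <= k.+1%:R^-1 * w t.
  rewrite /G /H -mulrBl normrM;
    apply: (@le_trans _ _ (`|cl k.+1 (c i' t) - cl k.+1 (c i t) - (c i' t - c i t)| * 1)).
    by rewrite ler_wpM2l//; have /andP[? ?] := phi01 (\row_j c (p j) t); rewrite ger0_norm.
  rewrite mulr1 /w mulrDr; apply: (le_trans (norm_subB _ _ _ _)).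
  by apply: lerD; exact: clerr.
have VGH k : V (fun t => G k t - H t) by apply: V_le (VZ k.+1%:R^-1 _ Vw) _; exact: GH.
have VH : V H.
  apply: (V_le (VD _ _ (VZ 2 _ V1) Vw)) => t; rewrite /H /w normrM.
  apply: (@le_trans _ _ (`|c i' t - c i t| * 1)).
    by rewrite ler_wpM2l//; have /andP[? ?] := phi01 (\row_j c (p j) t); rewrite ger0_norm.
  have := sqr_ge0 (c i t - 1); have := sqr_ge0 (c i t + 1).
  have := sqr_ge0 (c i' t - 1); have := sqr_ge0 (c i' t + 1).
  by rewrite !expr2 mulr1 ler_norml => *; apply/andP; split; nra.
have VG k : V (G k).
  by have := VD _ _ (VGH k) VH; under eq_fun do rewrite subrK.
have MG k : M (G k) = \int[P]_s ((cl k.+1 (X i' s) - cl k.+1 (X i s)) * phi (point s)).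
  have [|_ <-//] := representation (F := fun a' =>
    (cl k.+1 (a' i') - cl k.+1 (a' i)) * phi (\row_j a' (p j))).
  (* The 2 is the Lipschitz constant of the difference of clipped coordinates, multiplied by
     [phi <= 1]. The other term is the bound [2 (k + 1)] of that difference times the Lipschitz
     constant of [phi]. *)
  exists (2 + (k.+1%:R + k.+1%:R) * L); split => [|a' b'].
    by rewrite addr_ge0// mulr_ge0.
  set u := cl _ _ - _; set v := cl _ (b' _) - _; set f := phi _; set g := phi _.
  have -> : u * f - v * g = (u - v) * f + v * (f - g) by ring.
  apply: (le_trans (ler_normD _ _)); rewrite [leRHS]mulrDl; apply: lerD.
    rewrite normrM; apply: (@le_trans _ _ (`|u - v| * 1)).
      by rewrite ler_wpM2l//; have /andP[? ?] := phi01 (\row_j a' (p j)); rewrite ger0_norm.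
    rewrite mulr1; apply: (le_trans (norm_subB _ _ _ _)); rewrite mulr_natl mulr2n.
    by apply: lerD; (apply: le_trans (clip_lip _ _ (kk _)) _; exact: term_le).
  rewrite normrM -mulrA; apply: ler_pM => //.
    by apply: (le_trans (ler_normB _ _)); apply: lerD; exact: clk.
  apply: (le_trans (hL _ _)); rewrite ler_wpM2l//.
  by under eq_bigr do rewrite !mxE; exact: sum_proj.
have MH0 : M H = 0 by exact: M0 (tent_lip a b n) phi01.
have MZ k F : V F -> M (fun t => k * F t) = k * M F.
  move=> VF; have h0 : M (fun=> 0) = 0.
    have := M_lin (-1) V0 V0; under eq_fun do rewrite mulr0 addr0.
    lra.
  by have := M_lin k V0 VF; under eq_fun do rewrite add0r; rewrite h0 add0r.
have MGle k : `|M (G k)| <= k.+1%:R^-1 * M w.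
  have h F : V F -> (forall t, F t <= k.+1%:R^-1 * w t) -> M F <= k.+1%:R^-1 * M w.
    move=> VF Fw; rewrite -subr_ge0 -MZ//.
    have := M_lin (-1) (VZ k.+1%:R^-1 _ Vw) VF; rewrite mulN1r => <-.
    apply: M_ge0; first by apply: V_lin => //; exact: VZ.
    by move=> t; rewrite mulN1r subr_ge0.
  have e1 : M (fun t => G k t - H t) = M (G k).
    have := M_lin (-1) (VG k) VH; rewrite MH0 mulr0 addr0 => <-.
    by congr M; apply/funext => t; rewrite mulN1r.
  have e2 : M (fun t => -1 * (G k t - H t)) = - M (G k) by rewrite MZ// e1 mulN1r.
  rewrite ler_norml lerNl -e2 -e1; apply/andP; split; apply: h => //.
  - exact: VZ.
  - by move=> t; apply: le_trans (GH k t); rewrite mulN1r -normrN ler_norm.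
  - by move=> t; apply: le_trans (GH k t); exact: ler_norm.
have cl_cvg s : cl k.+1 s @[k --> \oo] --> s.
  apply: cvg_near_cst; exists (Num.bound `|s|) => // k /= sk.
  have h : `|s| <= k.+1%:R.
    apply: le_trans (ltW (archi_boundP (normr_ge0 s))) _.
    by rewrite ler_nat; exact: leq_trans sk (leqnSn k).
  move: h; rewrite ler_norml => /andP[h1 h2].
  by rewrite /cl /clip min_r// max_r.
have mphi : measurable_fun setT (fun s => phi (point s)).
  exact: (measurableT_comp (tent_measurable a b n) measurable_point).
have mcl k i0 : measurable_fun setT (fun s => cl k.+1 (X i0 s)).
  apply: measurable_maxr; first exact: measurable_cst.
  by apply: measurable_minr; [exact: measurable_cst|exact: mX].
have [|||||_ climit] := @Rint_dominated _ _ _ P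
  (fun k s => (cl k.+1 (X i' s) - cl k.+1 (X i s)) * phi (point s))
  (fun s => (X i' s - X i s) * phi (point s)) (fun s => `|X i' s| + `|X i s|).
- by move=> k; apply: measurable_funM => //; exact: measurable_funB.
- by apply: measurable_funM => //; exact: intg_measurable iX.
- by apply: aeW => s; apply: cvgMl; apply: cvgB; exact: cl_cvg.
- by apply: intgD; apply: intg_norm; exact: intg_component.
- move=> k s; rewrite normrM.
  apply: (@le_trans _ _ (`|cl k.+1 (X i' s) - cl k.+1 (X i s)| * 1)).
    by rewrite ler_wpM2l//; have /andP[? ?] := phi01 (point s); rewrite ger0_norm.
  by rewrite mulr1; apply: (le_trans (ler_normB _ _)); apply: lerD; exact: clle.
apply: cvg_unique climit _; first exact: Rhausdorff.
rewrite -(funext MG : M \o G = _); apply/cvgrPdist_le => r r0.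
have h0 : k.+1%:R^-1 * M w @[k --> \oo] --> 0 * M w by apply: cvgMl; exact: cvg_harmonic.
rewrite mul0r in h0; move/cvgrPdist_le : h0 => /(_ r r0); apply: filterS => k.
rewrite !sub0r !normrN => hk; apply: le_trans (MGle k) _.
exact: le_trans (ler_norm _) hk.
Qed.

End representation.

(** * Measures on triples from functionals of quadratic growth *)

Section coupling.
Variables (R : realType) (d : nat).
Implicit Types (t : Rd3 R d) (F G : Rd3 R d -> R).

Definition cx t : 'rV[R]_d := t.1.1.
Definition cy t : 'rV[R]_d := t.1.2.
Definition cz t : 'rV[R]_d := t.2.

Definition sqnorms t : R := 1 + dotp (cx t) (cx t) + dotp (cy t) (cy t) + dotp (cz t) (cz t).

Definition qgrowth F := exists C : R, forall t, `|F t| <= C * sqnorms t.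

Lemma sqnorms_ge1 t : 1 <= sqnorms t.
Proof.
rewrite /sqnorms; have := dotp_ge0 (cx t); have := dotp_ge0 (cy t).
by have := dotp_ge0 (cz t); lra.
Qed.

Lemma qgrowth_le F G : qgrowth G -> (forall t, `|F t| <= G t) -> qgrowth F.
Proof.
by move=> [C hC] FG; exists C => t; apply: (le_trans (FG t)); apply: le_trans (hC t); exact: ler_norm.
Qed.

Lemma qgrowth_lin F G k : qgrowth F -> qgrowth G -> qgrowth (fun t => F t + k * G t).
Proof.
move=> [C hC] [D hD]; exists (C + `|k| * D) => t.
rewrite mulrDl -mulrA; apply: (le_trans (ler_normD _ _)); apply: lerD => //.
by rewrite normrM ler_wpM2l.
Qed.

Lemma qgrowth1 : qgrowth (fun=> 1).
Proof. by exists 1 => t; rewrite normr1 mul1r sqnorms_ge1. Qed.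

Let I : finType := ('I_d + 'I_d + 'I_d)%type.

Let coord (i : I) t : R :=
  match i with
  | inl (inl j) => cx t ord0 j | inl (inr j) => cy t ord0 j | inr j => cz t ord0 j
  end.

Let ix (j : 'I_d) : I := inl (inl j).
Let iy (j : 'I_d) : I := inl (inr j).
Let iz (j : 'I_d) : I := inr j.

Let qgrowth_sqr i : qgrowth (fun t => coord i t ^+ 2).
Proof.
exists 1 => t; rewrite mul1r ger0_norm ?sqr_ge0// /sqnorms.
have := dotp_ge0 (cx t); have := dotp_ge0 (cy t); have := dotp_ge0 (cz t).
by case: i => [[]|] j; rewrite /coord; [have := sqr_coord_le (cx t) j|
  have := sqr_coord_le (cy t) j|have := sqr_coord_le (cz t) j]; lra.
Qed.

Variable M : (Rd3 R d -> R) -> R.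
Hypothesis M_lin : forall F G k, qgrowth F -> qgrowth G ->
  M (fun t => F t + k * G t) = M F + k * M G.
Hypothesis M_ge0 : forall F, qgrowth F -> (forall t, 0 <= F t) -> 0 <= M F.
Hypothesis M1 : M (fun=> 1) = 1.

Definition same_law (k : Rd3 R d -> 'rV[R]_d) (mu : probability (Rd R d) R) :=
  forall phi, lip phi -> measurable_fun setT (phi : Rd R d -> R) ->
    (forall x, 0 <= phi x <= 1) -> M (fun t => phi (k t)) = \int[mu]_x phi x.

Definition null_drift (k : Rd3 R d -> 'rV[R]_d) :=
  forall i phi, lip phi -> (forall x, 0 <= phi x <= 1) ->
    M (fun t => (cz t ord0 i - k t ord0 i) * phi (k t)) = 0.

Hypothesis drift_x : null_drift cx.
Hypothesis drift_y : null_drift cy.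

Let coupling_of_representation e (S : measurableType e) (P : probability S R) (X : I -> S -> R) :
  (forall i, measurable_fun setT (X i)) ->
  (forall F : (I -> R) -> R,
    (exists L : R, 0 <= L /\ forall a b, `|F a - F b| <= L * \sum_i `|a i - b i|) ->
    intg P (fun s => F (X ^~ s)) /\ \int[P]_s (F (X ^~ s)) = M (fun t => F (coord ^~ t))) ->
  (forall i, (\int[P]_s (X i s ^+ 2)%:E <= (M (fun t => coord i t ^+ 2))%:E)%E) ->
  exists pi : probability (Rd3 R d) R,
  [/\ forall mu, same_law cx mu -> marg1 pi mu,
      forall mu, same_law cy mu -> marg2 pi mu,
      forall mu, same_law cz mu -> marg3 pi mu,
      forall i, orth pi (fun t => cz t ord0 i - cx t ord0 i) cx /\
                orth pi (fun t => cz t ord0 i - cy t ord0 i) cy &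
      (forall i, (\int[pi]_t (cz t ord0 i ^+ 2)%:E <= (M (fun t => cz t ord0 i ^+ 2))%:E)%E) /\
      P2_3 pi].
Proof.
move=> mX Xrep Xsqr.
pose px s : Rd R d := \row_j X (ix j) s.
pose py s : Rd R d := \row_j X (iy j) s.
pose pz s : Rd R d := \row_j X (iz j) s.
have mpx : measurable_fun setT px .
  exact: (measurable_point mX ix).
have mpy : measurable_fun setT py .
  exact: (measurable_point mX iy).
have mpz : measurable_fun setT pz .
  exact: (measurable_point mX iz).
pose h s : Rd3 R d := ((px s, py s), pz s).
have mh : measurable_fun setT h.
  by apply: measurable_fun_pair => //; exact: measurable_fun_pair.
pose hm : {mfun _ >-> Rd3 R d} := mfun_Sub (mem_set mh).
pose pi : probability (Rd3 R d) R := distribution P hm.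
have cxh t : \row_j coord (ix j) t = cx t by apply/rowP => j; rewrite mxE.
have cyh t : \row_j coord (iy j) t = cy t by apply/rowP => j; rewrite mxE.
have czh t : \row_j coord (iz j) t = cz t by apply/rowP => j; rewrite mxE.
have push F : measurable_fun setT F -> intg P (fun s => F (h s)) ->
    \int[pi]_t F t = \int[P]_s F (h s).
  move=> mF iF; congr fine.
  apply: (etrans (integral_pushforward mh (f := EFin \o F) (D := setT) _ _ measurableT)) => //.
  exact/measurable_EFinP.
have iX i : intg P (X i) := @intg_component R _ M I coord e S P X Xrep i.
have mcx : measurable_fun setT (cx : Rd3 R d -> Rd R d).
  by apply: (measurableT_comp (f := fst)) => //; exact: measurable_fst.
have mcy : measurable_fun setT (cy : Rd3 R d -> Rd R d).
  exact: (measurableT_comp measurable_snd measurable_fst).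
have mcz : measurable_fun setT (cz : Rd3 R d -> Rd R d) by exact: measurable_snd.
have drift (k : Rd3 R d -> Rd R d) (p : 'I_d -> I) : injective p ->
    measurable_fun setT k -> (forall t, \row_j coord (p j) t = k t) ->
    (forall s, k (h s) = \row_j X (p j) s) ->
    null_drift k -> forall i, orth pi (fun t => cz t ord0 i - k t ord0 i) k.
  move=> p_inj mk kE kh dk i A mA.
  have o : orth P (fun s => X (iz i) s - X (p i) s) (fun s => \row_j X (p j) s : Rd R d).
    apply: (@orth_component R _ M qgrowth I coord d e S P X mX Xrep p p_inj
      qgrowth_lin qgrowth_le qgrowth1 qgrowth_sqr M_lin M_ge0).
    move=> phi lphi phi01; rewrite -[RHS](dk i phi lphi phi01); congr M.
    by apply/funext => t; rewrite kE -kE mxE.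
  have eq_s s : (cz (h s) ord0 i - k (h s) ord0 i) * \1_A (k (h s)) =
      (X (iz i) s - X (p i) s) * \1_A (\row_j X (p j) s) by rewrite kh !mxE.
  have m1 : measurable_fun setT (\1_A : Rd R d -> R) by exact: measurable_indic.
  rewrite push; first by under eq_Rintegral do rewrite eq_s; exact: o.
    apply: measurable_funM; last exact: (measurableT_comp m1 mk).
    by apply: measurable_funB;
      [exact: (measurableT_comp (measurable_coord i) mcz)|
       exact: (measurableT_comp (measurable_coord i) mk)].
  rewrite (funext eq_s); apply: (intg_le (g := fun s => `|X (iz i) s - X (p i) s|)).
  - apply: measurable_funM; first exact: intg_measurable (intgB (iX _) (iX _)).
    exact: (measurableT_comp m1 (measurable_point mX p)).
  - move=> s; rewrite normrM ler_piMr// indicE.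
    by case: (_ \in _); rewrite ?normr1 ?normr0.
  - by apply: intg_norm; exact: intgB.
have msq (k : Rd3 R d -> Rd R d) i : measurable_fun setT k ->
    measurable_fun setT (fun t => (k t : 'rV[R]_d) ord0 i ^+ 2).
  by move=> mk; apply: measurable_funX; exact: (measurableT_comp (measurable_coord i) mk).
have sq_le (k : Rd3 R d -> Rd R d) (p : 'I_d -> I) i : measurable_fun setT k ->
    (forall t, coord (p i) t = (k t : 'rV[R]_d) ord0 i) ->
    (forall s, (k (h s) : 'rV[R]_d) ord0 i = X (p i) s) ->
    (\int[pi]_t ((k t : 'rV[R]_d) ord0 i ^+ 2)%:E <=
      (M (fun t => (k t : 'rV[R]_d) ord0 i ^+ 2))%:E)%E.
  move=> mk kE kh.
  have := Xsqr (p i); rewrite (_ : (fun t => coord (p i) t ^+ 2) =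
    (fun t => (k t : 'rV[R]_d) ord0 i ^+ 2)); last by apply/funext => t; rewrite kE.
  apply: le_trans.
  rewrite [leLHS](ge0_integral_pushforward mh)//.
  - rewrite preimage_setT le_eqVlt; apply/orP; left; apply/eqP.
    by apply: eq_integral => s _ /=; rewrite kh.
  - by apply/measurable_EFinP; exact: msq.
  - by move=> t _; rewrite lee_fin sqr_ge0.
exists pi; split.
- move=> mu Mmu A mA.
  apply: (@law_eq R _ M I coord d e S P X mX Xrep ix _ mu _ A mA) => [j j' []//|phi lphi mphi phi01].
  by rewrite -Mmu//; congr M; apply/funext => t; rewrite cxh.
- move=> mu Mmu A mA.
  apply: (@law_eq R _ M I coord d e S P X mX Xrep iy _ mu _ A mA) => [j j' []//|phi lphi mphi phi01].
  by rewrite -Mmu//; congr M; apply/funext => t; rewrite cyh.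
- move=> mu Mmu A mA.
  apply: (@law_eq R _ M I coord d e S P X mX Xrep iz _ mu _ A mA) => [j j' []//|phi lphi mphi phi01].
  by rewrite -Mmu//; congr M; apply/funext => t; rewrite czh.
- move=> i; split.
    by apply: (drift cx ix) => // j j' [].
  by apply: (drift cy iy) => // j j' [].
split.
  by move=> i; apply: (sq_le cz iz) => // s; rewrite mxE.
rewrite /P2_3.
rewrite (eq_integral (fun t => (\sum_i ((cx t ord0 i ^+ 2)%:E + (cy t ord0 i ^+ 2)%:E
   + (cz t ord0 i ^+ 2)%:E)))%E); last first.
  move=> t _; rewrite !enorm_sqr /dotp -!big_split/= -sumEFin.
  by apply: eq_bigr => i _; rewrite !expr2.
have mE (k : Rd3 R d -> Rd R d) i : measurable_fun setT k ->
    measurable_fun setT (fun t => ((k t : 'rV[R]_d) ord0 i ^+ 2)%:E).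
  by move=> mk; apply/measurable_EFinP; exact: msq.
rewrite ge0_integral_sum//.
- apply: lte_sum_pinfty => i _.
  rewrite ge0_integralD//; [|by move=> t _; rewrite lee_fin addr_ge0 ?sqr_ge0
    |by apply: emeasurable_funD; exact: mE|by move=> t _; rewrite lee_fin sqr_ge0|exact: mE].
  rewrite ge0_integralD//; [|by move=> t _; rewrite lee_fin sqr_ge0
    |exact: mE|by move=> t _; rewrite lee_fin sqr_ge0|exact: mE].
  apply: lte_add_pinfty; first apply: lte_add_pinfty.
  + apply: le_lt_trans (ltry _); apply: (sq_le cx ix) => // s; by rewrite mxE.
  + apply: le_lt_trans (ltry _); apply: (sq_le cy iy) => // s; by rewrite mxE.
  + apply: le_lt_trans (ltry _); apply: (sq_le cz iz) => // s; by rewrite mxE.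
- move=> i; apply: emeasurable_funD; last exact: mE.
  by apply: emeasurable_funD; exact: mE.
- by move=> i t _; rewrite !adde_ge0// lee_fin sqr_ge0.
Qed.

(** The coupling is the joint law of the represented coordinates. The squared coordinates bound its
    second moments and have finite [M]-values, hence [P2_3]. *)
Lemma coupling_of_functional : exists pi : probability (Rd3 R d) R,
  [/\ forall mu, same_law cx mu -> marg1 pi mu,
      forall mu, same_law cy mu -> marg2 pi mu,
      forall mu, same_law cz mu -> marg3 pi mu,
      forall i, orth pi (fun t => cz t ord0 i - cx t ord0 i) cx /\
                orth pi (fun t => cz t ord0 i - cy t ord0 i) cy &
      (forall i, (\int[pi]_t (cz t ord0 i ^+ 2)%:E <= (M (fun t => cz t ord0 i ^+ 2))%:E)%E) /\
      P2_3 pi].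
Proof.
have [X [mX Xrep Xsqr]] := riesz qgrowth_lin qgrowth_le qgrowth1 qgrowth_sqr M_lin M_ge0 M1.
exact: (@coupling_of_representation _ (measurableTypeR R) _ X mX Xrep Xsqr).
Qed.

End coupling.

Arguments cx {R d} t.
Arguments cy {R d} t.
Arguments cz {R d} t.

(** * Duality *)

Section quadratic_growth.
Variables (R : realType) (d : nat).
Implicit Types (f g : 'rV[R]_d -> R) (mu : probability (Rd R d) R).

Definition qborel f := measurable_fun setT (f : Rd R d -> R) /\
  exists C, forall x, `|f x| <= C * (1 + dotp x x).

Lemma intg_cst k mu : intg mu (fun=> k).
Proof. exact: finite_measure_integrable_cst. Qed.

Lemma measurable_sqr : measurable_fun setT (fun x : Rd R d => dotp (x : 'rV[R]_d) x).
Proof. by apply: measurable_sum => i; apply: measurable_funM; exact: measurable_coord. Qed.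

Lemma intg_sqr mu : P2 mu -> intg mu (fun x => dotp (x : 'rV[R]_d) x).
Proof.
move=> p2; apply/integrableP; split; first by apply/measurable_EFinP; exact: measurable_sqr.
apply: le_lt_trans p2; rewrite le_eqVlt; apply/orP; left; apply/eqP.
by apply: eq_integral => x _ /=; rewrite enorm_sqr ger0_norm// dotp_ge0.
Qed.

Lemma intg_qborel f mu : P2 mu -> qborel f -> intg mu f.
Proof.
move=> p2 [mf [C hC]]; apply: (intg_le mf hC).
by apply: intgZ; apply: intgD; [exact: intg_cst|exact: intg_sqr].
Qed.

Lemma qborelD f g : qborel f -> qborel g -> qborel (fun x => f x + g x).
Proof.
move=> [mf [C hC]] [mg [D hD]]; split; first exact: measurable_funD.
by exists (C + D) => x; rewrite mulrDl; apply: (le_trans (ler_normD _ _)); exact: lerD.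
Qed.

Lemma qborelZ k f : qborel f -> qborel (fun x => k * f x).
Proof.
move=> [mf [C hC]]; split; first exact: measurable_funM.
by exists (`|k| * C) => x; rewrite normrM -mulrA ler_wpM2l.
Qed.

Lemma qborel_cst k : qborel (fun=> k).
Proof.
split; first exact: measurable_cst.
by exists `|k| => x; rewrite ler_peMr// lerDl dotp_ge0.
Qed.

Lemma qborel_sqr : qborel (fun x => dotp x x).
Proof.
split; first exact: measurable_sqr.
by exists 1 => x; rewrite mul1r ger0_norm ?dotp_ge0// lerDr.
Qed.

Lemma qborel_bounded f : measurable_fun setT (f : Rd R d -> R) ->
  (forall x, 0 <= f x <= 1) -> qborel f.
Proof.
move=> mf f01; split => //; exists 1 => x; have /andP[? ?] := f01 x.
by rewrite mul1r ger0_norm//; apply: (@le_trans _ _ 1) => //; rewrite lerDl dotp_ge0.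
Qed.

Lemma Rint_cst k mu : \int[mu]_x k = k.
Proof.
have mu1 : mu setT = 1%E := probability_setT mu.
by rewrite /Rintegral integral_cst// [X in fine (_ * X)%E](_ : _ = 1%E)// mule1.
Qed.

End quadratic_growth.

(** * Hahn-Banach with a cone of admissible functions of [z] *)

Section cone.
Variables (R : realType) (d : nat) (mu nu : probability (Rd R d) R).
Implicit Types (f g h : 'rV[R]_d -> R) (F G : Rd3 R d -> R).
Hypotheses (P2mu : P2 mu) (P2nu : P2 nu).

(* [H h b]: the function [h] of [z] may be used at the price [b]. *)
Variable H : ('rV[R]_d -> R) -> R -> Prop.
Hypothesis H0 : H (fun=> 0) 0.
Hypothesis HD : forall h h' b b', H h b -> H h' b' -> H (fun z => h z + h' z) (b + b').
Hypothesis HZ : forall k h b, 0 < k -> H h b -> H (fun z => k * h z) (k * b).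
Hypothesis Hsqr : exists b, H (fun z => dotp z z) b.

Definition split_fun f g h (Phi Psi : 'rV[R]_d -> 'rV[R]_d) (t : Rd3 R d) :=
  f (cx t) + g (cy t) + h (cz t) +
  dotp (cz t - cx t) (Phi (cx t)) + dotp (cz t - cy t) (Psi (cy t)).

Hypothesis weak_duality : forall f g h Phi Psi b, qborel f -> qborel g -> H h b ->
  (forall t, 0 <= split_fun f g h Phi Psi t) -> 0 <= \int[mu]_x f x + \int[nu]_x g x + b.

(** [v] is the price of a separated function above [G], in the manner of superhedging. [Phi] and
    [Psi] cost nothing and are arbitrary maps: the bound only has to hold pointwise. *)
Let dominated G v := exists f g h Phi Psi b,
  [/\ qborel f, qborel g, H h b, forall t, G t <= split_fun f g h Phi Psi t &
      v = \int[mu]_x f x + \int[nu]_x g x + b].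

Let dominatedD G G' v v' : dominated G v -> dominated G' v' ->
  dominated (fun t => G t + G' t) (v + v').
Proof.
move=> [f [g [h [Phi [Psi [b [qf qg Hh le ->]]]]]]].
move=> [f' [g' [h' [Phi' [Psi' [b' [qf' qg' Hh' le' ->]]]]]]].
exists (fun x => f x + f' x), (fun x => g x + g' x), (fun x => h x + h' x).
exists (fun x => Phi x + Phi' x), (fun x => Psi x + Psi' x), (b + b'); split.
- exact: qborelD.
- exact: qborelD.
- exact: HD.
- by move=> t; have := le t; have := le' t; rewrite /split_fun !dotpDr; lra.
- by rewrite !RintD; [ring|exact: intg_qborel..].
Qed.

Let dominatedZ G v k : 0 < k -> dominated G v -> dominated (fun t => k * G t) (k * v).
Proof.
move=> k0 [f [g [h [Phi [Psi [b [qf qg Hh le ->]]]]]]].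
exists (fun x => k * f x), (fun x => k * g x), (fun x => k * h x).
exists (fun x => k *: Phi x), (fun x => k *: Psi x), (k * b); split.
- exact: qborelZ.
- exact: qborelZ.
- exact: HZ.
- by move=> t; rewrite /split_fun !dotpZr -!mulrDr ler_wpM2l// ltW.
- by rewrite !RintZ; [ring|exact: intg_qborel..].
Qed.

Let dominated_ge0 G v : (forall t, 0 <= G t) -> dominated G v -> 0 <= v.
Proof.
move=> G0 [f [g [h [Phi [Psi [b [qf qg Hh le ->]]]]]]].
by apply: (weak_duality (Phi := Phi) (Psi := Psi) qf qg Hh) => t; exact: le_trans (G0 t) (le t).
Qed.

Let dominated_qgrowth G : qgrowth G -> exists v, dominated G v.
Proof.
move=> [C0 hC0]; pose C := `|C0| + 1; have C_gt0 : 0 < C by rewrite ltr_wpDl.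
have hC t : G t <= C * sqnorms t.
  apply: (le_trans (ler_norm _)); apply: (le_trans (hC0 t)).
  rewrite ler_wpM2r//; first exact: le_trans (sqnorms_ge1 t).
  by apply: (le_trans (ler_norm _)); rewrite lerDl.
have [b Hb] := Hsqr.
exists (\int[mu]_x (C * (1 + dotp x x)) + \int[nu]_x (C * dotp x x) + C * b).
exists (fun x => C * (1 + dotp x x)), (fun x => C * dotp x x), (fun x => C * dotp x x).
exists (fun=> 0), (fun=> 0), (C * b); split => //.
- by apply: qborelZ; apply: qborelD; [exact: qborel_cst|exact: qborel_sqr].
- by apply: qborelZ; exact: qborel_sqr.
- exact: HZ.
- by move=> t; apply: (le_trans (hC t)); rewrite /split_fun /sqnorms !dotp0r; lra.
Qed.

Let qgrowthZ G k : qgrowth G -> qgrowth (fun t => k * G t).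
Proof.
move=> qG; have [C hC] := qG; exists (`|k| * C) => t.
by rewrite normrM -mulrA ler_wpM2l.
Qed.

(** Any price of [G] plus any price of [- G] is a price of 0, hence nonnegative by weak duality.
    This keeps the infimum of the prices finite. *)
Let dominated_lbound G : qgrowth G -> exists m, forall v, dominated G v -> m <= v.
Proof.
move=> qG; have [v0 dv0] := dominated_qgrowth (qgrowthZ (-1) qG).
exists (- v0) => v dv.
have : 0 <= v + v0 by apply: dominated_ge0 (dominatedD dv dv0) => t; rewrite mulN1r subrr.
lra.
Qed.

Lemma cone_functional : exists M : (Rd3 R d -> R) -> R,
  [/\ forall F G k, qgrowth F -> qgrowth G -> M (fun t => F t + k * G t) = M F + k * M G,
      forall F, qgrowth F -> (forall t, 0 <= F t) -> 0 <= M F &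
      forall f g h Phi Psi b, qborel f -> qborel g -> H h b ->
        qgrowth (split_fun f g h Phi Psi) ->
        M (split_fun f g h Phi Psi) <= \int[mu]_x f x + \int[nu]_x g x + b].
Proof.
pose p G := inf [set v | dominated G v].
have p_le G v : qgrowth G -> dominated G v -> p G <= v.
  move=> qG dv; apply: ge_inf => //; have [m hm] := dominated_lbound qG.
  by exists m.
have p_ge G m : qgrowth G -> (forall v, dominated G v -> m <= v) -> m <= p G.
  by move=> qG hm; apply: lb_le_inf; [exact: dominated_qgrowth|exact: hm].
have q0 : qgrowth (fun _ : Rd3 R d => 0 : R).
  by exists 0 => t; rewrite normr0 mul0r.
have d0 : dominated (fun=> 0) 0.
  exists (fun=> 0), (fun=> 0), (fun=> 0), (fun=> 0), (fun=> 0), 0; split => //;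
    try exact: qborel_cst.
    by move=> t; rewrite /split_fun !dotp0r !addr0.
  by rewrite !Rint0 !addr0.
have p0 : p (fun=> 0) = 0.
  apply/eqP; rewrite eq_le p_le//= p_ge// => v.
  exact: dominated_ge0.
have pD F G : qgrowth F -> qgrowth G -> p (fun t => F t + G t) <= p F + p G.
  move=> qF qG.
  have qFG : qgrowth (fun t => F t + G t).
    by have := qgrowth_lin 1 qF qG; under eq_fun do rewrite mul1r.
  rewrite -lerBlDr; apply: (p_ge) => // v dv.
  rewrite lerBlDr -lerBlDl; apply: (p_ge) => // v' dv'.
  by rewrite lerBlDl; apply: (p_le) => //; exact: dominatedD.
have pZ_le k F : 0 < k -> qgrowth F -> p (fun t => k * F t) <= k * p F.
  move=> k0 qF; rewrite mulrC -ler_pdivrMr//; apply: (p_ge) => // v dv.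
  rewrite ler_pdivrMr// mulrC; apply: (p_le); first exact: qgrowthZ.
  exact: dominatedZ.
have pZ k F : 0 < k -> qgrowth F -> p (fun t => k * F t) = k * p F.
  move=> k0 qF; apply/eqP; rewrite eq_le pZ_le//=.
  have kV : 0 < k^-1 by rewrite invr_gt0.
  have := pZ_le _ _ kV (qgrowthZ k qF).
  under [X in p X]eq_fun do rewrite mulrA mulVf ?gt_eqF// mul1r.
  by rewrite -(ler_pM2l k0) mulrA divff ?gt_eqF// mul1r.
have [M [M_lin M_le]] := @hahn_banach R (Rd3 R d -> R^o) (@qgrowth R d) p q0
  (fun F G k qF qG => qgrowth_lin k qF qG) pD pZ p0.
exists M; split.
- by move=> F G k qF qG; exact: (M_lin F G k).
- move=> F qF F0.
  have M0 : M (fun=> 0) = 0.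
    have := M_lin (fun=> 0) (fun=> 0) (-1) q0 q0.
    by rewrite scaleN1r subrr mulN1r subrr.
  have MN : M (fun t => 0 + (-1) * F t) = - M F.
    by apply: (etrans (M_lin (fun=> 0) F (-1) q0 qF)); rewrite M0 add0r mulN1r.
  rewrite -oppr_le0 -MN.
  apply: le_trans (M_le _ _) _; first exact: (qgrowth_lin (-1) q0 qF).
  apply: (p_le); first exact: (qgrowth_lin (-1) q0 qF).
  have [f [g [h [Phi [Psi [b [qf qg Hh le vE]]]]]]] := d0.
  exists f, g, h, Phi, Psi, b; split => // t; apply: le_trans (le t).
  by rewrite add0r mulN1r oppr_le0 F0.
- move=> f g h Phi Psi b qf qg Hh qs; apply: (le_trans (M_le _ qs)); apply: (p_le) => //.
  by exists f, g, h, Phi, Psi, b; split.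
Qed.

(** Every equality is obtained from two domination inequalities, for a function and its opposite at
    opposite prices: a test function of [x] or [y] costs its integral, and the drift terms, with
    [Phi x = phi x e_i], cost 0. On [|z|^2] only the upper bound is needed, which is the one that
    survives the loss of mass. *)
Lemma cone_coupling : exists pi : probability (Rd3 R d) R,
  [/\ marg1 pi mu /\ marg2 pi nu,
      forall i, orth pi (fun t => cz t ord0 i - cx t ord0 i) cx /\
                orth pi (fun t => cz t ord0 i - cy t ord0 i) cy,
      P2_3 pi,
      (forall rho : probability (Rd R d) R, (forall phi, lip phi ->
        measurable_fun setT (phi : Rd R d -> R) -> (forall x, 0 <= phi x <= 1) ->
        H phi (\int[rho]_x phi x) /\ H (fun x => - phi x) (- \int[rho]_x phi x)) ->
        marg3 pi rho) &
      forall b, H (fun z => dotp z z) b -> (\int[pi]_t (dotp (cz t) (cz t))%:E <= b%:E)%E].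
Proof.
have [M [M_lin M_ge0 M_le]] := cone_functional.
have qg01 (phi : 'rV[R]_d -> R) (k : Rd3 R d -> 'rV[R]_d) :
    (forall x, 0 <= phi x <= 1) -> qgrowth (fun t => phi (k t)).
  move=> phi01; apply: qgrowth_le (@qgrowth1 R d) _ => t.
  by have /andP[? ?] := phi01 (k t); rewrite ger0_norm.
have qN F : qgrowth F -> qgrowth (fun t => - F t).
  by move=> /(qgrowthZ (-1)); under eq_fun do rewrite mulN1r.
have q0 : qgrowth (fun _ : Rd3 R d => 0 : R) by exists 0 => t; rewrite normr0 mul0r.
have M0 : M (fun=> 0) = 0.
  have := M_lin _ _ (-1) q0 q0; under eq_fun do rewrite mulr0 addr0.
  lra.
have MN F : qgrowth F -> M (fun t => - F t) = - M F.
  move=> qF; have := M_lin _ _ (-1) q0 qF; under eq_fun do rewrite mulN1r add0r.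
  by rewrite M0 mulN1r add0r.
have Meq F v : qgrowth F -> M F <= v -> M (fun t => - F t) <= - v -> M F = v.
  by move=> qF le1; rewrite MN// lerN2 => le2; apply/eqP; rewrite eq_le le1.
have M_split F f g h Phi Psi b : qborel f -> qborel g -> H h b ->
    qgrowth F -> F = split_fun f g h Phi Psi -> M F <= \int[mu]_x f x + \int[nu]_x g x + b.
  by move=> qf qg Hh qF FE; move: qF; rewrite FE => qF; exact: M_le.
have qc k : qborel (fun _ : 'rV[R]_d => k) := qborel_cst d k.
have law_x : same_law M cx mu.
  move=> phi lphi mphi phi01; have qphi := qborel_bounded mphi phi01.
  apply: (Meq); first exact: qg01.
    apply: (le_trans (M_split _ phi (fun=> 0) (fun=> 0) (fun=> 0) (fun=> 0) 0 _ _ _ _ _)) => //.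
    - exact: qg01.
    - by apply/funext => t; rewrite /split_fun !dotp0r !addr0.
    - by rewrite Rint0 !addr0.
  apply: (le_trans (M_split _ (fun x => - phi x)
    (fun=> 0) (fun=> 0) (fun=> 0) (fun=> 0) 0 _ _ _ _ _)) => //.
  - by have := qborelZ (-1) qphi; under eq_fun do rewrite mulN1r.
  - by apply: qN; exact: qg01.
  - by apply/funext => t; rewrite /split_fun !dotp0r !addr0.
  - by rewrite Rint0 !addr0 RintN//; exact: intg_qborel.
have law_y : same_law M cy nu.
  move=> phi lphi mphi phi01; have qphi := qborel_bounded mphi phi01.
  apply: (Meq); first exact: qg01.
    apply: (le_trans (M_split _ (fun=> 0) phi (fun=> 0) (fun=> 0) (fun=> 0) 0 _ _ _ _ _)) => //.
    - exact: qg01.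
    - by apply/funext => t; rewrite /split_fun !dotp0r !addr0 add0r.
    - by rewrite Rint0 !addr0 add0r.
  apply: (le_trans (M_split _ (fun=> 0) (fun x => - phi x)
    (fun=> 0) (fun=> 0) (fun=> 0) 0 _ _ _ _ _)) => //.
  - by have := qborelZ (-1) qphi; under eq_fun do rewrite mulN1r.
  - by apply: qN; exact: qg01.
  - by apply/funext => t; rewrite /split_fun !dotp0r !addr0 add0r.
  - by rewrite Rint0 !addr0 add0r RintN//; exact: intg_qborel.
have M1 : M (fun=> 1) = 1.
  rewrite -[RHS](Rint_cst 1 mu); apply: (law_x (fun=> 1)).
  - by exists 0; split => // x y; rewrite subrr normr0 mul0r.
  - exact: measurable_cst.
  - by move=> x; rewrite ler01 lexx.
have q_drift (k : Rd3 R d -> 'rV[R]_d) i (phi : 'rV[R]_d -> R) :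
    (forall t, dotp (k t) (k t) <= sqnorms t) -> (forall x, 0 <= phi x <= 1) ->
    qgrowth (fun t => (cz t ord0 i - k t ord0 i) * phi (k t)).
  move=> kle phi01; exists 2 => t; rewrite normrM.
  have /andP[p0 p1] := phi01 (k t).
  apply: (@le_trans _ _ (`|cz t ord0 i - k t ord0 i| * 1)).
    by rewrite ler_wpM2l// ger0_norm.
  have kle' := kle t; have := sqr_coord_le (cz t) i; have := sqr_coord_le (k t) i.
  have : dotp (cz t) (cz t) + 1 <= sqnorms t.
    by rewrite /sqnorms; have := dotp_ge0 (cx t); have := dotp_ge0 (cy t); lra.
  have := sqr_ge0 (cz t ord0 i - 1); have := sqr_ge0 (cz t ord0 i + 1).
  have := sqr_ge0 (k t ord0 i - 1); have := sqr_ge0 (k t ord0 i + 1).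
  by rewrite !expr2 mulr1 ler_norml => *; apply/andP; split; nra.
have cx_le (t : Rd3 R d) : dotp (cx t) (cx t) <= sqnorms t.
  by rewrite /sqnorms; have := dotp_ge0 (cz t); have := dotp_ge0 (cy t); lra.
have cy_le (t : Rd3 R d) : dotp (cy t) (cy t) <= sqnorms t.
  by rewrite /sqnorms; have := dotp_ge0 (cz t); have := dotp_ge0 (cx t); lra.
have cz_le (t : Rd3 R d) : dotp (cz t) (cz t) <= sqnorms t.
  by rewrite /sqnorms; have := dotp_ge0 (cy t); have := dotp_ge0 (cx t); lra.
have drift_x : null_drift M cx.
  move=> i phi _ phi01; apply: (Meq); first exact: q_drift.
    apply: (le_trans (M_split _ (fun=> 0) (fun=> 0) (fun=> 0)
      (fun x => phi x *: delta_mx ord0 i) (fun=> 0) 0 _ _ _ _ _)) => //.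
    - exact: q_drift.
    - by apply/funext => t; rewrite /split_fun !dotpZr dotp_delta dotp0r !mxE; ring.
    - by rewrite !Rint0 !addr0.
  apply: (le_trans (M_split _ (fun=> 0) (fun=> 0) (fun=> 0)
    (fun x => - phi x *: delta_mx ord0 i) (fun=> 0) 0 _ _ _ _ _)) => //.
  - by apply: qN; exact: q_drift.
  - by apply/funext => t; rewrite /split_fun !dotpZr dotp_delta dotp0r !mxE; ring.
  - by rewrite !Rint0 !addr0 oppr0.
have drift_y : null_drift M cy.
  move=> i phi _ phi01; apply: (Meq); first exact: q_drift.
    apply: (le_trans (M_split _ (fun=> 0) (fun=> 0) (fun=> 0) (fun=> 0)
      (fun x => phi x *: delta_mx ord0 i) 0 _ _ _ _ _)) => //.
    - exact: q_drift.
    - by apply/funext => t; rewrite /split_fun !dotpZr dotp_delta dotp0r !mxE; ring.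
    - by rewrite !Rint0 !addr0.
  apply: (le_trans (M_split _ (fun=> 0) (fun=> 0) (fun=> 0) (fun=> 0)
    (fun x => - phi x *: delta_mx ord0 i) 0 _ _ _ _ _)) => //.
  - by apply: qN; exact: q_drift.
  - by apply/funext => t; rewrite /split_fun !dotpZr dotp_delta dotp0r !mxE; ring.
  - by rewrite !Rint0 !addr0 oppr0.
have [pi [l1 l2 l3 opi [sq p2]]] := coupling_of_functional M_lin M_ge0 M1 drift_x drift_y.
exists pi; split => //.
- by split; [exact: l1|exact: l2].
- move=> rho Hrho; apply: l3 => phi lphi mphi phi01.
  have [Hp Hn] := Hrho phi lphi mphi phi01.
  apply: (Meq); first exact: qg01.
    apply: (le_trans (M_split _ (fun=> 0) (fun=> 0) phi (fun=> 0) (fun=> 0) _ _ _ Hp _ _)) => //.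
    - exact: qg01.
    - by apply/funext => t; rewrite /split_fun !dotp0r !addr0 add0r.
    - by rewrite !Rint0 !add0r.
  apply: (le_trans (M_split _ (fun=> 0) (fun=> 0) (fun x => - phi x)
    (fun=> 0) (fun=> 0) _ _ _ Hn _ _)) => //.
  - by apply: qN; exact: qg01.
  - by apply/funext => t; rewrite /split_fun !dotp0r !addr0 add0r.
  - by rewrite !Rint0 !add0r.
move=> b Hb.
have q_i i : qgrowth (fun t : Rd3 R d => cz t ord0 i ^+ 2).
  exists 1 => t; rewrite mul1r ger0_norm ?sqr_ge0//.
  exact: le_trans (sqr_coord_le (cz t) i) (cz_le t).
have q_s (s : seq 'I_d) : qgrowth (fun t : Rd3 R d => \sum_(i <- s) cz t ord0 i ^+ 2) /\
    M (fun t => \sum_(i <- s) cz t ord0 i ^+ 2) = \sum_(i <- s) M (fun t => cz t ord0 i ^+ 2).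
  elim: s => [|i s [IH1 IH2]].
    by rewrite big_nil; under eq_fun do rewrite big_nil; split.
  rewrite big_cons; under eq_fun do rewrite big_cons; split.
    by have := qgrowth_lin 1 (q_i i) IH1; under eq_fun do rewrite mul1r.
  by have := M_lin _ _ 1 (q_i i) IH1; under eq_fun do rewrite mul1r; rewrite IH2 mul1r.
apply: (@le_trans _ _ (M (fun t => \sum_i cz t ord0 i ^+ 2))%:E); last first.
  rewrite lee_fin; apply: (le_trans (M_split _ (fun=> 0) (fun=> 0) (fun z => dotp z z)
    (fun=> 0) (fun=> 0) _ _ _ Hb _ _)) => //.
  - exact: (q_s _).1.
  - apply/funext => t; rewrite /split_fun !dotp0r !addr0 add0r /dotp.
    by apply: eq_bigr => i _; rewrite expr2.
  - by rewrite !Rint0 !add0r.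
rewrite (q_s _).2 -sumEFin.
rewrite (eq_integral (fun t => (\sum_i (cz t ord0 i ^+ 2)%:E)%E)); last first.
  by move=> t _; rewrite sumEFin /dotp; congr EFin; apply: eq_bigr => i _; rewrite expr2.
rewrite ge0_integral_sum//.
- by apply: lee_sum => i _; exact: sq.
- move=> i; apply/measurable_EFinP; apply: measurable_funX.
  exact: (measurableT_comp (measurable_coord i) measurable_snd).
- by move=> i t _; rewrite lee_fin sqr_ge0.
Qed.

End cone.

(** * Weak duality for the two cones *)

Section weak_duality.
Variables (R : realType) (d : nat).
Implicit Types (f g h : 'rV[R]_d -> R) (mu : probability (Rd R d) R).

Lemma qborel_le f g : measurable_fun setT (f : Rd R d -> R) ->
  (forall x, `|f x| <= g x) -> qborel g -> qborel f.
Proof.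
move=> mf fg [_ [C hC]]; split => //; exists C => x.
by apply: le_trans (hC x); apply: le_trans (fg x) (ler_norm _).
Qed.

Lemma aff_bound (l : R * 'rV[R]_d) z :
  `|aff l z| <= (`|l.1| + dotp l.2 l.2 + 1) * (1 + dotp z z).
Proof.
have := dotp_le_sqr l.2 z; have := dotp_le_sqr l.2 (- z); rewrite !dotpNr dotpNl opprK => h1 h2.
have := ler_norm l.1; have := ler_norm (- l.1); rewrite normrN => h3 h4.
have := dotp_ge0 l.2; have := dotp_ge0 z; have := normr_ge0 l.1 => h5 h6 h7.
have h8 : 0 <= (`|l.1| + dotp l.2 l.2) * dotp z z by rewrite mulr_ge0// addr_ge0.
by rewrite /aff ler_norml; apply/andP; split; lra.
Qed.

Lemma qborel_aff (l : R * 'rV[R]_d) : qborel (aff l).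
Proof.
split; last by exists (`|l.1| + dotp l.2 l.2 + 1) => z; exact: aff_bound.
apply: measurable_funD; first exact: measurable_cst.
by apply: measurable_sum => i; apply: measurable_funM; [exact: measurable_cst|exact: measurable_coord].
Qed.

(** For fixed [x] the terms in [x] of a separated function are affine in [z]. With opposite sign
    they take the value [- f x] at [z = x], and positivity of the whole bounds the sum of an affine
    function from [f] and one from [g] by [h z]. *)
Definition tangents f (Phi : 'rV[R]_d -> 'rV[R]_d) :=
  [set (- f x + dotp x (Phi x), - Phi x) | x in [set: 'rV[R]_d]].

Lemma tangents_neq0 f Phi : tangents f Phi !=set0.
Proof. by exists (- f 0 + dotp 0 (Phi 0), - Phi 0), 0. Qed.

Lemma aff_tangent f Phi x z :
  aff (- f x + dotp x (Phi x), - Phi x) z = - f x - dotp (z - x) (Phi x).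
Proof. by rewrite /aff /= dotpNl dotpBl (dotpC z); ring. Qed.

Lemma aff_tangent_self f Phi x : aff (- f x + dotp x (Phi x), - Phi x) x = - f x.
Proof. by rewrite aff_tangent subrr dotp0l subr0. Qed.

Lemma tangents_sum f g h Phi Psi :
  (forall t : Rd3 R d, 0 <= split_fun f g h Phi Psi t) ->
  forall l m z, tangents f Phi l -> tangents g Psi m -> aff l z + aff m z <= h z.
Proof.
move=> pos _ _ z [x _ <-] [y _ <-]; have := pos ((x, y), z).
by rewrite !aff_tangent /split_fun /cx /cy /cz /=; lra.
Qed.

Lemma C11_1_qborel (u : 'rV[R]_d -> R^o) : C11_1 u -> qborel u.
Proof.
move=> [g [ud gL]]; split.
  by apply: continuous_measurable => x; apply: differentiable_continuous; exact: (ud x).1.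
exists (`|u 0| + dotp (g 0) (g 0) + 2) => y.
have := C11_1_lower ud gL 0 y; have := C11_1_upper ud gL 0 y; rewrite !subr0 => hi lo.
have := aff_bound (u 0, g 0) y; rewrite /aff /= ler_norml => /andP[lo' hi'].

by rewrite ler_norml; apply/andP; split; nra.
Qed.

Variables (mu nu : probability (Rd R d) R).
Hypotheses (P2mu : P2 mu) (P2nu : P2 nu).

(** With [a] and [b] the suprema of the tangents, [a + b <= h], [- f <= a] and [- g <= b].
    Integrating the first inequality against [rho], moving [a] to [mu] and [b] to [nu] by convex
    order, and then using the other two gives the claim. *)
Lemma convex_order_weak_duality (rho : probability (Rd R d) R) f g h Phi Psi : P2 rho ->
  (forall phi, cvx phi -> (\int[mu]_x (phi x)%:E <= \int[rho]_x (phi x)%:E)%E) ->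
  (forall phi, cvx phi -> (\int[nu]_x (phi x)%:E <= \int[rho]_x (phi x)%:E)%E) ->
  qborel f -> qborel g -> qborel h ->
  (forall t : Rd3 R d, 0 <= split_fun f g h Phi Psi t) ->
  0 <= \int[mu]_x f x + \int[nu]_x g x + \int[rho]_x h x.
Proof.
move=> P2rho mu_rho nu_rho qf qg qh pos.
have FG := tangents_sum pos.
set F := tangents f Phi in FG; set G := tangents g Psi in FG.
have [l0 Fl0] := tangents_neq0 f Phi; have [m0 Gm0] := tangents_neq0 g Psi.
have bF : bounded_family F.
  split; first by exists l0.
  move=> z; exists (h z - aff m0 z) => l Fl.
  by have := FG _ _ z Fl Gm0; lra.
have bG : bounded_family G.
  split; first by exists m0.
  move=> z; exists (h z - aff l0 z) => m Gm.
  by have := FG _ _ z Fl0 Gm; lra.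
have sum_le z : supaff F z + supaff G z <= h z.
  rewrite -lerBrDr; apply: supaff_le; first by exists l0.
  move=> l Fl; rewrite lerBrDr -lerBrDl; apply: supaff_le; first by exists m0.
  by move=> m Gm; rewrite lerBrDl; exact: FG.
(* Each supremum lies between an affine function and [h] minus an affine function, so it has
   quadratic growth and is integrable. *)
have qsup K L k k' : bounded_family K -> bounded_family L -> K k -> L k' ->
    (forall z, supaff K z + supaff L z <= h z) -> qborel (supaff K).
  move=> bK bL Kk Lk le_h.
  have q : qborel (fun z => `|h z| + `|aff k z| + `|aff k' z|).
    have qn p : qborel p -> qborel (fun z => `|p z|).
      move=> [mp [C hC]]; split; first exact: measurableT_comp mp.
      by exists C => x; rewrite normr_id.
    by apply: qborelD; [apply: qborelD|]; apply: qn => //; exact: qborel_aff.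
  apply: qborel_le q; first by apply: cvx_measurable; exact: cvx_supaff.
  move=> z; have h1 := le_h z; have h2 := supaff_ge z bK Kk; have h3 := supaff_ge z bL Lk.
  have := ler_norm (h z); have := ler_norm (- aff k z); have := ler_norm (- aff k' z).
  have := normr_ge0 (h z); have := normr_ge0 (aff k z); have := normr_ge0 (aff k' z).
  by rewrite !normrN ler_norml => *; apply/andP; split; lra.
have qa := qsup _ _ _ _ bF bG Fl0 Gm0 sum_le.
have qb : qborel (supaff G).
  by apply: (qsup _ _ _ _ bG bF Gm0 Fl0) => z; rewrite addrC.
have order (nu' : probability (Rd R d) R) K : P2 nu' -> bounded_family K -> qborel (supaff K) ->
    (forall phi, cvx phi -> (\int[nu']_x (phi x)%:E <= \int[rho]_x (phi x)%:E)%E) ->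
    \int[nu']_x supaff K x <= \int[rho]_x supaff K x.
  move=> p2 bK qK /(_ _ (cvx_supaff bK)).
  by rewrite !Rint_EFin ?lee_fin//; exact: intg_qborel.
have lower (nu' : probability (Rd R d) R) f' Phi' : P2 nu' -> qborel f' ->
    bounded_family (tangents f' Phi') -> qborel (supaff (tangents f' Phi')) ->
    - (\int[nu']_x f' x) <= \int[nu']_x supaff (tangents f' Phi') x.
  move=> p2 qf' bf qs; apply: (@le_trans _ _ (\int[nu']_x (- f' x))).
    by rewrite (RintN (intg_qborel p2 qf')).
  apply: Rint_le; [by apply: intgN; exact: intg_qborel|exact: intg_qborel|].
  move=> x; rewrite -(aff_tangent_self f' Phi' x); apply: supaff_ge => //.
  by exists x.
have := lower _ _ _ P2mu qf bF qa; have := lower _ _ _ P2nu qg bG qb.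
have := order _ _ P2mu bF qa mu_rho; have := order _ _ P2nu bG qb nu_rho.
have : \int[rho]_x supaff F x + \int[rho]_x supaff G x <= \int[rho]_x h x.
  apply: (@le_trans _ _ (\int[rho]_x (supaff F x + supaff G x))).
    by rewrite RintD//; exact: intg_qborel.
  by apply: Rint_le => //; [apply: intgD; exact: intg_qborel|exact: intg_qborel].
lra.
Qed.

(** Here [H] is a linear space with price [int h drho], so that test functions of [z] are available
    with both signs and the third marginal is exactly [rho]. One functional serves both martingale
    conditions, hence a common third coordinate. *)
Lemma strassen (rho : probability (Rd R d) R) : P2 rho ->
  (forall phi, cvx phi -> (\int[mu]_x (phi x)%:E <= \int[rho]_x (phi x)%:E)%E) ->
  (forall phi, cvx phi -> (\int[nu]_x (phi x)%:E <= \int[rho]_x (phi x)%:E)%E) ->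
  exists pi : probability (Rd3 R d) R,
    [/\ marg1 pi mu, marg2 pi nu, marg3 pi rho,
        forall i, orth pi (fun t => cz t ord0 i - cx t ord0 i) cx /\
                  orth pi (fun t => cz t ord0 i - cy t ord0 i) cy &
        P2_3 pi].
Proof.
move=> P2rho mu_rho nu_rho.
pose H h b := qborel h /\ b = \int[rho]_x h x.
have [|||||pi [[m1 m2] o p2 m3 _]] := @cone_coupling R d mu nu P2mu P2nu H.
- by split; [exact: qborel_cst|rewrite Rint0].
- move=> h h' b b' [qh ->] [qh' ->]; split; first exact: qborelD.
  by rewrite RintD//; exact: intg_qborel.
- move=> k h b k0 [qh ->]; split; first exact: qborelZ.
  by rewrite RintZ//; exact: intg_qborel.
- by exists (\int[rho]_x dotp x x); split => //; exact: qborel_sqr.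
- move=> f g h Phi Psi b qf qg [qh ->] pos.
  exact: (convex_order_weak_duality (Phi := Phi) (Psi := Psi)).
exists pi; split => //; apply: m3 => phi _ mphi phi01.
have q := qborel_bounded mphi phi01; split; split => //.
  by have := qborelZ (-1) q; under eq_fun do rewrite mulN1r.
by rewrite RintN//; exact: intg_qborel.
Qed.

Variable D : R.
Hypothesis D_ge : forall u, C11_1 u ->
  \int[nu]_x u x - \int[mu]_x u x + (\int[mu]_x dotp x x + \int[nu]_x dotp x x) / 2 <= D.

(** Division by [s] turns the bound into [|z|^2]. At the base points the sandwich reads
    [- g' <= u + |.|^2/2] and [- f' <= |.|^2/2 - u]; integration against [nu] and [mu] leaves
    exactly the quantity bounded by [D]. *)
Let weak_duality_pos s f g Phi Psi : 0 < s -> qborel f -> qborel g ->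
  (forall t : Rd3 R d, 0 <= split_fun f g (fun z => s * dotp z z) Phi Psi t) ->
  0 <= \int[mu]_x f x + \int[nu]_x g x + s * D.
Proof.
move=> s0 qf qg pos.
pose f' x := s^-1 * f x; pose g' x := s^-1 * g x.
pose Phi' x := s^-1 *: Phi x; pose Psi' x := s^-1 *: Psi x.
have pos' (t : Rd3 R d) : 0 <= split_fun f' g' (fun z => dotp z z) Phi' Psi' t.
  have -> : split_fun f' g' (fun z => dotp z z) Phi' Psi' t =
      s^-1 * split_fun f g (fun z => s * dotp z z) Phi Psi t.
    rewrite /split_fun /f' /g' /Phi' /Psi' !dotpZr; field.
    by rewrite gt_eqF.
  by rewrite mulr_ge0 ?invr_ge0// ltW.
have [u [uC uP]] := C11_1_sandwich (tangents_neq0 f' Phi') (tangents_neq0 g' Psi')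
  (tangents_sum pos').
have qu := C11_1_qborel uC.
have iu nu' : P2 nu' -> intg nu' u by move=> p2; exact: intg_qborel.
have i2 (nu' : probability (Rd R d) R) : P2 nu' -> intg nu' (fun x => 2^-1 * dotp x x).
  by move=> p2; apply: intgZ; exact: intg_sqr.
have le_g : - (\int[nu]_x g' x) <= \int[nu]_x u x + 2^-1 * \int[nu]_x dotp x x.
  apply: (@le_trans _ _ (\int[nu]_x (- g' x))).
    by rewrite (RintN (intg_qborel P2nu (qborelZ _ qg))).
  apply: (@le_trans _ _ (\int[nu]_x (u x + 2^-1 * dotp x x))); last first.
    by rewrite (RintD (iu _ P2nu) (i2 _ P2nu)) (RintZ _ (intg_sqr P2nu)).
  apply: Rint_le; [by apply: intgN; apply: intg_qborel => //; exact: qborelZ|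
    by apply: intgD; [exact: iu|exact: i2]|].
  move=> y; have := (uP y).1 _ (ex_intro2 _ _ y I erefl).
  by rewrite aff_tangent_self; lra.
have le_f : - (\int[mu]_x f' x) <= 2^-1 * \int[mu]_x dotp x x - \int[mu]_x u x.
  apply: (@le_trans _ _ (\int[mu]_x (- f' x))).
    by rewrite (RintN (intg_qborel P2mu (qborelZ _ qf))).
  apply: (@le_trans _ _ (\int[mu]_x (2^-1 * dotp x x - u x))); last first.
    by rewrite (RintB (i2 _ P2mu) (iu _ P2mu)) (RintZ _ (intg_sqr P2mu)).
  apply: Rint_le; [by apply: intgN; apply: intg_qborel => //; exact: qborelZ|
    by apply: intgB; [exact: i2|exact: iu]|].
  move=> y; have := (uP y).2 _ (ex_intro2 _ _ y I erefl).
  by rewrite aff_tangent_self; lra.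
have -> : \int[mu]_x f x + \int[nu]_x g x + s * D =
    s * (\int[mu]_x f' x + \int[nu]_x g' x + D).
  rewrite !RintZ; [|exact: intg_qborel..].
  by field; rewrite gt_eqF.
apply: mulr_ge0; first exact: ltW.
by have := D_ge uC; lra.
Qed.

Lemma dual_weak_duality s f g Phi Psi : 0 <= s -> qborel f -> qborel g ->
  (forall t : Rd3 R d, 0 <= split_fun f g (fun z => s * dotp z z) Phi Psi t) ->
  0 <= \int[mu]_x f x + \int[nu]_x g x + s * D.
Proof.
(* [s] may vanish: perturb it to [s + r]. *)
move=> s0 qf qg pos; apply/ler_addgt0Pl => e e0.
pose r := e / (`|D| + 1).

have r0 : 0 < r by rewrite divr_gt0.
have sr : 0 < s + r by rewrite ltr_wpDl.
have := weak_duality_pos (Phi := Phi) (Psi := Psi) sr qf qg.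
have pos' (t : Rd3 R d) : 0 <= split_fun f g (fun z => (s + r) * dotp z z) Phi Psi t.
  apply: (le_trans (pos t)); rewrite /split_fun.
  have : 0 <= r * dotp (cz t) (cz t) by rewrite mulr_ge0 ?dotp_ge0// ltW.
  lra.
move=> /(_ pos').
have : r * D <= e.
  apply: (@le_trans _ _ (r * (`|D| + 1))).
    by rewrite ler_pM2l//; apply: (le_trans (ler_norm _)); rewrite lerDl.
  by rewrite /r divfK// gt_eqF.
lra.
Qed.

(** [H] consists of the nonnegative multiples of [|z|^2]: the third marginal is left free and only
    its second moment is bounded from above. *)
Lemma dual_coupling : exists pi : probability (Rd3 R d) R,
    [/\ marg1 pi mu, marg2 pi nu,
        forall i, orth pi (fun t => cz t ord0 i - cx t ord0 i) cx /\
                  orth pi (fun t => cz t ord0 i - cy t ord0 i) cy,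
        P2_3 pi & (\int[pi]_t (dotp (cz t) (cz t))%:E <= D%:E)%E].
Proof.
pose H (h : 'rV[R]_d -> R) b := exists s, [/\ 0 <= s, h = (fun z => s * dotp z z) & b = s * D].
have H1 : H (fun z => dotp z z) D.
  by exists 1; split; rewrite ?mul1r//; apply/funext => z; rewrite mul1r.
have [|||||pi [[m1 m2] o p2 _ le_D]] := @cone_coupling R d mu nu P2mu P2nu H.
- by exists 0; split; rewrite ?mul0r//; apply/funext => z; rewrite mul0r.
- move=> h h' b b' [s [s0 -> ->]] [s' [s'0 -> ->]]; exists (s + s'); split.
  + exact: addr_ge0.
  + by apply/funext => z; rewrite mulrDl.
  + by rewrite mulrDl.
- move=> k h b k0 [s [s0 -> ->]]; exists (k * s); split.
  + by rewrite mulr_ge0// ltW.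
  + by apply/funext => z; rewrite mulrA.
  + by rewrite mulrA.
- by exists D.
- move=> f g h Phi Psi b qf qg [s [s0 -> ->]] pos.
  exact: (dual_weak_duality (Phi := Phi) (Psi := Psi)).
by exists pi; split => //; exact: le_D.
Qed.

End weak_duality.

(** * Convex order and the three values *)

Section law_transfer.
Context e (S : measurableType e) (R : realType) (P : probability S R) (d : nat).
Variables (k : S -> Rd R d) (mu : probability (Rd R d) R).
Hypothesis mk : measurable_fun setT k.
Hypothesis law_k : forall A : set (Rd R d), measurable A -> P (k @^-1` A) = mu A.

Let ge0_law_integral (g : Rd R d -> \bar R) : measurable_fun setT g ->
  (forall x, (0 <= g x)%E) -> (\int[P]_s g (k s) = \int[mu]_x g x)%E.
Proof.
move=> mg g0.
rewrite -(@eq_measure_integral _ _ _ setT mu (pushforward P k)); last first.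
  by move=> A mA _; exact: law_k.
by rewrite ge0_integral_pushforward// preimage_setT.
Qed.

(** Integrability is not assumed, since convex functions of infinite integral have to be transferred
    as well. *)
Lemma law_integral (f : Rd R d -> R) : measurable_fun setT f ->
  (\int[P]_s (f (k s))%:E = \int[mu]_x (f x)%:E)%E.
Proof.
move=> mf; have mEf : measurable_fun setT (EFin \o f) by exact/measurable_EFinP.
have mp : measurable_fun setT (EFin \o f)^\+%E by exact: measurable_funepos.
have mn : measurable_fun setT (EFin \o f)^\-%E by exact: measurable_funeneg.
have pos := ge0_law_integral mp (fun x => funepos_ge0 _ x).
have neg := ge0_law_integral mn (fun x => funeneg_ge0 _ x).
rewrite integralE [RHS]integralE -[X in (_ = X - _)%E]pos -[X in (_ = _ - X)%E]neg.
by congr (_ - _)%E; apply: eq_integral => s _; rewrite ?funeposE ?funenegE.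
Qed.

Lemma law_Rint (f : Rd R d -> R) : measurable_fun setT f ->
  \int[P]_s f (k s) = \int[mu]_x f x.
Proof. by move=> mf; congr fine; exact: law_integral. Qed.

End law_transfer.

(** * Convex order, second moments and bounds for the dual problem *)

Section convex_order.
Variables (R : realType) (d : nat).
Implicit Types (mu nu rho : probability (Rd R d) R) (phi u : 'rV[R]_d -> R).

Lemma convex_functionP phi : convex_function setT phi <-> cvx phi.
Proof.
split=> [cphi x y t /andP[t0 t1]|cphi t x y _ _].
  exact: (cphi (Itv01 t0 t1) x y (in_setT _) (in_setT _)).
by apply: (cphi x y t%:num); rewrite ge0 le1.
Qed.

Lemma cvx_geP rho mu : cvx_ge rho mu <->
  (forall phi, cvx phi -> (\int[mu]_x (phi x)%:E <= \int[rho]_x (phi x)%:E)%E).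
Proof. by split=> h phi /convex_functionP; exact: h. Qed.

Definition m2 mu : R := \int[mu]_x dotp (x : 'rV[R]_d) x.

Lemma qborel_dotp p : qborel (dotp p : 'rV[R]_d -> R).
Proof.
rewrite (_ : dotp p = aff (0, p)); first exact: qborel_aff.
by apply/funext => x; rewrite /aff add0r.
Qed.

Lemma qborel_coord i : qborel (fun x : 'rV[R]_d => x ord0 i).
Proof.
rewrite (_ : (fun _ => _) = dotp (delta_mx ord0 i)); first exact: qborel_dotp.
by apply/funext => x; rewrite dotpC dotp_delta.
Qed.

Lemma baryE mu i : bary mu ord0 i = \int[mu]_x (x : 'rV[R]_d) ord0 i.
Proof. by rewrite mxE. Qed.

Lemma Rint_dotp mu p : P2 mu -> \int[mu]_x dotp p x = dotp p (bary mu).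
Proof.
move=> p2; rewrite Rint_sum => [|i _]; last first.
  by apply: intgZ; apply: intg_qborel => //; exact: qborel_coord.
by apply: eq_bigr => i _; rewrite RintZ ?baryE//; apply: intg_qborel => //; exact: qborel_coord.
Qed.

Lemma Rint_dist mu b : P2 mu -> b = bary mu ->
  \int[mu]_x dotp ((x : 'rV[R]_d) - b) (x - b) = m2 mu - dotp b b.
Proof.
move=> p2 bE.
have i1 : intg mu (fun x : Rd R d => - 2 * dotp b (x : 'rV[R]_d)).
  by apply: intg_qborel => //; apply: qborelZ; exact: qborel_dotp.
have i2 : intg mu (fun x : Rd R d => dotp (x : 'rV[R]_d) x) by exact: intg_sqr.
have i3 := intgD i2 i1.
rewrite (@eq_Rintegral _ _ _ mu setT (fun x => dotp x x + - 2 * dotp b x + dotp b b)); last first.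
  by move=> x _; rewrite !(dotpDl, dotpDr, dotpNl, dotpNr) (dotpC x b); ring.
rewrite (RintD i3 (intg_cst _ _)) (RintD i2 i1) Rint_cst RintZ; last first.
  by apply: intg_qborel => //; exact: qborel_dotp.
by rewrite Rint_dotp// -bE /m2; ring.
Qed.

Lemma qborel_dist b : qborel (fun x : 'rV[R]_d => dotp (x - b) (x - b)).
Proof.
rewrite (_ : (fun _ => _) = fun x => (dotp x x + - 2 * dotp b x) + dotp b b).
  apply: qborelD; last exact: qborel_cst.
  by apply: qborelD; [exact: qborel_sqr|apply: qborelZ; exact: qborel_dotp].
by apply/funext => x; rewrite !(dotpDl, dotpDr, dotpNl, dotpNr) (dotpC x b); ring.
Qed.

Lemma varE mu : P2 mu -> var mu = (m2 mu - dotp (bary mu) (bary mu))%:E.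
Proof.
move=> p2; rewrite -(Rint_dist p2 erefl) -Rint_EFin; last first.
  by apply: intg_qborel => //; exact: qborel_dist.
by apply: eq_integral => x _; rewrite enorm_sqr.
Qed.

(** Linear functions are convex together with their opposites. *)
Lemma convex_order_bary mu rho : P2 mu -> P2 rho -> cvx_ge rho mu -> bary rho = bary mu.
Proof.
move=> p2 p2' /cvx_geP order; apply/rowP => i; rewrite !baryE.
have le p : dotp p (bary mu) <= dotp p (bary rho).
  rewrite -!Rint_dotp// -lee_fin -!Rint_EFin; [|apply: intg_qborel => //; exact: qborel_dotp..].
  by apply: order => x y t _; rewrite dotpDr !dotpZr.
have := le (delta_mx ord0 i); have := le (- delta_mx ord0 i).
rewrite !dotpNl !(dotpC (delta_mx _ _)) !dotp_delta lerN2 !baryE => h1 h2.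
by apply/eqP; rewrite eq_le h1 h2.
Qed.

Lemma C11_1_cvx u : C11_1 u -> cvx (fun x => dotp x x / 2 + u x) /\ cvx (fun x => dotp x x / 2 - u x).
Proof.
move=> [g [ud gL]]; split.
  apply: (supported_cvx (p := fun x => x + g x)) => x y.
  have := C11_1_lower ud gL x y.
  by rewrite !(dotpDl, dotpDr, dotpNl, dotpNr) (dotpC y x); lra.
apply: (supported_cvx (p := fun x => x - g x)) => x y.
have := C11_1_upper ud gL x y.
by rewrite !(dotpDl, dotpDr, dotpNl, dotpNr) (dotpC y x); lra.
Qed.

Lemma dual_le_primal mu nu rho u : P2 mu -> P2 nu -> P2 rho ->
  cvx_ge rho mu -> cvx_ge rho nu -> C11_1 u ->
  \int[nu]_x u x - \int[mu]_x u x + (m2 mu + m2 nu) / 2 <= m2 rho.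
Proof.
move=> p2 p2' p2'' /cvx_geP rho_mu /cvx_geP rho_nu uC.
have qu := C11_1_qborel uC; have [cp cm] := C11_1_cvx uC.
have qs k : qborel (fun x : 'rV[R]_d => dotp x x / 2 + k * u x).
  apply: qborelD; last exact: qborelZ.
  by have := qborelZ 2^-1 (@qborel_sqr R d); under eq_fun do rewrite mulrC.
have E k nu' : P2 nu' -> \int[nu']_x (dotp x x / 2 + k * u x) = m2 nu' / 2 + k * \int[nu']_x u x.
  move=> q; rewrite (@eq_Rintegral _ _ _ nu' setT (fun x => 2^-1 * dotp x x + k * u x)); last first.
    by move=> x _; rewrite mulrC.
  rewrite RintD; [|by apply: intgZ; exact: intg_sqr|by apply: intgZ; exact: intg_qborel].
  by rewrite !RintZ; [rewrite [m2 _ / 2]mulrC|exact: intg_sqr|exact: intg_qborel].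
have h k nu' : P2 nu' -> cvx (fun x => dotp x x / 2 + k * u x) ->
    (forall phi, cvx phi -> (\int[nu']_x (phi x)%:E <= \int[rho]_x (phi x)%:E)%E) ->
    m2 nu' / 2 + k * \int[nu']_x u x <= m2 rho / 2 + k * \int[rho]_x u x.
  move=> q cv /(_ _ cv); rewrite !Rint_EFin ?lee_fin ?E//; exact: intg_qborel.
have c1 : cvx (fun x => dotp x x / 2 + 1 * u x) by under eq_fun do rewrite mul1r.
have c2 : cvx (fun x => dotp x x / 2 + (-1) * u x) by under eq_fun do rewrite mulN1r.
by have := h _ _ p2' c1 rho_nu; have := h _ _ p2 c2 rho_mu; lra.
Qed.

(** Quadratic bounds for [u] around the common barycenter [b]: the linear terms integrate to 0,
    [u b] cancels, and half of each variance remains. *)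
Lemma dual_bound mu nu u : P2 mu -> P2 nu -> bary mu = bary nu -> C11_1 u ->
  \int[nu]_x u x - \int[mu]_x u x <= (m2 mu + m2 nu) / 2 - dotp (bary mu) (bary mu).
Proof.
move=> p2 p2' bE uC; have qu := C11_1_qborel uC.
have [g [ud gL]] := uC; set b := bary mu.
pose A s x := u b + dotp (g b) (x - b) + s * dotp (x - b) (x - b).
have qlin : qborel (fun x => u b + dotp (g b) (x - b)).
  rewrite (_ : (fun _ => _) = aff (u b - dotp (g b) b, g b)); first exact: qborel_aff.
  by apply/funext => x; rewrite /aff/= dotpBr; ring.
have EA s nu' : P2 nu' -> b = bary nu' -> \int[nu']_x A s x = u b + s * (m2 nu' - dotp b b).
  move=> q bb; rewrite RintD; [|exact: intg_qborel
    |by apply: intgZ; apply: intg_qborel => //; exact: qborel_dist].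
  rewrite RintZ; last by apply: intg_qborel => //; exact: qborel_dist.
  rewrite (Rint_dist q bb)
    (@eq_Rintegral _ _ _ nu' setT (fun x => (u b - dotp (g b) b) + dotp (g b) x)); last first.
    by move=> x _; rewrite dotpBr; ring.
  rewrite RintD; [|exact: intg_cst|by apply: intg_qborel => //; exact: qborel_dotp].
  by rewrite Rint_cst Rint_dotp// -bb subrK.
have qA s : qborel (A s) by apply: qborelD => //; apply: qborelZ; exact: qborel_dist.
have up : \int[nu]_x u x <= \int[nu]_x A 2^-1 x.
  apply: Rint_le; [exact: intg_qborel..|] => x.
  by have := C11_1_upper ud gL b x; rewrite /A; lra.
have lo : \int[mu]_x A (- 2^-1) x <= \int[mu]_x u x.
  apply: Rint_le; [exact: intg_qborel..|] => x.
  by have := C11_1_lower ud gL b x; rewrite /A; lra.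
by move: up lo; rewrite !EA//; lra.
Qed.

Lemma C11_1_0 : C11_1 (fun _ : 'rV[R]_d => 0 : R^o).
Proof.
exists (fun=> 0); split => x; last by move=> y; rewrite subrr enorm_le dotp0l dotp_ge0.
split; first exact: differentiable_cst.
by move=> h; rewrite dotp0l (diff_cst (0 : R^o)).
Qed.

End convex_order.

(** * Third marginals and costs of admissible couplings *)

Section admissible_couplings.
Variables (R : realType) (d : nat).
Implicit Types (mu nu rho : probability (Rd R d) R) (pi : probability (Rd3 R d) R).

Lemma measurable_cx : measurable_fun setT (cx : Rd3 R d -> Rd R d).
Proof. exact: (measurableT_comp measurable_fst measurable_fst). Qed.

Lemma measurable_cy : measurable_fun setT (cy : Rd3 R d -> Rd R d).
Proof. exact: (measurableT_comp measurable_snd measurable_fst). Qed.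

Lemma measurable_cz : measurable_fun setT (cz : Rd3 R d -> Rd R d).
Proof. exact: measurable_snd. Qed.

Let msqr (k : Rd3 R d -> Rd R d) : measurable_fun setT k ->
  measurable_fun setT (fun t => dotp (k t : 'rV[R]_d) (k t)).
Proof. by move=> mk; exact: (measurableT_comp (@measurable_sqr R d) mk). Qed.

Lemma intg_qgrowth pi F : P2_3 pi -> measurable_fun setT F -> qgrowth F -> intg pi F.
Proof.
move=> p2 mF [C hC]; apply: (intg_le mF hC); apply: intgZ.
have -> : @sqnorms R d = (fun t => 1 + (dotp (cx t) (cx t) + dotp (cy t) (cy t) + dotp (cz t) (cz t))).
  by apply/funext => t; rewrite /sqnorms !addrA.
apply: intgD; first exact: finite_measure_integrable_cst.
have m : measurable_fun setT (fun t : Rd3 R d =>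
  dotp (cx t) (cx t) + dotp (cy t) (cy t) + dotp (cz t) (cz t)).
  by apply: measurable_funD; [apply: measurable_funD|]; apply: msqr;
    [exact: measurable_cx|exact: measurable_cy|exact: measurable_cz].
apply/integrableP; split; first exact/measurable_EFinP.
apply: le_lt_trans p2; rewrite le_eqVlt; apply/orP; left; apply/eqP.
by apply: eq_integral => t _ /=; rewrite !enorm_sqr ger0_norm// !addr_ge0// dotp_ge0.
Qed.

Lemma qgrowth_sqnorm (F : Rd3 R d -> R) : (forall t, `|F t| <= sqnorms t) -> qgrowth F.
Proof. by move=> h; exists 1 => t; rewrite mul1r. Qed.

Lemma cx_le (t : Rd3 R d) : dotp (cx t) (cx t) <= sqnorms t.
Proof. by rewrite /sqnorms; have := dotp_ge0 (cz t); have := dotp_ge0 (cy t); lra. Qed.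

Lemma cy_le (t : Rd3 R d) : dotp (cy t) (cy t) <= sqnorms t.
Proof. by rewrite /sqnorms; have := dotp_ge0 (cz t); have := dotp_ge0 (cx t); lra. Qed.

Lemma cz_le (t : Rd3 R d) : dotp (cz t) (cz t) <= sqnorms t.
Proof. by rewrite /sqnorms; have := dotp_ge0 (cx t); have := dotp_ge0 (cy t); lra. Qed.

Section dominated_coordinate.
Variable pi : probability (Rd3 R d) R.
Hypothesis p2 : P2_3 pi.
Variables (k : Rd3 R d -> Rd R d).
Hypothesis mk : measurable_fun setT k.
Hypothesis k_le : forall t, dotp (k t : 'rV[R]_d) (k t) <= sqnorms t.

Lemma intg_coord i : intg pi (fun t => (k t : 'rV[R]_d) ord0 i).
Proof.
apply: intg_qgrowth => //; first exact: (measurableT_comp (measurable_coord i) mk).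
apply: qgrowth_sqnorm => t; have := k_le t; have := sqr_coord_le (k t) i.
have := sqnorms_ge1 t; set a := (k t : 'rV[R]_d) ord0 i; rewrite expr2 => h1 h2 h3.
by rewrite ler_norml; apply/andP; split; nra.
Qed.

Lemma intg_sqnorm : intg pi (fun t => dotp (k t : 'rV[R]_d) (k t)).
Proof.
apply: intg_qgrowth => //; first exact: msqr.
by apply: qgrowth_sqnorm => t; rewrite ger0_norm// dotp_ge0.
Qed.

Variable mu : probability (Rd R d) R.
Hypothesis law_k : forall A : set (Rd R d), measurable A -> pi (k @^-1` A) = mu A.

Lemma law_P2 : P2 mu.
Proof.
rewrite /P2; under eq_integral do rewrite enorm_sqr.
rewrite -(law_integral mk law_k (@measurable_sqr R d)) Rint_EFin ?ltry//.
exact: intg_sqnorm.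
Qed.

Lemma law_m2 : \int[pi]_t dotp (k t : 'rV[R]_d) (k t) = m2 mu.
Proof. exact: (law_Rint mk law_k (@measurable_sqr R d)). Qed.

End dominated_coordinate.

Section drift.
Variable pi : probability (Rd3 R d) R.
Hypothesis p2 : P2_3 pi.
Variables (k : Rd3 R d -> Rd R d).
Hypothesis mk : measurable_fun setT k.
Hypothesis k_le : forall t, dotp (k t : 'rV[R]_d) (k t) <= sqnorms t.
Variables (mu rho : probability (Rd R d) R).
Hypothesis law_k : forall A : set (Rd R d), measurable A -> pi (k @^-1` A) = mu A.
Hypothesis law_z : marg3 pi rho.
Hypothesis drift : forall i, orth pi (fun t => cz t ord0 i - (k t : 'rV[R]_d) ord0 i) k.

Lemma orth_convex_order : cvx_ge rho mu.
Proof.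
apply/cvx_geP => phi cphi; have mphi := cvx_measurable cphi.
rewrite -(law_integral mk law_k mphi) -(law_integral measurable_cz law_z mphi).
apply: (jensen (h := k) (z := cz)) => // [|i|i].
- exact: measurable_cz.
- exact: intg_coord.
- exact: (intg_coord p2 measurable_cz cz_le).
Qed.

(** [|z - k|^2 = |z|^2 - |k|^2 - 2 <z - k, k>], and the last term has mean 0. The multiplier [k] is
    unbounded, which is why [orth_fun] asks only for an integrable product. *)
Lemma orth_sqdist : intg pi (fun t => dotp (cz t - k t) (cz t - k t)) /\
  \int[pi]_t dotp (cz t - k t) (cz t - k t) = m2 rho - m2 mu.
Proof.
have ik := intg_sqnorm p2 mk k_le; have iz := intg_sqnorm p2 measurable_cz cz_le.
have ic i : intg pi (fun t => (cz t ord0 i - (k t : 'rV[R]_d) ord0 i) * (k t : 'rV[R]_d) ord0 i).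
  apply: intg_qgrowth => //.
    apply: measurable_funM; last exact: (measurableT_comp (measurable_coord i) mk).
    by apply: measurable_funB; [exact: (measurableT_comp (measurable_coord i) measurable_cz)|
      exact: (measurableT_comp (measurable_coord i) mk)].
  exists 2 => t; have := k_le t; have := cz_le t; have := sqr_coord_le (k t) i.
  have := sqr_coord_le (cz t) i; set a := (k t : 'rV[R]_d) ord0 i; set b := cz t ord0 i.
  rewrite !expr2 => h1 h2 h3 h4; have := sqr_ge0 (a - b); have := sqr_ge0 (a + b).
  by rewrite !expr2 ler_norml => h5 h6; apply/andP; split; nra.
have ic' : intg pi (fun t =>
  2 * \sum_i (cz t ord0 i - (k t : 'rV[R]_d) ord0 i) * (k t : 'rV[R]_d) ord0 i).
  by apply: intgZ; exact: intg_sum.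
have E : (fun t => dotp (cz t - k t) (cz t - k t)) =
  (fun t => dotp (cz t) (cz t) - dotp (k t : 'rV[R]_d) (k t)
    - 2 * \sum_i (cz t ord0 i - (k t : 'rV[R]_d) ord0 i) * (k t : 'rV[R]_d) ord0 i).
  apply/funext => t; rewrite (_ : \sum_i _ = dotp (cz t - k t) (k t)); last first.
    by apply: eq_bigr => i _; rewrite !mxE.
  by rewrite !(dotpDl, dotpDr, dotpNl, dotpNr) (dotpC (k t)); ring.
have i0 := intgB (intgB iz ik) ic'.
rewrite E; split => //.
rewrite (RintB (intgB iz ik) ic') (RintB iz ik) (law_m2 mk law_k) (law_m2 measurable_cz law_z).
rewrite RintZ ?Rint_sum//; last exact: intg_sum.
rewrite big1 ?mulr0 ?subr0// => i _.
apply: (orth_fun (f := fun x : Rd R d => (x : 'rV[R]_d) ord0 i) (drift i)) => //.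
  by apply: intgB; [exact: (intg_coord p2 measurable_cz cz_le)|exact: intg_coord].
exact: measurable_coord.
Qed.

End drift.

Lemma Sigma_orth mu nu pi : Sigma mu nu pi ->
  forall i, orth pi (fun t => cz t ord0 i - cx t ord0 i) cx /\
            orth pi (fun t => cz t ord0 i - cy t ord0 i) cy.
Proof.
case=> p2 _ _ tx ty i; have iz := intg_coord p2 measurable_cz cz_le.
by split; [apply: (orth_of_testfun (h := cx) (z := cz) measurable_cx
             (intg_coord p2 measurable_cx cx_le) iz tx)|
           apply: (orth_of_testfun (h := cy) (z := cz) measurable_cy
             (intg_coord p2 measurable_cy cy_le) iz ty)].
Qed.

Lemma orth_Sigma mu nu pi : P2_3 pi -> marg1 pi mu -> marg2 pi nu ->
  (forall i, orth pi (fun t => cz t ord0 i - cx t ord0 i) cx /\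
             orth pi (fun t => cz t ord0 i - cy t ord0 i) cy) -> Sigma mu nu pi.
Proof.
move=> p2 m1 m2 o; have iz := intg_coord p2 measurable_cz cz_le.
split=> //.
  exact: (testfun_of_orth (h := cx) (z := cz) measurable_cx
    (intg_coord p2 measurable_cx cx_le) iz (fun i => (o i).1)).
exact: (testfun_of_orth (h := cy) (z := cz) measurable_cy
  (intg_coord p2 measurable_cy cy_le) iz (fun i => (o i).2)).
Qed.

Lemma marg3_exists pi : exists rho, marg3 pi rho.
Proof.
pose c : {mfun Rd3 R d >-> Rd R d} := mfun_Sub (mem_set measurable_cz).
by exists (distribution pi c).
Qed.

Lemma Sigma_marg3 mu nu rho pi : Sigma mu nu pi -> marg3 pi rho ->
  [/\ P2 rho, cvx_ge rho mu, cvx_ge rho nu &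
      (\int[pi]_t (cost t)%:E = (m2 rho - (m2 mu + m2 nu) / 2)%:E)%E].
Proof.
move=> S m3; have o := Sigma_orth S; have [p2 m1 m2' _ _] := S.
have ox i := (o i).1; have oy i := (o i).2.
split.
- exact: (law_P2 p2 measurable_cz cz_le m3).
- exact: (orth_convex_order p2 measurable_cx cx_le m1 m3 ox).
- exact: (orth_convex_order p2 measurable_cy cy_le m2' m3 oy).
have [ix Ex] := orth_sqdist p2 measurable_cx cx_le m1 m3 ox.
have [iy Ey] := orth_sqdist p2 measurable_cy cy_le m2' m3 oy.
rewrite (eq_integral (fun t => (2^-1 * (dotp (cz t - cx t) (cz t - cx t) +
   dotp (cz t - cy t) (cz t - cy t)))%:E)); last first.
  by move=> t _; rewrite /cost !enorm_sqr mulrC.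
rewrite Rint_EFin; last by apply: intgZ; exact: intgD.
congr EFin; rewrite RintZ; last exact: intgD.
by rewrite RintD// Ex Ey; lra.
Qed.

End admissible_couplings.

(** * The common value and its minimizers *)

Section value.
Variables (R : realType) (d : nat) (mu nu : probability (Rd R d) R).
Hypotheses (P2mu : P2 mu) (P2nu : P2 nu) (same_bary : bary mu = bary nu).

Let c := (m2 mu + m2 nu) / 2.
Let b := dotp (bary mu) (bary mu).

Lemma calI_fin_num : calI mu nu \is a fin_num.
Proof.
rewrite fin_numE; apply/andP; split; apply/eqP => H.
  have : (0 <= calI mu nu)%E.
    apply: ereal_sup_ubound; exists (fun=> 0); first exact: C11_1_0.
    by rewrite !integral0 sube0.
  by rewrite H.
have : (calI mu nu <= (c - b)%:E)%E.
  apply: ge_ereal_sup => _ [u uC <-].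
  rewrite !Rint_EFin; [|exact: intg_qborel (C11_1_qborel uC)..].
  by rewrite -EFinB lee_fin; exact: dual_bound.
by rewrite H.
Qed.

(** The dual value shifted to the scale of second moments: it is the least possible [m2 rho], while
    the variance and the cost are [m2 rho - b] and [m2 rho - c]. *)
Let D := fine (calI mu nu) + c.

Let calIE : calI mu nu = (D - c)%:E.
Proof. by rewrite /D addrK fineK// calI_fin_num. Qed.

Let D_ge u : C11_1 u -> \int[nu]_x u x - \int[mu]_x u x + c <= D.
Proof.
move=> uC; rewrite -lerBrDr -lee_fin -calIE EFinB -!Rint_EFin;
  [|exact: intg_qborel (C11_1_qborel uC)..].
by apply: ereal_sup_ubound; exists u.
Qed.

Let D_le (v : R) : (forall u, C11_1 u -> \int[nu]_x u x - \int[mu]_x u x + c <= v) -> D <= v.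
Proof.
move=> h; rewrite -(lerD2r (- c)) -lee_fin -calIE.
apply: ge_ereal_sup => _ [u uC <-].
rewrite !Rint_EFin; [|exact: intg_qborel (C11_1_qborel uC)..].
by rewrite -EFinB lee_fin lerBrDr; exact: h.
Qed.

Let m2_ge rho : P2 rho -> cvx_ge rho mu -> cvx_ge rho nu -> D <= m2 rho.
Proof. by move=> p2 gm gn; apply: D_le => u uC; exact: dual_le_primal. Qed.

Let varE_ge rho : P2 rho -> cvx_ge rho mu -> var rho = (m2 rho - b)%:E.
Proof. by move=> p2 gm; rewrite varE// (convex_order_bary P2mu p2 gm). Qed.

(** The coupling gives [m2 rho <= D], whatever second moment was lost on the way; as its third
    marginal dominates [mu] and [nu], weak duality gives [D <= m2 rho]. *)
Let optimal : exists pi rho, [/\ Sigma mu nu pi, marg3 pi rho & m2 rho = D].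
Proof.
have [pi [m1 m2' o p2 le_D]] := dual_coupling P2mu P2nu D_ge.
have S := orth_Sigma p2 m1 m2' o; have [rho m3] := marg3_exists pi.
exists pi, rho; split => //.
have [p2' gm gn _] := Sigma_marg3 S m3.
apply/eqP; rewrite eq_le m2_ge// andbT -lee_fin; apply: le_trans le_D.
by rewrite -(law_m2 (@measurable_cz R d) m3)
  -Rint_EFin//; exact: (intg_sqnorm p2 (@measurable_cz R d) (@cz_le R d)).
Qed.

Let calVE : calV mu nu = (D - b)%:E.
Proof.
have [pi [rho [S m3 E]]] := optimal; have [p2 gm gn _] := Sigma_marg3 S m3.
apply/eqP; rewrite eq_le; apply/andP; split.
  by apply: ereal_inf_lbound; exists rho => //; rewrite varE_ge// E.
apply: le_ereal_inf_tmp => _ [rho' [p2' [gm' gn']] <-].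
by rewrite varE_ge// lee_fin lerD2r m2_ge.
Qed.

Let calJE : calJ mu nu = (D - c)%:E.
Proof.
have [pi [rho [S m3 E]]] := optimal; have [_ _ _ cE] := Sigma_marg3 S m3.
apply/eqP; rewrite eq_le; apply/andP; split.
  by apply: ereal_inf_lbound; exists pi => //; rewrite cE E.
apply: le_ereal_inf_tmp => _ [pi' S' <-]; have [rho' m3'] := marg3_exists pi'.
have [p2' gm' gn' ->] := Sigma_marg3 S' m3'.
by rewrite lee_fin lerD2r m2_ge.
Qed.

Lemma value_identities :
  (calI mu nu = calV mu nu - (var mu + var nu) * (2^-1)%:E)%E /\
  (calV mu nu - (var mu + var nu) * (2^-1)%:E = calJ mu nu)%E.
Proof.
have -> : (calV mu nu - (var mu + var nu) * (2^-1)%:E = (D - c)%:E)%E.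
  rewrite calVE !varE// -same_bary.
  have <- : D - b - (m2 mu - b + (m2 nu - b)) / 2 = D - c by rewrite /c; field.
  by rewrite [RHS]EFinB EFinM EFinD.
by rewrite calIE calJE.
Qed.

Lemma minJ_minV pi rho : Sigma mu nu pi -> marg3 pi rho -> minJ mu nu pi <-> minV mu nu rho.
Proof.
move=> S m3; have [p2 gm gn cE] := Sigma_marg3 S m3.
rewrite /minJ /minV calJE calVE cE (varE_ge p2 gm); split.
  by move=> [_ [/addIr ->]]; split.
by move=> [_ _ _ [/addIr ->]]; split.
Qed.

Lemma minV_exists : exists rho, minV mu nu rho.
Proof.
have [pi [rho [S m3 E]]] := optimal; have [p2 gm gn _] := Sigma_marg3 S m3.
by exists rho; split => //; rewrite calVE varE_ge// E.
Qed.

(** The coupling with third marginal [rho] is a minimizer at once, since the cost depends on the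
    third marginal alone. *)
Lemma minV_coupling rho : minV mu nu rho -> exists pi : probability (Rd3 R d) R,
  [/\ minJ mu nu pi, marg1 pi mu, marg2 pi nu & marg3 pi rho].
Proof.
move=> mV; have [p2 /cvx_geP gm /cvx_geP gn _] := mV.
have [pi [m1 m2' m3 o p2']] := strassen P2mu P2nu p2 gm gn.
have S := orth_Sigma p2' m1 m2' o.
by exists pi; split => //; apply/(minJ_minV S m3).
Qed.

End value.

Theorem theorem1p3 (R : realType) (d : nat) (mu nu : probability (Rd R d) R) :
  P2 mu -> P2 nu -> bary mu = bary nu ->
  (* (i) *)
  ((calI mu nu = calV mu nu - (var mu + var nu) * (2^-1)%:E)%E /\
   (calV mu nu - (var mu + var nu) * (2^-1)%:E = calJ mu nu)%E /\
   (forall (pi : probability (Rd3 R d) R) (rho : probability (Rd R d) R),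
      Sigma mu nu pi -> marg3 pi rho ->
      (minJ mu nu pi <-> minV mu nu rho))) /\
  (* (ii) *)
  ((exists rho : probability (Rd R d) R, minV mu nu rho) /\
   (forall rho : probability (Rd R d) R, minV mu nu rho ->
      exists pi : probability (Rd3 R d) R,
        [/\ minJ mu nu pi, marg1 pi mu, marg2 pi nu & marg3 pi rho])).
Proof.
move=> P2mu P2nu same_bary.
have [IV VJ] := value_identities P2mu P2nu same_bary.
split; [split => //; split => //|split].
- by move=> pi rho; exact: minJ_minV.
- exact: minV_exists.
- by move=> rho; exact: minV_coupling.
Qed.
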